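(* Let $(\omega_i)_{i\in\mathbb{Z}}$ be i.i.d. with law $\eta$, and assume that there is $\varepsilon_0>0$ with $\eta(\varepsilon_0\le\omega_0\le 1-\varepsilon_0)=1$, that $\int \log\rho_0\,\eta(d\omega)=0$, and that $\operatorname{Var}(\log\rho_0)>0$, where $\rho_0=\frac{1-\omega_0}{\omega_0}$. Then the rate function $I^q_\eta$ of quenched large deviations of the random walk in random environment $(S_n)_{n\in\mathbb{N}}$ satisfies $$\lim_{\theta\to 0^+}(I^q_\eta)''(\theta)=+\infty .$$
   Context: Let $\omega=(\omega_i)_{i\in\mathbb{Z}}$ be a collection of i.i.d. random variables (the environment), with law $\eta$. Given $\omega$, the random walk in random environment (RWRE) $(S_n)_{n\in\mathbb{N}}$ is the nearest-neighbour Markov chain on $\mathbb{Z}$ with $S_0=0$ and, under the quenched law $P_\omega$, $P_\omega(S_{n+1}=i+1\mid S_n=i)=\omega_i$, $P_\omega(S_{n+1}=i-1\mid S_n=i)=1-\omega_i$. It is known (Greven and den Hollander) that the RWRE satisfies a quenched large deviation principle with a deterministic, nonnegative, convex rate function $I^q_\eta$: for $\eta$-almost every $\omega$ and every measurable set $A$, $$\liminf_{n\to\infty}\frac1n\log P_\omega\left(\frac{S_n}{n}\in A\right)\ge-\inf_{x\in A^\circ}I^q_\eta(x),\qquad \limsup_{n\to\infty}\frac1n\log P_\omega\left(\frac{S_n}{n}\in A\right)\le-\inf_{x\in\overline A}I^q_\eta(x),$$ where $A^\circ$ and $\overline A$ are the interior and closure of $A$. *)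

(* Defs.v *)
From HB Require Import structures.
From mathcomp Require Import all_boot all_order all_algebra finmap.
From mathcomp Require Import all_classical all_reals all_analysis.

Set Implicit Arguments.
Unset Strict Implicit.
Unset Printing Implicit Defensive.

Import Order.TTheory GRing.Theory Num.Theory.
Import numFieldNormedType.Exports.

Local Open Scope classical_set_scope.
Local Open Scope ring_scope.

Definition mutually_independent (d : measure_display) (Omega : measurableType d)
    (R : realType) (P : probability Omega R) (K : choiceType)
    (X : K -> {RV P >-> R}) : Prop :=
  forall (J : {fset K}) (B : K -> set R),
    (forall k, k \in J -> measurable (B k)) ->
    P (\bigcap_(k in [set` J]) (X k @^-1` B k)) =
    (\prod_(k <- J) P (X k @^-1` B k))%E.

Definition iid_with_law (d : measure_display) (Omega : measurableType d)
    (R : realType) (P : probability Omega R) (K : choiceType)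
    (X : K -> {RV P >-> R}) (eta : probability R R) : Prop :=
  mutually_independent X /\
  forall (k : K) (B : set R), measurable B -> distribution P (X k) B = eta B.

Definition log_rho (R : realType) (w : R) : R := ln ((1 - w) / w).

Definition rwre_step (R : realType) (e : int -> R) (i j : int) : R :=
  if j == i + 1 then e i else if j == i - 1 then 1 - e i else 0.

(* The Markov property is written multiplicatively, as
   Q(S_0 = x_0, ..., S_(n+1) = x_(n+1)) =
   Q(S_0 = x_0, ..., S_n = x_n) * rwre_step e x_n x_(n+1),
   to avoid conditioning on null events. *)
Definition is_rwre (R : realType) (e : int -> R) (d : measure_display)
    (T : measurableType d) (Q : probability T R) (S : nat -> T -> int) : Prop :=
  [/\ forall n k, measurable (S n @^-1` [set k]),
      Q (S 0%N @^-1` [set 0]) = 1%E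
    & forall (n : nat) (x : nat -> int),
        Q [set t | forall m, (m <= n.+1)%N -> S m t = x m] =
        (Q [set t | forall m, (m <= n)%N -> S m t = x m] *
         (rwre_step e (x n) (x n.+1))%:E)%E].

(* [Q e] is the quenched law P_e, on a space carrying the walk S. *)
Definition quenched_laws (R : realType) (d : measure_display)
    (T : measurableType d) (Q : (int -> R) -> probability T R)
    (S : nat -> T -> int) : Prop :=
  forall e : int -> R, (forall i, 0 <= e i <= 1) -> is_rwre e (Q e) S.

Definition speed_log_prob (R : realType) (d : measure_display)
    (T : measurableType d) (Q : probability T R) (S : nat -> T -> int)
    (A : set R) (n : nat) : \bar R :=
  ((n%:R^-1)%R%:E * lne (Q [set t | A ((S n t)%:~R / n%:R)%R]))%E.

Definition satisfies_ldp (R : realType) (d : measure_display)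
    (T : measurableType d) (Q : probability T R) (S : nat -> T -> int)
    (I : R -> \bar R) : Prop :=
  forall A : set R, measurable A ->
    (- ereal_inf (I @` A°) <= limn_einf (speed_log_prob Q S A))%E /\
    (limn_esup (speed_log_prob Q S A) <= - ereal_inf (I @` closure A))%E.

Definition is_convex_rate_function (R : realType) (I : R -> \bar R) : Prop :=
  [/\ forall x, (0 <= I x)%E,
      lower_semicontinuous I
    & forall (x y t : R), 0 <= t <= 1 ->
        (I (t * x + (1 - t) * y)%R
         <= t%:E * I x + (1 - t)%:E * I y)%E].

(* As I is deterministic, it is fixed before the environment is drawn. *)
Definition quenched_rate_function (d : measure_display)
    (Omega : measurableType d) (R : realType) (P : probability Omega R)
    (omega : int -> {RV P >-> R}) (d' : measure_display)
    (T : measurableType d') (Q : (int -> R) -> probability T R)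
    (S : nat -> T -> int) (I : R -> \bar R) : Prop :=
  is_convex_rate_function I /\
  {ae P, forall w, satisfies_ldp (Q (fun i => omega i w)) S I}.

(* Main.v *)
Require Import Defs.
From mathcomp Require Import all_boot all_order all_algebra finmap.
From mathcomp Require Import all_classical all_reals all_analysis.
From mathcomp Require Import measurable_realfun.
From mathcomp Require Import ring lra zify.

(** Let [lambda r] be the mean over the environment of
    [- ln (E_omega [exp (- r * tau)])], where [tau] is the time that the walk
    takes from a site to its right neighbour; [lyapunov] is this mean, as a limit
    over barriers that move away to the left.

    The products of the inverses of these generating functions form a function
    [h] of the site, with [h 0 = 1], such that the quenched walk satisfies
    [E_omega [h (S_n)] = exp (r * n)], and [h (c * n)] is
    [exp (c * n * lambda r + o(n))] by a law of large numbers ([cost_ae]).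
    Markov's inequality for [h (S_n)] gives [I theta >= theta * lambda r - r].
    Under the law tilted by [h], the functions [h] of slightly larger and
    slightly smaller [r] show that the walk has velocity [1 / lambda' r]
    ([walk_window_ge]), which gives equality at [theta = 1 / lambda' r]
    ([rateE]). Hence, for these [theta],
    [[
      I' theta = lambda r    and    I'' theta = (lambda' r)^3 / - lambda'' r,
    ]]
    and [theta] tends to [0] when [r] does. It remains to bound [lambda'] from
    below and [- lambda''] from above.

    Expanding the first-step recursion of the generating functions gives
    [lambda r = r + C0 - G (exp (- r))], where [G] is a bounded power series
    with nonnegative coefficients ([abs_monotone_lyapunov]). So [lambda] is
    smooth and concave, and [- lambda'' r <= C / r^2] by Cauchy-type estimates
    ([curvature_le]).

    For the lower bound, let [V] be the logarithm of one minus the generating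
    function. From one site to the next [V] makes a step [log_rho], except that
    it is pushed up near its minimum [ln (1 - exp (- r))], of order [ln r], and
    pushed down near its maximum [0] ([log_odds_step]). The first moment says
    that both pushes have mean [lambda r] in the limit, because [log_rho] is
    centered. In the second moment the push at depth [ln (1 / r)] has to
    compensate the variance [sigma^2] of [log_rho], so that
    [2 * ln (1 / r) * lambda r] tends to [sigma^2] ([lyapunov_asymptotics]):
    this is where recurrence and nondegeneracy enter.

    By concavity, [u^3 * lambda' (u^4) >= lambda (u^3) - lambda (u^4)], which is
    of order [sigma^2 / ln (1 / u)] ([slope_ge]). With [r = u^4],
    [(lambda' r)^3] is at least of order [r^(-9/4) / ln (1 / r)^3], which
    dominates the bound [C / r^2] of [- lambda'' r]
    ([curvature_ratio_large]). *)

Set Implicit Arguments.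
Unset Strict Implicit.
Unset Printing Implicit Defensive.
Import Order.TTheory GRing.Theory Num.Theory.
Import numFieldNormedType.Exports.
Local Open Scope classical_set_scope.
Local Open Scope ring_scope.

(** * Passage generating functions *)

Section passage.
Variable R : realType.
Implicit Types (z w y : R) (u : nat -> R).

(** First-step analysis: from a site that steps right with probability [w], the
    generating function at [z] of the passage time to the right neighbour is
    [F = z * w + z * (1 - w) * y * F], with [y] that of the left neighbour. *)
Definition hit_step z w y : R := z * w / (1 - z * (1 - w) * y).

(** Generating function at [z] of the passage time from [k - 1] to [k], on the
    event that [- 1] is not visited before; the barrier gives [hit z u 0 = 0]. *)
Fixpoint hit z u k : R :=
  if k is k'.+1 then hit_step z (u k') (hit z u k') else 0.

Lemma hit_den_gt0 z w y : 0 < z < 1 -> 0 < w < 1 -> 0 <= y <= z ->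
  0 < 1 - z * (1 - w) * y.
Proof.
move=> /andP[z0 z1] /andP[w0 w1] /andP[y0 yz].
have : z * (1 - w) <= 1 by nra.
nra.
Qed.

Lemma hit_stepE z w y : 0 < z < 1 -> 0 < w < 1 -> 0 <= y <= z ->
  hit_step z w y * (1 - z * (1 - w) * y) = z * w.
Proof.
by move=> hz hw hy; rewrite /hit_step divfK// gt_eqF// hit_den_gt0.
Qed.

Lemma hit_step_bound z w y : 0 < z < 1 -> 0 < w < 1 -> 0 <= y <= z ->
  z * w <= hit_step z w y <= z.
Proof.
move=> hz hw hy; have d0 := hit_den_gt0 hz hw hy.
move: (hz) (hw) (hy) => /andP[z0 z1] /andP[w0 w1] /andP[y0 yz].
rewrite /hit_step ler_pdivlMr// ler_pdivrMr//; apply/andP; split; last first.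
  have : z * y <= 1 by nra.
  by move=> zy; rewrite ler_pM2l//; nra.
rewrite -[leRHS]mulr1 ler_pM2l ?mulr_gt0//.
by have : 0 <= z * (1 - w) * y; [rewrite !mulr_ge0//; lra | lra].
Qed.

Lemma hit_step_mono z z' w y y' : 0 < z -> z <= z' -> z' < 1 -> 0 < w < 1 ->
  0 <= y -> y <= y' -> y <= z -> y' <= z' ->
  hit_step z w y <= hit_step z' w y'.
Proof.
move=> z0 zz z1 hw y0 yy yz yz'.
have d0 : 0 < 1 - z * (1 - w) * y by apply: hit_den_gt0 => //; lra.
have d0' : 0 < 1 - z' * (1 - w) * y' by apply: hit_den_gt0 => //; lra.
move: (hw) => /andP[w0 w1].
rewrite /hit_step; apply: ler_pM.
- by rewrite mulr_ge0// ltW.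
- by rewrite invr_ge0 ltW.
- by rewrite ler_pM2r.
rewrite lef_pV2 ?posrE// lerB// -2!mulrA; apply: ler_pM => //.
- exact: ltW.
- by rewrite mulr_ge0// subr_ge0 ltW.
- by rewrite ler_wpM2l// subr_ge0 ltW.
Qed.

(** Weighted by [(1 - y)^-1], the distance between two orbits shrinks by [z]. The
    weight is what makes this uniform: at [z = y = 1] the derivative of
    [hit_step] in [y] is [(1 - w) / w], which may exceed one. *)
Lemma hit_step_contract z w y y' :
  0 < z < 1 -> 0 < w < 1 -> 0 <= y <= z -> 0 <= y' <= z ->
  `|hit_step z w y - hit_step z w y'| * (1 - y)
    <= z * (1 - hit_step z w y) * `|y - y'|.
Proof.
move=> hz hw hy hy'.
have /andP[lF uF] := hit_step_bound hz hw hy.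
have /andP[lF' uF'] := hit_step_bound hz hw hy'.
have eF := hit_stepE hz hw hy; have eF' := hit_stepE hz hw hy'.
set F := hit_step z w y in eF lF uF *; set F' := hit_step z w y' in eF' lF' uF' *.
move: (hz) (hw) (hy) (hy') => /andP[z0 z1] /andP[w0 w1] /andP[y0 yz] /andP[y0' yz'].
have zw0 : 0 < z * w by rewrite mulr_gt0.
have F0 : 0 < F by lra.
have F0' : 0 < F' by lra.
have dF : w * (F - F') = (1 - w) * F * F' * (y - y').
  apply: (mulfI (lt0r_neq0 z0)).
  rewrite (_ : z * (w * (F - F')) = (z * w) * F - (z * w) * F'); last by ring.
  by rewrite -{1}eF' -{1}eF; ring.
have dn : w * `|F - F'| = (1 - w) * F * F' * `|y - y'|.
  rewrite -[w in LHS]gtr0_norm// -normrM dF normrM; congr (_ * _).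
  have w10 : 0 < 1 - w by lra.
  by rewrite gtr0_norm//; apply: mulr_gt0 => //; apply: mulr_gt0.
rewrite -(ler_pM2l w0) mulrA dn.
rewrite (_ : _ * _ * (1 - y) = ((1 - w) * F * F' * (1 - y)) * `|y - y'|); last by ring.
rewrite (_ : w * _ = (w * (z * (1 - F))) * `|y - y'|); last by ring.
apply: ler_wpM2r => //.
(* [z (1 - F) = F ((1 - z (1 - w) y) / w - z)] *)
have key : (1 - w) * (1 - y) * F <= w * z * (1 - F).
  have -> : w * z * (1 - F) = F * (1 - z * (1 - w) * y - w * z).
    by rewrite mulrBr mulr1 mulrC -{1}eF; ring.
  rewrite mulrC; apply: ler_wpM2l; first exact: ltW.
  have : 0 <= (1 - z) * (w + (1 - w) * y) by apply: mulr_ge0; [lra | nra].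
  by nra.
rewrite [w * (z * _)]mulrA; apply: le_trans key.
rewrite (_ : _ * (1 - y) = ((1 - w) * (1 - y) * F) * F'); last by ring.
rewrite -[leRHS]mulr1; apply: ler_wpM2l; last by lra.
by apply: mulr_ge0; [apply: mulr_ge0; lra | lra].
Qed.

Lemma hit_bound z u k : 0 < z < 1 -> (forall i, 0 < u i < 1) ->
  0 <= hit z u k <= z.
Proof.
move=> hz hu; elim: k => [|k IH] /=; first by rewrite lexx /=; lra.
have := hit_step_bound hz (hu k) IH.
move: (hz) (hu k) => /andP[z0 _] /andP[u0 _].
by have : 0 <= z * u k; [rewrite mulr_ge0 ?ltW | lra].
Qed.

Lemma hitS_bound z u k : 0 < z < 1 -> (forall i, 0 < u i < 1) ->
  z * u k <= hit z u k.+1 <= z.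
Proof. by move=> hz hu; apply: hit_step_bound => //; exact: hit_bound. Qed.

Lemma hit_mono z z' u k : 0 < z -> z <= z' -> z' < 1 ->
  (forall i, 0 < u i < 1) -> hit z u k <= hit z' u k.
Proof.
move=> z0 zz z1 hu; elim: k => [|k IH] //=.
have hz : 0 < z < 1 by lra.
have hz' : 0 < z' < 1 by lra.
have /andP[? ?] := hit_bound k hz hu; have /andP[? ?] := hit_bound k hz' hu.
exact: hit_step_mono.
Qed.

(** Moving the barrier to the right kills more paths. *)
Lemma hit_restart_le z u b k : 0 < z < 1 -> (forall i, 0 < u i < 1) ->
  hit z (fun i => u (b + i)%N) k <= hit z u (b + k).
Proof.
move=> hz hu; elim: k => [|k IH]; first by have /andP[] := hit_bound (b + 0) hz hu.
have hv i : 0 < u (b + i)%N < 1 by exact: hu.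
have /andP[h1 h2] := @hit_bound z (fun i => u (b + i)%N) k hz hv.
have /andP[h3 h4] := hit_bound (b + k) hz hu.
by rewrite addnS /=; case/andP: (hz) => ? ?; exact: hit_step_mono.
Qed.

(** The weights of [hit_step_contract] telescope along the recursion, so passage
    from a site forgets the environment to its left geometrically fast. *)
Lemma hit_forget z u b k : 0 < z < 1 -> (forall i, 0 < u i < 1) ->
  `|hit z u (b + k) - hit z (fun i => u (b + i)%N) k| <= z ^+ k / (1 - z).
Proof.
move=> hz hu; set v := fun i => _.
have hv i : 0 < v i < 1 by exact: hu.
have z1 : 0 < 1 - z by lra.
have z0 : 0 < z by lra.
suff H : `|hit z u (b + k) - hit z v k| * (1 - z) <=
    z ^+ k * (1 - hit z u (b + k)).
  rewrite ler_pdivlMr//; apply: le_trans H _.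
  have zk0 : 0 <= z ^+ k by apply: exprn_ge0; exact: ltW.
  have /andP[? _] := hit_bound (b + k) hz hu.
  by rewrite ler_piMr//; lra.
elim: k => [|k IH].
  rewrite addn0 expr0 mul1r/= subr0.
  have /andP[h0 hz'] := hit_bound b hz hu.
  by rewrite ger0_norm//; nra.
rewrite addnS /= -/(v k).
have h1 := hit_bound (b + k) hz hu; have h2 := hit_bound k hz hv.
have c := hit_step_contract hz (hv k) h1 h2; rewrite -/(v k) in c.
set D := `|hit_step _ _ _ - _| in c *.
set d := `|hit z u _ - _| in c IH.
set y := hit z u (b + k) in c IH h1 *.
set F := hit_step z _ y in c *.
have y1 : 0 < 1 - y by lra.
have F1 : 0 <= 1 - F.
  by have /andP[_] := hit_step_bound hz (hv k) h1; rewrite -/F; lra.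
rewrite -(ler_pM2r y1).
apply: (@le_trans _ _ (z * (1 - F) * d * (1 - z))).
  by rewrite mulrAC; apply: ler_wpM2r c; lra.
rewrite -mulrA exprS.
rewrite (_ : z * z ^+ k * (1 - F) * (1 - y) =
  z * (1 - F) * (z ^+ k * (1 - y))); last by ring.
by apply: ler_wpM2l => //; rewrite mulr_ge0// ltW.
Qed.

End passage.

(** * The walk at a fixed time *)

Section walk.
Variable R : realType.
Implicit Types (e : int -> R) (f g : int -> R).

(** Expectation of [f] at time [n] for the walk started at [x], by the backward
    equation: estimates become inductions that involve no path measure. *)
Fixpoint walk_mean e n f (x : int) : R :=
  if n is n'.+1
  then e x * walk_mean e n' f (x + 1) + (1 - e x) * walk_mean e n' f (x - 1)
  else f x.

Lemma le_walk_mean e n f g x : (forall i, 0 <= e i <= 1) ->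
  (forall i, f i <= g i) -> walk_mean e n f x <= walk_mean e n g x.
Proof.
move=> he fg; elim: n x => [|n IH] x /=; first exact: fg.
have /andP[e0 e1] := he x.
by apply: lerD; apply: ler_wpM2l => //; rewrite subr_ge0.
Qed.

Lemma walk_meanD e n f g x : walk_mean e n (fun i => f i + g i) x =
  walk_mean e n f x + walk_mean e n g x.
Proof. by elim: n x => [|n IH] x //=; rewrite !IH; ring. Qed.

Lemma walk_meanZ e n c f x : walk_mean e n (fun i => c * f i) x =
  c * walk_mean e n f x.
Proof. by elim: n x => [|n IH] x //=; rewrite !IH; ring. Qed.

(** Harmonicity is asked for only at the sites that can be left within [n] steps
    from [x]; this allows for harmonic functions that vanish to the left of a
    barrier. *)
Lemma walk_mean_harmonic e n h c (b x : int) :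
  (forall i, b <= i -> e i * h (i + 1) + (1 - e i) * h (i - 1) = c * h i) ->
  b + n%:Z <= x + 1 -> walk_mean e n h x = c ^+ n * h x.
Proof.
move=> hh; elim: n x => [|n IH] x /= bx; first by rewrite expr0 mul1r.
have bx1 : b <= x by lia.
rewrite !IH; [|lia..].
by rewrite mulrCA [X in _ + X]mulrCA -mulrDr hh// exprSr mulrA.
Qed.

Lemma walk_mean_ge0 e n f x : (forall i, 0 <= e i <= 1) ->
  (forall i, 0 <= f i) -> 0 <= walk_mean e n f x.
Proof.
move=> he f0; elim: n x => [|n IH] x //=; have /andP[? ?] := he x.
by rewrite addr_ge0// mulr_ge0// subr_ge0.
Qed.

End walk.

Section path_measure.
Context d (T : measurableType d) (R : realType) (Q : probability T R).
Variables (e : int -> R) (S : nat -> T -> int).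
Hypotheses (rwre : is_rwre e Q S) (he : forall i, 0 <= e i <= 1).

Let prefix (x : nat -> int) n := [set t | forall m, (m <= n)%N -> S m t = x m].

(** Only the fibres of the walk are given as measurable, but [int] is
    countable. *)
Lemma measurable_walk n (A : set int) : measurable (S n @^-1` A).
Proof.
have [mS _ _] := rwre.
pose F (k : nat) := if choice.unpickle k is Some x then
  (if x \in A then S n @^-1` [set x] else set0) else set0.
have -> : S n @^-1` A = \bigcup_k F k.
  apply/seteqP; split => [t At|t [k _]].
    by exists (choice.pickle (S n t)) => //; rewrite /F choice.pickleK; case: ifPn => // /negP; rewrite inE.
  by rewrite /F; case: (choice.unpickle k) => // y; case: ifPn => //; rewrite inE => Ay /= ->.
apply: bigcupT_measurable => k; rewrite /F.
by case: (choice.unpickle k) => // y; case: ifP.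
Qed.

Let measurable_prefix x n : measurable (prefix x n).
Proof.
have -> : prefix x n = \bigcap_(m in [set m | (m <= n)%N]) S m @^-1` [set x m] by [].
by apply: bigcap_measurableType => m _; exact: measurable_walk.
Qed.

Let extend (x : nat -> int) j y m : int := if (m <= j)%N then x m else y.

Let prefix_extend x j y :
  prefix (extend x j y) j.+1 = prefix x j `&` S j.+1 @^-1` [set y].
Proof.
apply/seteqP; split => [t H|t [H Hy] m].
  split => [m mj|]; first by rewrite H ?(leq_trans mj)// /extend mj.
  by rewrite /= H// /extend ltnn.
rewrite leq_eqVlt => /orP[/eqP ->|]; first by rewrite Hy /extend ltnn.
by rewrite ltnS => mj; rewrite H// /extend mj.
Qed.

Let prob_extend x j y : Q (prefix x j `&` S j.+1 @^-1` [set y]) =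
  (Q (prefix x j) * (rwre_step e (x j) y)%:E)%E.
Proof.
have [_ _ mk] := rwre; rewrite -prefix_extend [LHS]mk.
have -> : [set t | forall m, (m <= j)%N -> S m t = extend x j y m] = prefix x j.
  by apply/seteqP; split => t H m mj; rewrite H// /extend mj.
by rewrite /extend leqnn ltnn.
Qed.

(** Induction over the remaining steps, with the past prescribed, since the
    Markov property of [is_rwre] speaks of probabilities of whole paths. *)
Let prob_prefix_walk (A : set int) k : forall x j,
  Q (prefix x j `&` S (j + k)%N @^-1` A) =
  (Q (prefix x j) * (walk_mean e k \1_A (x j))%:E)%E.
Proof.
elim: k => [|k IH] x j.
  rewrite addn0 /= indicE; case: (boolP (x j \in A)) => xA.
    rewrite mule1; congr (Q _); apply/setIidPl => t H /=.
    by rewrite H//; rewrite inE in xA.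
  rewrite mule0 (_ : _ `&` _ = set0) ?measure0//; apply/seteqP; split => // t [H /=].
  by rewrite H//; move/negP: xA; rewrite inE.
set E := _ `&` _.
pose a := prefix x j `&` S j.+1 @^-1` [set x j + 1].
pose b := prefix x j `&` S j.+1 @^-1` [set x j - 1].
have mp := measurable_prefix x j.
have ma : measurable a by apply: measurableI => //; exact: measurable_walk.
have mb : measurable b by apply: measurableI => //; exact: measurable_walk.
have mE : measurable E by apply: measurableI => //; exact: measurable_walk.
have ne : (x j + 1 == x j - 1) = false by apply/negbTE/eqP; lia.
have ab0 : a `&` b = set0.
  apply/seteqP; split => // t [[_ /= h1] [_ /= h2]].
  by move: ne; rewrite -h1 h2 eqxx.
have step y : Q (E `&` (prefix x j `&` S j.+1 @^-1` [set y])) =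
    (Q (prefix x j) * (rwre_step e (x j) y)%:E * (walk_mean e k \1_A y)%:E)%E.
  rewrite -prob_extend -prefix_extend.
  have := IH (extend x j y) j.+1; rewrite /extend ltnn => <-; congr (Q _).
  rewrite -/(extend x j y) prefix_extend /E addSnnS.
  by apply/seteqP; split=> t; rewrite /=; tauto.
have [ex0 ex1] : 0 <= e (x j) /\ 0 <= 1 - e (x j).
  by have /andP[? ?] := he (x j); rewrite subr_ge0.
have stepp : rwre_step e (x j) (x j + 1) = e (x j) by rewrite /rwre_step eqxx.
have stepm : rwre_step e (x j) (x j - 1) = 1 - e (x j).
  by rewrite /rwre_step eq_sym ne eqxx.
have Qab : Q (a `|` b) = Q (prefix x j).
  transitivity (Q a + Q b)%E; first exact: measureU.
  rewrite /a /b !prob_extend stepp stepm.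
  by rewrite -ge0_muleDr ?lee_fin// -EFinD addrC subrK mule1.
(* The two neighbours exhaust the mass, so the other positions are null. *)
have Q0 : Q (E `\` (a `|` b)) = 0%E.
  apply: (@subset_measure0 _ _ _ Q _ (prefix x j `\` (a `|` b))).
  - by apply: measurableD => //; exact: measurableU.
  - by apply: measurableD => //; exact: measurableU.
  - by move=> t [[]].
  transitivity (Q (prefix x j) - Q (prefix x j `&` (a `|` b)))%E.
    apply: measureD => //; first exact: measurableU.
    by rewrite ltey_eq fin_num_measure.
  rewrite (_ : _ `&` _ = a `|` b); first by rewrite Qab subee// fin_num_measure.
  by apply: setIidr => t [[]|[]].
rewrite (measureDI Q mE (measurableU _ _ ma mb)) [X in (X + _)%E = _]Q0 add0e setIUr.
transitivity (Q (E `&` a) + Q (E `&` b))%E; first apply: measureU.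
- exact: measurableI.
- exact: measurableI.
- by rewrite setIACA setIid ab0 setI0.
- rewrite !step stepp stepm -!muleA -!EFinM -ge0_muleDr ?lee_fin.
  + by rewrite -EFinD.
  + by rewrite mulr_ge0//; apply: walk_mean_ge0.
  + by rewrite mulr_ge0//; apply: walk_mean_ge0.
Qed.

Lemma prob_walk n (A : set int) :
  Q (S n @^-1` A) = (walk_mean e n \1_A 0)%:E.
Proof.
have [_ S0 _] := rwre.
have p0 : prefix (fun=> 0) 0 = S 0%N @^-1` [set 0].
  by apply/seteqP; split => t H; [exact: H|case].
have := prob_prefix_walk A n (fun=> 0) 0.
rewrite add0n p0 S0 mul1e => <-.
have m0 : measurable (S 0%N @^-1` [set 0]) by exact: measurable_walk.
have mA := measurable_walk n A.
rewrite (measureDI Q mA m0) setIC [X in (X + _)%E](_ : _ = 0%E) ?add0e//.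
apply: (@subset_measure0 _ _ _ Q _ (~` (S 0%N @^-1` [set 0]))) => //.
- exact: measurableD.
- exact: measurableC.
- transitivity (1 - Q (S 0%N @^-1` [set 0%R]))%E; first exact: probability_setC.
  by rewrite S0 subee.
Qed.

End path_measure.

(** * Harmonic functions and exponential tilting *)

Section harmonic.
Variable R : realType.
Implicit Types (z : R) (u : nat -> R) (e : int -> R).

(** Inverse of the generating function of the passage time from [0] to [k], as
    successive passages are independent in a fixed environment. *)
Fixpoint harmonic z u k : R :=
  if k is k'.+1 then harmonic z u k' / hit z u k else 1.

Lemma harmonicS z u k :
  harmonic z u k.+1 = harmonic z u k / hit z u k.+1.
Proof. by []. Qed.

Lemma hitS z u k : hit z u k.+1 = hit_step z (u k) (hit z u k).
Proof. by []. Qed.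

(** The growth of [ln harmonic] from [n] to [n + m] ([harmonic_cost]), in the
    form of a sum to which laws of large numbers apply. *)
Definition cost z u n m : R := \sum_(i < m) - ln (hit z u (n + i).+1).

Lemma hitS_gt0 z u k : 0 < z < 1 -> (forall i, 0 < u i < 1) ->
  0 < hit z u k.+1.
Proof.
move=> hz hu; have /andP[+ _] := hitS_bound k hz hu; apply: lt_le_trans.
by move: (hu k) => /andP[? _]; apply: mulr_gt0 => //; lra.
Qed.

Lemma harmonic_gt0 z u k : 0 < z < 1 -> (forall i, 0 < u i < 1) ->
  0 < harmonic z u k.
Proof.
move=> hz hu; elim: k => [|k IH]; first exact: ltr01.
by apply: divr_gt0 => //; exact: hitS_gt0.
Qed.

Lemma harmonic_cost z u n m : 0 < z < 1 -> (forall i, 0 < u i < 1) ->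
  harmonic z u (n + m) = harmonic z u n * expR (cost z u n m).
Proof.
move=> hz hu; elim: m => [|m IH]; first by rewrite addn0 /cost big_ord0 expR0 mulr1.
rewrite addnS /cost big_ord_recr/= -/(cost z u n m) expRD mulrA -IH expRN lnK//.
by rewrite posrE; exact: (hitS_gt0 _ hz hu).
Qed.

Lemma harmonic_nondecreasing z u k l : 0 < z < 1 -> (forall i, 0 < u i < 1) ->
  (k <= l)%N -> harmonic z u k <= harmonic z u l.
Proof.
move=> hz hu /subnKC <-; elim: (l - k)%N => [|m IH]; first by rewrite addn0.
apply: le_trans IH _; rewrite addnS.
have g0 := harmonic_gt0 (k + m) hz hu; have h0 := hitS_gt0 (k + m) hz hu.
have /andP[_ h1] := hitS_bound (k + m) hz hu.
rewrite harmonicS ler_pdivlMr//; rewrite -[leRHS]mulr1.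
by apply: ler_wpM2l; [exact: ltW|apply: le_trans h1 _; lra].
Qed.

(** Ratios of the harmonic functions of two rates are monotone in the site,
    because each factor [hit] is monotone in [z]. *)
Lemma harmonic_cross z z' u k l : 0 < z -> z <= z' -> z' < 1 ->
  (forall i, 0 < u i < 1) -> (k <= l)%N ->
  harmonic z u k * harmonic z' u l <= harmonic z u l * harmonic z' u k.
Proof.
move=> z0 zz z1 hu /subnKC <-; elim: (l - k)%N => [|m IH].
  by rewrite addn0 mulrC.
have hz : 0 < z < 1 by lra.
have hz' : 0 < z' < 1 by lra.
have h0 := hitS_gt0 (k + m) hz hu; have h0' := hitS_gt0 (k + m) hz' hu.
have hh : hit z u (k + m).+1 <= hit z' u (k + m).+1 by exact: hit_mono.
have g0 := harmonic_gt0 k hz hu; have g0' := harmonic_gt0 (k + m) hz' hu.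
rewrite addnS !harmonicS mulrA [leRHS]mulrAC; apply: ler_pM => //.
- by rewrite mulr_ge0 ?ltW.
- by rewrite invr_ge0 ltW.
- by rewrite lef_pV2 ?posrE.
Qed.

(** [harmonic] on the integers, normalised at the starting point [0]; the barrier
    at [- n - 1] is out of reach within [n] steps. *)
Definition space_harmonic z e n (x : int) : R :=
  let u i := e (i%:Z - n%:Z) in
  if x + n%:Z is Posz k then harmonic z u k / harmonic z u n else 0.

Lemma space_harmonic_pos z e n m (u := fun i : nat => e (i%:Z - n%:Z)) :
  0 < z < 1 -> (forall i, 0 < e i < 1) ->
  space_harmonic z e n m%:Z = expR (cost z u n m).
Proof.
move=> hz he; rewrite /space_harmonic -PoszD addnC harmonic_cost//.
have g0 := @harmonic_gt0 z u n hz (fun i => he _).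
by rewrite mulrC mulKf// gt_eqF.
Qed.

Lemma space_harmonic_ge0 z e n x : 0 < z < 1 -> (forall i, 0 < e i < 1) ->
  0 <= space_harmonic z e n x.
Proof.
move=> hz he; rewrite /space_harmonic; case: (x + n%:Z) => // k.
by apply: divr_ge0; apply: ltW; apply: harmonic_gt0.
Qed.

Lemma space_harmonicP z e n (i : int) : 0 < z < 1 -> (forall i, 0 < e i < 1) ->
  - n%:Z <= i ->
  e i * space_harmonic z e n (i + 1) + (1 - e i) * space_harmonic z e n (i - 1)
  = z^-1 * space_harmonic z e n i.
Proof.
move=> hz he ni; set u := fun i : nat => e (i%:Z - n%:Z).
have hu j : 0 < u j < 1 by exact: he.
have [k ik] : exists k : nat, i = k%:Z - n%:Z.
  by exists (absz (i + n%:Z)); lia.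
have -> : e i = u k by rewrite ik.
rewrite /space_harmonic.
have -> : i + 1 + n%:Z = k.+1 by lia.
have -> : i + n%:Z = k by lia.
rewrite -/u.
have gn := harmonic_gt0 n hz hu.
have -> : (if i - 1 + n%:Z is Posz k then harmonic z u k / harmonic z u n else 0)
   = harmonic z u k * hit z u k / harmonic z u n.
  case: k ik => [|k] ik.
    have -> : i - 1 + n%:Z = Negz 0 by rewrite NegzE; lia.
    by rewrite /= mulr0 mul0r.
  have -> : i - 1 + n%:Z = k by lia.
  rewrite harmonicS divfK//; apply: lt0r_neq0; exact: (hitS_gt0 k hz hu).
have h0 := hitS_gt0 k hz hu.
have hk := hit_stepE hz (hu k) (hit_bound k hz hu).
rewrite harmonicS.
have z0 : 0 < z by lra.
have g0 := harmonic_gt0 k hz hu.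
rewrite -hitS in hk.
rewrite 2![_ * (_ / harmonic z u n)]mulrA -mulrDl [RHS]mulrA; congr (_ / _).
have F0 := lt0r_neq0 h0; have z0' := lt0r_neq0 z0.
move: hk F0; set w := u k; set y := hit z u k; set F := hit z u k.+1; set g := harmonic z u k.
move=> hk F0.
have eu : w / F = (1 - z * (1 - w) * y) / z.
  by apply/eqP; rewrite eqr_div// [X in _ == X]mulrC hk mulrC.
rewrite [w * _](_ : _ = g * (w / F)); last by ring.
by rewrite eu; field.
Qed.

Lemma space_harmonic0 z e n : 0 < z < 1 -> (forall i, 0 < e i < 1) ->
  space_harmonic z e n 0 = 1.
Proof. by move=> hz he; rewrite (space_harmonic_pos _ 0)// /cost big_ord0 expR0. Qed.

Lemma space_harmonic_nondecreasing z e n (x y : int) :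
  0 < z < 1 -> (forall i, 0 < e i < 1) -> x <= y ->
  space_harmonic z e n x <= space_harmonic z e n y.
Proof.
move=> hz he xy; rewrite {1}/space_harmonic.
case xn : (x + n%:Z) => [k|k]; last exact: space_harmonic_ge0.
rewrite /space_harmonic (_ : y + n%:Z = (k + absz (y - x))%N :> int); last by lia.
rewrite ler_pM2r ?invr_gt0 ?harmonic_gt0//.
by apply: harmonic_nondecreasing => //; exact: leq_addr.
Qed.

Lemma space_harmonic_cross z z' e n (x y : int) :
  0 < z -> z <= z' -> z' < 1 -> (forall i, 0 < e i < 1) -> x <= y ->
  space_harmonic z e n x * space_harmonic z' e n y <=
  space_harmonic z e n y * space_harmonic z' e n x.
Proof.
move=> z0 zz z1 he xy.
have hz : 0 < z < 1 by lra.
have hz' : 0 < z' < 1 by lra.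
rewrite /space_harmonic.
case xn : (x + n%:Z) => [k|k]; last by rewrite mul0r mulr0.
rewrite (_ : y + n%:Z = (k + absz (y - x))%N :> int); last by lia.
rewrite mulrACA [leRHS]mulrACA ler_pM2r.
  by apply: harmonic_cross => //; exact: leq_addr.
by rewrite mulr_gt0// invr_gt0 harmonic_gt0.
Qed.

Lemma walk_mean_space_harmonic z e n : 0 < z < 1 -> (forall i, 0 < e i < 1) ->
  walk_mean e n (space_harmonic z e n) 0 = z^-1 ^+ n.
Proof.
move=> hz he; rewrite (@walk_mean_harmonic _ _ _ _ z^-1 (- n%:Z)).
- by rewrite space_harmonic0// mulr1.
- by move=> i ni; exact: space_harmonicP.
- by lia.
Qed.

(** Markov's inequality for the increasing function [space_harmonic]. *)
Lemma walk_right_le z e n m (u := fun i : nat => e (i%:Z - n%:Z)) :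
  0 < z < 1 -> (forall i, 0 < e i < 1) ->
  walk_mean e n \1_[set x | m%:Z <= x] 0 <= z^-1 ^+ n * expR (- cost z u n m).
Proof.
move=> hz he; rewrite -(walk_mean_space_harmonic n hz he) mulrC -walk_meanZ.
apply: le_walk_mean => [i|x]; first by move: (he i) => /andP[? ?]; rewrite !ltW.
rewrite indicE; case: (boolP (x \in _)) => [|_].
  rewrite inE /= => mx; rewrite expRN -(space_harmonic_pos _ _ hz he).
  rewrite ler_pdivlMl ?mulr1; first exact: space_harmonic_nondecreasing.
  by rewrite space_harmonic_pos// expR_gt0.
by rewrite mulr_ge0 ?expR_ge0// space_harmonic_ge0.
Qed.

(** Exponential tilting by [space_harmonic z]: tails of the tilted law are
    estimated with the harmonic functions of a larger and of a smaller rate. *)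
Lemma walk_window_ge z z1 z2 e n m1 m2 (u := fun i : nat => e (i%:Z - n%:Z)) :
  0 < z2 -> z2 <= z -> z <= z1 -> z1 < 1 -> (forall i, 0 < e i < 1) ->
  z^-1 ^+ n <=
    z1^-1 ^+ n * expR (cost z u n m1 - cost z1 u n m1) +
    z2^-1 ^+ n * expR (cost z u n m2 - cost z2 u n m2) +
    expR (cost z u n m2) *
      walk_mean e n \1_[set x | m1%:Z < x < m2%:Z] 0.
Proof.
move=> z20 z2z zz1 z11 he.
have hz : 0 < z < 1 by lra.
have hz1 : 0 < z1 < 1 by lra.
have hz2 : 0 < z2 < 1 by lra.
rewrite -(walk_mean_space_harmonic n hz he) -(walk_mean_space_harmonic n hz1 he).
rewrite -(walk_mean_space_harmonic n hz2 he).
rewrite [_ * expR (_ - cost z1 u n m1)]mulrC [_ * expR (_ - cost z2 u n m2)]mulrC.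
rewrite -!walk_meanZ -!walk_meanD.
apply: le_walk_mean => [i|x]; first by move: (he i) => /andP[? ?]; rewrite !ltW.
have c1 := expR_ge0 (cost z u n m1 - cost z1 u n m1).
have c2 := expR_ge0 (cost z u n m2 - cost z2 u n m2).
have c3 := expR_ge0 (cost z u n m2).
have h1 := @space_harmonic_ge0 z1 e n x hz1 he.
have h2 := @space_harmonic_ge0 z2 e n x hz2 he.
have i0 : 0 <= \1_[set x | m1%:Z < x < m2%:Z] x :> R by rewrite indicE ler0n.
case: (lerP x m1%:Z) => xm1.
  rewrite -addrA ler_wpDr ?addr_ge0 ?mulr_ge0//.
  rewrite expRD expRN -!(space_harmonic_pos _ _ _ he)// mulrAC ler_pdivlMr.
    by apply: space_harmonic_cross => //; lra.
  by rewrite space_harmonic_pos// expR_gt0.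
case: (lerP m2%:Z x) => xm2.
  rewrite addrAC ler_wpDl ?addr_ge0 ?mulr_ge0//.
  rewrite expRD expRN -!(space_harmonic_pos _ _ _ he)// mulrAC ler_pdivlMr.
    by rewrite mulrC [leRHS]mulrC; apply: space_harmonic_cross => //; lra.
  by rewrite space_harmonic_pos// expR_gt0.
rewrite ler_wpDl ?addr_ge0 ?mulr_ge0//.
rewrite indicE mem_set ?mulr1; last by rewrite /= xm1.
rewrite -(space_harmonic_pos _ _ hz he).
by apply: space_harmonic_nondecreasing => //; exact: ltW.
Qed.

End harmonic.

(** * Expectations of bounded random variables *)

Section rectangles.
Context d1 d2 (T1 : measurableType d1) (T2 : measurableType d2) (R : realType).

(** Rectangles form a pi-system that generates the product sigma-algebra. *)
Lemma rectangle_measure_unique (m1 m2 : {measure set (T1 * T2) -> \bar R}) :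
  (m1 setT < +oo)%E ->
  (forall A B, measurable A -> measurable B -> m1 (A `*` B) = m2 (A `*` B)) ->
  forall M, measurable M -> m1 M = m2 M.
Proof.
move=> m1oo m12 M mM.
pose C : set (set (T1 * T2)) :=
  [set C | exists A, measurable A /\ exists B, measurable B /\ C = A `*` B].
have CI : setI_closed C.
  move=> /= _ _ [X1 [mX1 [X2 [mX2 ->]]]] [Y1 [mY1 [Y2 [mY2 ->]]]].
  rewrite -setXI; exists (X1 `&` Y1); split; first exact: measurableI.
  by exists (X2 `&` Y2); split => //; exact: measurableI.
apply: (measure_unique C (fun=> setT)) => //.
- rewrite measurable_prod_measurableType //; congr (<<s _ >>).
  rewrite predeqE; split => [[A mA [B mB <-]]|[A [mA [B [mB ->]]]]].
    by exists A; split => //; exists B.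
  by exists A => //; exists B.
- by move=> _; exists setT; split => //; exists setT; split => //; rewrite setXTT.
- by apply/seteqP; split => // x _; exists 0%N.
- by move=> _ [A [mA [B [mB ->]]]]; exact: m12.
Qed.

End rectangles.

Section mean.
Context d (Omega : measurableType d) (R : realType) (P : probability Omega R).

Definition mean (f : Omega -> R) : R := \int[P]_w f w.

Definition bounded_rv (f : Omega -> R) :=
  measurable_fun setT f /\ exists C, forall w, `|f w| <= C.

Lemma bounded_rv_integrable f : bounded_rv f ->
  P.-integrable setT (EFin \o f).
Proof.
move=> [mf [C hC]]; apply: measurable_bounded_integrable => //.
  by rewrite ltey_eq fin_num_measure.
exists C; split; first by rewrite num_real.
by move=> x Cx w _; exact: le_trans (hC w) (ltW Cx).
Qed.

Lemma bounded_rv_cst c : bounded_rv (fun=> c).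
Proof. by split => //; exists `|c|. Qed.

Lemma bounded_rvD f g : bounded_rv f -> bounded_rv g ->
  bounded_rv (fun w => f w + g w).
Proof.
move=> [mf [C hC]] [mg [D hD]]; split; first exact: measurable_funD.
exists (C + D) => w; apply: le_trans (ler_normD _ _) _; exact: lerD.
Qed.

Lemma bounded_rvM f g : bounded_rv f -> bounded_rv g ->
  bounded_rv (fun w => f w * g w).
Proof.
move=> [mf [C hC]] [mg [D hD]]; split; first exact: measurable_funM.
by exists (C * D) => w; rewrite normrM; exact: ler_pM.
Qed.

Lemma bounded_rvN f : bounded_rv f -> bounded_rv (fun w => - f w).
Proof.
move=> [mf [C hC]]; split; first exact: measurableT_comp.
by exists C => w; rewrite normrN.
Qed.

Lemma bounded_rvB f g : bounded_rv f -> bounded_rv g ->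
  bounded_rv (fun w => f w - g w).
Proof. by move=> hf hg; apply: bounded_rvD => //; exact: bounded_rvN. Qed.

Lemma bounded_rvX f n : bounded_rv f -> bounded_rv (fun w => f w ^+ n).
Proof.
move=> hf; elim: n => [|n IH].
  rewrite (_ : (fun _ => _) = fun=> 1); first exact: bounded_rv_cst.
  by apply/funext => w; rewrite expr0.
rewrite (_ : (fun _ => _) = fun w => f w * f w ^+ n); first exact: bounded_rvM.
by apply/funext => w; rewrite exprS.
Qed.

Lemma bounded_rv_sum (F : nat -> Omega -> R) n :
  (forall i, bounded_rv (F i)) -> bounded_rv (fun w => \sum_(i < n) F i w).
Proof.
move=> hF; elim: n => [|n IH].
  rewrite (_ : (fun _ => _) = fun=> 0); first exact: bounded_rv_cst.
  by apply/funext => w; rewrite big_ord0.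
rewrite (_ : (fun _ => _) = fun w => \sum_(i < n) F i w + F n w).
  exact: bounded_rvD.
by apply/funext => w; rewrite big_ord_recr.
Qed.

Lemma mean_cst c : mean (fun=> c) = c.
Proof. by rewrite /mean Rintegral_cst// [X in fine X](_ : _ = 1%E) ?mulr1//; exact: probability_setT. Qed.

Lemma meanD f g : bounded_rv f -> bounded_rv g ->
  mean (fun w => f w + g w) = mean f + mean g.
Proof. by move=> hf hg; rewrite /mean RintegralD//; exact: bounded_rv_integrable. Qed.

Lemma meanB f g : bounded_rv f -> bounded_rv g ->
  mean (fun w => f w - g w) = mean f - mean g.
Proof. by move=> hf hg; rewrite /mean RintegralB//; exact: bounded_rv_integrable. Qed.

Lemma meanZ c f : bounded_rv f -> mean (fun w => c * f w) = c * mean f.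
Proof. by move=> hf; rewrite /mean RintegralZl//; exact: bounded_rv_integrable. Qed.

Lemma meanN f : bounded_rv f -> mean (fun w => - f w) = - mean f.
Proof.
by move=> hf; rewrite -mulN1r -meanZ//; congr mean; apply/funext => w; rewrite mulN1r.
Qed.

Lemma le_mean f g : bounded_rv f -> bounded_rv g ->
  (forall w, f w <= g w) -> mean f <= mean g.
Proof.
by move=> hf hg fg; apply: le_Rintegral => //; exact: bounded_rv_integrable.
Qed.

Lemma mean_sum (F : nat -> Omega -> R) n : (forall i, bounded_rv (F i)) ->
  mean (fun w => \sum_(i < n) F i w) = \sum_(i < n) mean (F i).
Proof.
move=> hF; elim: n => [|n IH].
  rewrite big_ord0 -[RHS](mean_cst 0); congr mean.
  by apply/funext => w; rewrite big_ord0.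
rewrite big_ord_recr/= -IH -meanD//; last exact: bounded_rv_sum.
by congr mean; apply/funext => w; rewrite big_ord_recr.
Qed.

Lemma norm_mean_le f C : bounded_rv f -> (forall w, `|f w| <= C) ->
  `|mean f| <= C.
Proof.
move=> hf fC; rewrite ler_norml -{1}(mean_cst (- C)) -{2}(mean_cst C).
apply/andP; split; apply: le_mean => //; try exact: bounded_rv_cst.
  by move=> w; move: (fC w); rewrite ler_norml => /andP[].
by move=> w; move: (fC w); rewrite ler_norml => /andP[].
Qed.

Lemma norm_meanB_le f g C : bounded_rv f -> bounded_rv g ->
  (forall w, `|f w - g w| <= C) -> `|mean f - mean g| <= C.
Proof.
move=> hf hg fg; rewrite -meanB//; apply: norm_mean_le => //; exact: bounded_rvB.
Qed.

Lemma EFin_mean f : bounded_rv f -> (mean f)%:E = (\int[P]_w (f w)%:E)%E.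
Proof.
move=> hf; rewrite /mean /Rintegral fineK//.
by apply: integrable_fin_num => //; exact: bounded_rv_integrable.
Qed.

End mean.

Section laws.
Context d (Omega : measurableType d) (R : realType) (P : probability Omega R).

Lemma mean_same_law d' (T : measurableType d') (X Y : Omega -> T) (f : T -> R) :
  measurable_fun setT X -> measurable_fun setT Y -> measurable_fun setT f ->
  (exists C, forall w, `|f (X w)| <= C) -> (exists C, forall w, `|f (Y w)| <= C) ->
  (forall M, measurable M -> P (X @^-1` M) = P (Y @^-1` M)) ->
  mean P (f \o X) = mean P (f \o Y).
Proof.
move=> mX mY mf bX bY XY.
have hX : bounded_rv (f \o X) by split => //; exact: measurableT_comp.
have hY : bounded_rv (f \o Y) by split => //; exact: measurableT_comp.
pose X' : {mfun Omega >-> T} := mfun_Sub (mem_set mX).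
pose Y' : {mfun Omega >-> T} := mfun_Sub (mem_set mY).
apply: EFin_inj; rewrite !EFin_mean//.
transitivity (\int[distribution P X']_t (f t)%:E)%E.
  rewrite integral_distribution//; first exact/measurable_EFinP.
  exact: bounded_rv_integrable.
transitivity (\int[distribution P Y']_t (f t)%:E)%E.
  by apply: eq_measure_integral => M mM _; exact: XY.
rewrite integral_distribution//; first exact/measurable_EFinP.
exact: bounded_rv_integrable.
Qed.

Lemma mean_indep (U V : Omega -> R) : bounded_rv U -> bounded_rv V ->
  (forall B C, measurable B -> measurable C ->
    P (U @^-1` B `&` V @^-1` C) = (P (U @^-1` B) * P (V @^-1` C))%E) ->
  mean P (fun w => U w * V w) = mean P U * mean P V.
Proof.
move=> hU hV UV.
have [mU bU] := hU; have [mV bV] := hV.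
pose U' : {mfun Omega >-> R} := mfun_Sub (mem_set mU).
pose V' : {mfun Omega >-> R} := mfun_Sub (mem_set mV).
have mUV : measurable_fun setT (fun w => (U w, V w)).
  exact/measurable_fun_pair.
pose W : {mfun Omega >-> (R * R)%type} := mfun_Sub (mem_set mUV).
have mp : measurable_fun setT (fun p : R * R => p.1 * p.2) by exact: measurable_funM.
have hUV := bounded_rvM hU hV.
apply: EFin_inj; rewrite EFin_mean//.
transitivity (\int[distribution P W]_p (p.1 * p.2)%:E)%E.
  rewrite integral_distribution//; first exact/measurable_EFinP.
  exact: bounded_rv_integrable.
transitivity (\int[distribution P U' \x distribution P V']_p (p.1 * p.2)%:E)%E.
  apply: eq_measure_integral => M mM _; apply/esym.
  by apply: product_measure_unique => // A B mA mB; exact: UV.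
have eqW M : measurable M -> (distribution P U' \x distribution P V')%E M = distribution P W M.
  move=> mM; apply: product_measure_unique => // A B mA mB; exact: UV.
have iW : (distribution P U' \x distribution P V')%E.-integrable setT (fun p : R * R => (p.1 * p.2)%:E).
  apply/integrableP; split; first exact/measurable_EFinP.
  rewrite (eq_measure_integral (distribution P W)); last by move=> M mM _; exact: eqW.
  rewrite ge0_integral_distribution//; last exact/measurableT_comp/measurable_EFinP.
  by have /integrableP[] := bounded_rv_integrable P hUV.
rewrite -integral12_prod_meas1//.
have iV : (distribution P V').-integrable setT (EFin \o id).
  apply: integrable_pushforward => //.
    exact/measurable_EFinP/measurable_id.
  exact: (bounded_rv_integrable P hV).
transitivity (\int[distribution P U']_x (x * mean P V)%:E)%E.
  apply: eq_integral => x _.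
  rewrite /fubini_F; transitivity (x%:E * \int[distribution P V']_y y%:E)%E.
    by rewrite -integralZl//; apply: eq_integral => y _; rewrite EFinM.
  rewrite EFinM EFin_mean//; congr (_ * _)%E.
  rewrite integral_distribution//; exact: bounded_rv_integrable.
rewrite integral_distribution//; [|exact/measurable_EFinP/measurable_funM|].
  transitivity (\int[P]_w (U w * mean P V)%:E)%E => //.
  rewrite -(EFin_mean P (bounded_rvM hU (bounded_rv_cst Omega (mean P V)))).
  congr (_%:E); rewrite mulrC -meanZ//; congr mean.
  by apply/funext => w; rewrite mulrC.
exact: (bounded_rv_integrable P (bounded_rvM hU (bounded_rv_cst Omega (mean P V)))).
Qed.

End laws.

(** * Elliptic environments *)

Lemma measurable_inv (R : realType) :
  measurable_fun setT (fun x : R => x^-1).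
Proof.
rewrite (_ : (fun _ => _) = fun x => x * expR (- ln (x ^+ 2))).
  apply: measurable_funM => //; apply: (measurableT_comp (@measurable_expR R)).
  apply: measurable_funN; apply: (measurableT_comp (@measurable_ln R)).
  exact: exprn_measurable.
apply/funext => x; have [->|x0] := eqVneq x 0; first by rewrite invr0 mul0r.
by rewrite expRN lnK ?posrE ?exprn_even_gt0// expr2 invfM mulrA divff// mul1r.
Qed.

(** Ellipticity is asked for every outcome, so that all bounds on passage
    generating functions are pointwise; an environment that is elliptic almost
    surely is clipped to this form. *)
Record elliptic_iid d (Omega : measurableType d) (R : realType)
    (P : probability Omega R) (o : int -> Omega -> R) (eps : R) : Prop :=
  EllipticIid {
    measurable_env : forall i, measurable_fun setT (o i);
    independent_env : forall (J : {fset int}) (D : int -> set R),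
      (forall k, measurable (D k)) ->
      P (\bigcap_(k in [set` J]) (o k @^-1` D k)) =
      (\prod_(k <- J) P (o k @^-1` D k))%E;
    same_law_env : forall k (B : set R), measurable B ->
      P (o k @^-1` B) = P (o 0 @^-1` B);
    ellipticity_gt0 : 0 < eps;
    elliptic_env : forall i w, eps <= o i w <= 1 - eps }.

Section environment.
Context d (Omega : measurableType d) (R : realType) (P : probability Omega R).
Variables (o : int -> Omega -> R) (eps : R).
Hypothesis env : elliptic_iid P o eps.
Let measurable_o := measurable_env env.
Let independent_o := independent_env env.
Let same_law_o := same_law_env env.

Let cylinder (J : {fset int}) (D : int -> set R) :=
  \bigcap_(k in [set` J]) (o k @^-1` D k).

Let measurable_pre d' (T : measurableType d') (V : Omega -> T) C :
  measurable_fun setT V -> measurable C -> measurable (V @^-1` C).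
Proof. by move=> mV mC; rewrite -[X in measurable X]setTI; exact: mV. Qed.

Let measurable_cylinder J D : (forall k, measurable (D k)) ->
  measurable (cylinder J D).
Proof.
move=> mD; apply: fin_bigcap_measurable => // k _.
exact: measurable_pre.
Qed.

Let cylinderU1 j J D : cylinder (j |` J)%fset D = o j @^-1` D j `&` cylinder J D.
Proof. by rewrite /cylinder set_fsetU1 bigcap_setU1. Qed.

Let prob_cylinderU1 j (J : {fset int}) (D : int -> set R) : j \notin J -> (forall k, measurable (D k)) ->
  P (o j @^-1` D j `&` cylinder J D) = (P (o j @^-1` D j) * P (cylinder J D))%E.
Proof.
by move=> jJ mD; rewrite -cylinderU1 !independent_o// big_fsetU1.
Qed.

(** [U], [V] and the environment from [j] on are independent. Including the
    environment makes the property pass through the recursion of [hit], one site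
    at a time ([indep_future_step]). *)
Definition indep_future d1 (T1 : measurableType d1) d2 (T2 : measurableType d2)
    (U : Omega -> T1) (V : Omega -> T2) (j : int) :=
  forall B C (J : {fset int}) (D : int -> set R), measurable B -> measurable C ->
    (forall k, k \in J -> j <= k) -> (forall k, measurable (D k)) ->
    P (U @^-1` B `&` V @^-1` C `&` cylinder J D) =
    (P (U @^-1` B) * P (V @^-1` C) * P (cylinder J D))%E.

Lemma indep_futureW d1 (T1 : measurableType d1) d2 (T2 : measurableType d2)
    (U : Omega -> T1) (V : Omega -> T2) j B C :
  indep_future U V j -> measurable B -> measurable C ->
  P (U @^-1` B `&` V @^-1` C) = (P (U @^-1` B) * P (V @^-1` C))%E.
Proof.
move=> UV mB mC; have := UV B C fset0 (fun=> setT) mB mC.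
rewrite /cylinder set_fset0 bigcap_set0 setIT probability_setT mule1.
by apply=> // k; rewrite inE.
Qed.

Lemma indep_future_comp d1 (T1 : measurableType d1) d2 (T2 : measurableType d2)
    d3 (T3 : measurableType d3) (U : Omega -> T1) (V : Omega -> T2) (f : T2 -> T3) j :
  measurable_fun setT f -> indep_future U V j -> indep_future U (f \o V) j.
Proof.
move=> mf UV B C J D mB mC; rewrite comp_preimage; apply: UV => //.
by rewrite -[X in measurable X]setTI; exact: mf.
Qed.

Lemma indep_future_sym d1 (T1 : measurableType d1) d2 (T2 : measurableType d2)
    (U : Omega -> T1) (V : Omega -> T2) j :
  indep_future U V j -> indep_future V U j.
Proof.
move=> UV B C J D mB mC Jj mD.
by rewrite [_ `&` (U @^-1` _)]setIC UV// [X in (X * _)%E]muleC.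
Qed.

Lemma indep_future_cst d1 (T1 : measurableType d1) d2 (T2 : measurableType d2)
  (u : T1) (v : T2) j : indep_future (fun=> u) (fun=> v) j.
Proof.
move=> B C J D mB mC Jj mD; rewrite !preimage_cst.
case: ifP => _; case: ifP => _; rewrite ?setTI ?set0I ?probability_setT ?measure0 ?mul1e ?mul0e ?mule0//.
Qed.

(** Absorbing one more site into [V]: by uniqueness of finite measures it is
    enough to look at rectangles. *)
Lemma indep_future_step d1 (T1 : measurableType d1) d2 (T2 : measurableType d2)
    (U : Omega -> T1) (V : Omega -> T2) j :
  measurable_fun setT U -> measurable_fun setT V ->
  indep_future U V j -> indep_future U (fun w => (V w, o j w)) (j + 1).
Proof.
move=> mU mV UV B M J D mB mM Jj mD.
have jJ : j \notin J by apply/negP => /Jj; lia.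
have mUB := measurable_pre mU mB; have mK := measurable_cylinder J mD.
have mVo : measurable_fun setT (fun w => (V w, o j w)).
  exact: measurable_fun_pair.
pose W : {mfun Omega >-> (T2 * R)%type} := mfun_Sub (mem_set mVo).
have mA : measurable (U @^-1` B `&` cylinder J D) by exact: measurableI.
pose m0 : {measure set (T2 * R) -> \bar R} := pushforward (mrestr P mA) W.
pose m1 := m0 mVo.
have c0 : 0 <= fine (P (U @^-1` B) * P (cylinder J D)) by rewrite fine_ge0// mule_ge0.
have [c cE] : exists c : {nonneg R}, c%:num%:E = (P (U @^-1` B) * P (cylinder J D))%E.
  by exists (NngNum c0); rewrite /= fineK// fin_numM ?fin_num_measure.
pose m2 : {measure set (T2 * R) -> \bar R} := mscale c (distribution P W).
have m1E A : m1 A = P (W @^-1` A `&` (U @^-1` B `&` cylinder J D)) by [].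
have m2E A : m2 A = (c%:num%:E * P (W @^-1` A))%E by [].
suff H : m1 M = m2 M.
  move: H; rewrite m1E m2E cE.
  rewrite muleAC => <-; congr (P _).
  by rewrite -setIA [_ `&` cylinder _ _]setIC setIA setIC.
apply: rectangle_measure_unique mM => //.
  rewrite m1E preimage_setT setTI.
  by rewrite ltey_eq fin_num_measure.
move=> C E mC mE; rewrite m1E m2E cE.
have -> : W @^-1` (C `*` E) = V @^-1` C `&` o j @^-1` E by [].
pose D' (k : int) := if k == j then E else D k.
have mD' k : measurable (D' k) by rewrite /D'; case: ifP.
have D'J : cylinder J D' = cylinder J D.
  by apply: eq_bigcapr => k /= kJ; rewrite /D' ifN//; apply: contra jJ => /eqP <-.
have D'j : o j @^-1` D' j = o j @^-1` E by rewrite /D' eqxx.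
have leJ k : k \in (j |` J)%fset -> j <= k.
  by rewrite !inE => /orP[/eqP ->//|/Jj]; lia.
have le1 k : k \in (j |` fset0)%fset -> j <= k by rewrite !inE orbF => /eqP ->.
have VE : P (V @^-1` C `&` o j @^-1` E) = (P (V @^-1` C) * P (o j @^-1` E))%E.
  have := UV setT C (j |` fset0)%fset D' measurableT mC le1 mD'.
  rewrite cylinderU1 D'j [cylinder fset0 _]/cylinder set_fset0 bigcap_set0 setIT.
  by rewrite preimage_setT setTI probability_setT mul1e.
have := UV B C (j |` J)%fset D' mB mC leJ mD'.
rewrite cylinderU1 prob_cylinderU1// D'J D'j VE => H.
transitivity (P (U @^-1` B `&` V @^-1` C `&` (o j @^-1` E `&` cylinder J D))).
  by congr (P _); apply/seteqP; split => w /=; tauto.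
rewrite H -!muleA; congr (_ * _)%E.
by rewrite muleA muleC.
Qed.

Lemma indep_future_le d1 (T1 : measurableType d1) d2 (T2 : measurableType d2)
    (U : Omega -> T1) (V : Omega -> T2) j j' :
  j <= j' -> indep_future U V j -> indep_future U V j'.
Proof.
by move=> jj UV B C J D mB mC Jj mD; apply: UV => // k /Jj; exact: le_trans.
Qed.

Definition passage z (a : int) (k : nat) (w : Omega) : R :=
  hit z (fun i => o (a + i%:Z) w) k.

Lemma passageS z a k w :
  passage z a k.+1 w = hit_step z (o (a + k%:Z) w) (passage z a k w).
Proof. by []. Qed.

Lemma env_bound i w : 0 < o i w < 1.
Proof.
have e0 := ellipticity_gt0 env; have /andP[h1 h2] := elliptic_env env i w.
by apply/andP; split; lra.
Qed.

Lemma measurable_hit_step z : measurable_fun setT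
  (fun p : R * R => hit_step z p.2 p.1).
Proof.
rewrite /hit_step; apply: measurable_funM; first exact: measurable_funM.
apply: (measurableT_comp (@measurable_inv R)).
apply: measurable_funB => //; apply: measurable_funM => //.
by apply: measurable_funM => //; exact: measurable_funB.
Qed.

Lemma measurable_passage z a k : measurable_fun setT (passage z a k).
Proof.
elim: k => [|k IH]; first exact: measurable_cst.
rewrite (_ : passage z a k.+1 = (fun p : R * R => hit_step z p.2 p.1) \o
  (fun w => (passage z a k w, o (a + k%:Z) w))) //.
apply: measurableT_comp; first exact: measurable_hit_step.
exact: measurable_fun_pair.
Qed.

Lemma indep_future_passage d1 (T1 : measurableType d1) (U : Omega -> T1) z a k :
  measurable_fun setT U -> indep_future U (fun=> 0 : R) a ->
  indep_future U (passage z a k) (a + k%:Z).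
Proof.
move=> mU hU; elim: k => [|k IH]; first by rewrite addr0.
have -> : a + k.+1%:Z = (a + k%:Z) + 1 by lia.
have := indep_future_step mU (measurable_passage z a k) IH.
by move/(indep_future_comp (measurable_hit_step z)).
Qed.

(** By induction along the recursion: each step applies a fixed map to the
    previous value and to an independent site, whose law is that of site [0]. *)
Lemma passage_same_law z a k M : measurable M ->
  P ((fun w => (passage z a k w, o (a + k%:Z) w)) @^-1` M) =
  P ((fun w => (passage z 0 k w, o k%:Z w)) @^-1` M).
Proof.
have mVo b i : measurable_fun setT (fun w => (passage z b k w, o i w)).
  by apply: measurable_fun_pair => //; exact: measurable_passage.
move: M; have [m] := ubnP k; elim: m => // m IHm in k mVo *; rewrite ltnS => km M.
have cyl1 j E : cylinder (j |` fset0)%fset (fun=> E) = o j @^-1` E.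
  by rewrite (cylinderU1 j fset0 (fun=> E)) /cylinder set_fset0 bigcap_set0 setIT.
have split_law b C E : measurable C -> measurable E ->
    P (passage z b k @^-1` C `&` o (b + k%:Z) @^-1` E) =
    (P (passage z b k @^-1` C) * P (o 0 @^-1` E))%E.
  move=> mC mE; have := @indep_future_passage _ _ (fun=> 0 : R) z b k
    (measurable_cst _) (@indep_future_cst _ R _ R 0 0 b).
  set j := b + k%:Z.
  move=> /(_ setT C (j |` fset0)%fset (fun=> E) measurableT mC).
  rewrite cyl1 preimage_setT setTI probability_setT mul1e same_law_o//; apply=> // i.
  by rewrite !inE orbF => /eqP ->.
suff law1 C : measurable C -> P (passage z a k @^-1` C) = P (passage z 0 k @^-1` C).
  move=> mM.
  pose X : {mfun Omega >-> (R * R)%type} := mfun_Sub (mem_set (mVo a (a + k%:Z))).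
  pose Y : {mfun Omega >-> (R * R)%type} := mfun_Sub (mem_set (mVo 0 k%:Z)).
  suff : distribution P X M = distribution P Y M by [].
  apply: rectangle_measure_unique mM => [|C E mC mE].
    by rewrite ltey_eq fin_num_measure.
  change (P (passage z a k @^-1` C `&` o (a + k%:Z) @^-1` E) =
          P (passage z 0 k @^-1` C `&` o k%:Z @^-1` E)).
  have := split_law 0 C E mC mE; rewrite add0r => ->.
  by rewrite split_law// law1.
case: k km {mVo split_law} => [//|k] km mC.
have mf := measurable_hit_step z.
have mC' : measurable ((fun p : R * R => hit_step z p.2 p.1) @^-1` C).
  by rewrite -[X in measurable X]setTI; exact: mf.
have e0 : passage z 0 k.+1 = fun w => hit_step z (o k%:Z w) (passage z 0 k w).
  by apply/funext => w; rewrite passageS add0r.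
rewrite e0; apply: IHm km _ mC' => b i.
by apply: measurable_fun_pair => //; exact: measurable_passage.
Qed.

Lemma mean_passage_shift z a k (f : R * R -> R) C :
  measurable_fun setT f ->
  (forall b w, `|f (passage z b k w, o (b + k%:Z) w)| <= C) ->
  mean P (fun w => f (passage z a k w, o (a + k%:Z) w)) =
  mean P (fun w => f (passage z 0 k w, o k%:Z w)).
Proof.
move=> mf fC.
have mVo b i : measurable_fun setT (fun w => (passage z b k w, o i w)).
  by apply: measurable_fun_pair => //; exact: measurable_passage.
apply: mean_same_law mf _ _ _ => //.
- by exists C => w; exact: fC.
- by exists C => w; have := fC 0 w; rewrite add0r.
- exact: passage_same_law.
Qed.

Lemma mean_indep_passage z a k (U : Omega -> R) (f : R -> R) :
  bounded_rv U -> indep_future U (fun=> 0 : R) a ->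
  measurable_fun setT f -> bounded_rv (fun w => f (passage z a k w)) ->
  mean P (fun w => U w * f (passage z a k w)) =
  mean P U * mean P (fun w => f (passage z a k w)).
Proof.
move=> bU Ua mf bf; apply: mean_indep => // B C mB mC.
have := @indep_future_passage _ _ U z a k bU.1 Ua.
by move/(indep_future_comp mf)/indep_futureW; exact.
Qed.

Lemma indep_future_observable z a k (f : R -> R) j :
  measurable_fun setT f -> a + k%:Z <= j ->
  indep_future (fun w => f (passage z a k w)) (fun=> 0 : R) j.
Proof.
move=> mf akj; apply: (indep_future_le akj).
apply: indep_future_sym; apply: (indep_future_comp mf).
by apply: indep_future_passage => //; exact: indep_future_cst.
Qed.

(** [passage z a k] reads only the sites before [a + k]. *)
Lemma mean_passage_site z a k (f g : R -> R) :
  measurable_fun setT f -> measurable_fun setT g ->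
  bounded_rv (fun w => f (passage z a k w)) ->
  bounded_rv (fun w => g (o (a + k%:Z) w)) ->
  mean P (fun w => f (passage z a k w) * g (o (a + k%:Z) w)) =
  mean P (fun w => f (passage z a k w)) * mean P (fun w => g (o (a + k%:Z) w)).
Proof.
move=> mf mg bf bg; apply: mean_indep => // B C mB mC.
have := @indep_future_observable z a k f _ mf (lexx (a + k%:Z)).
move/(indep_future_step bf.1 (measurable_cst _)).
have ms : measurable_fun setT (g \o @snd R R) by exact: measurableT_comp.
by move/(indep_future_comp ms)/indep_futureW; exact.
Qed.

End environment.

(** * The Lyapunov exponent *)

Lemma ln_lipschitz (R : realType) (c x y : R) : 0 < c -> c <= x -> c <= y ->
  `|ln x - ln y| <= `|x - y| / c.
Proof.
move=> c0; wlog xy : x y / y <= x.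
  move=> H cx cy; have /orP[yx|xy] := le_total y x; first exact: (H x y).
  by rewrite distrC [ `|x - y|]distrC; exact: (H y x).
move=> cx cy; have x0 : 0 < x by lra.
have y0 : 0 < y by lra.
have xy1 : 0 < x / y by rewrite divr_gt0.
rewrite [ `|x - y|]ger0_norm ?subr_ge0// ger0_norm ?subr_ge0 ?ler_ln//.
rewrite -ln_div ?posrE//.
have -> : x / y = 1 + (x / y - 1) by ring.
have h : -1 < x / y - 1 by lra.
apply: (@le_trans _ _ (x / y - 1)); first by exact: le_ln1Dx.
have -> : x / y - 1 = (x - y) / y by field; rewrite gt_eqF.
by rewrite ler_wpM2l ?subr_ge0// lef_pV2 ?posrE.
Qed.

Section lyapunov.
Context d (Omega : measurableType d) (R : realType) (P : probability Omega R).
Variables (o : int -> Omega -> R) (eps : R).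
Hypothesis env : elliptic_iid P o eps.
Local Notation passage := (passage o).

Section rate.
Variable z : R.
Hypothesis hz : 0 < z < 1.

Let e0 : 0 < eps := ellipticity_gt0 env.
Let z0 : 0 < z. Proof. by case/andP: hz. Qed.

Lemma passage_bound a k w : z * eps <= passage z a k.+1 w <= z.
Proof.
have /andP[h1 ->] := hitS_bound k hz (fun i => env_bound env (a + i%:Z) w).
rewrite andbT; apply: le_trans h1.
by rewrite ler_pM2l//; have /andP[] := elliptic_env env (a + k%:Z) w.
Qed.

Let ze0 : 0 < z * eps. Proof. exact: mulr_gt0. Qed.

Lemma cost_bound a k w : 0 <= - ln (passage z a k.+1 w) <= - ln (z * eps).
Proof.
have /andP[h1 h2] := passage_bound a k w.
have h0 : 0 < passage z a k.+1 w by apply: lt_le_trans h1.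
rewrite oppr_ge0 lerN2 ler_ln ?posrE// h1 andbT.
by rewrite ln_le0//; apply: le_trans h2 _; case/andP: hz => _ /ltW.
Qed.

Lemma bounded_cost a k : bounded_rv (fun w => - ln (passage z a k.+1 w)).
Proof.
split; first by apply: measurable_funN; apply: (measurableT_comp (@measurable_ln R)); exact: measurable_passage env _ _ _.
exists (- ln (z * eps)) => w; have /andP[? ?] := cost_bound a k w.
by rewrite ger0_norm.
Qed.

Definition mean_cost k := mean P (fun w => - ln (passage z 0 k.+1 w)).

Lemma mean_cost_shift a k :
  mean P (fun w => - ln (passage z a k.+1 w)) = mean_cost k.
Proof.
have m1 : measurable_fun setT (fun p : R * R => - ln (hit_step z p.2 p.1)).
  apply: measurable_funN; apply: (measurableT_comp (@measurable_ln R)).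
  exact: measurable_hit_step.
have := @mean_passage_shift _ _ _ _ _ _ env z a k _ (- ln (z * eps)) m1.
rewrite /mean_cost => -> => [|b w].
  by congr mean; apply/funext => w; rewrite passageS add0r.
by rewrite /= -passageS; have /andP[? ?] := cost_bound b k w; rewrite ger0_norm.
Qed.

Definition forget_const := ((1 - z) * eps)^-1.

Lemma forget_const_ge0 : 0 <= forget_const.
Proof. by rewrite invr_ge0 mulr_ge0 ?ltW// subr_gt0; case/andP: hz. Qed.

(** [hit_forget] on the logarithmic scale: by ellipticity [ln] is Lipschitz on
    the range of [passage]. *)
Lemma passage_forget a b k w :
  `|- ln (passage z a (b + k).+1 w) + ln (passage z (a + b%:Z) k.+1 w)| <=
  forget_const * z ^+ k.
Proof.
rewrite -normrN opprD !opprK.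
have /andP[h1 _] := passage_bound a (b + k) w.
have /andP[h2 _] := passage_bound (a + b%:Z) k w.
apply: le_trans (ln_lipschitz ze0 h1 h2) _.
have := hit_forget b k.+1 hz (fun i => env_bound env (a + i%:Z) w).
have -> : (fun i : nat => o (a + (b + i)%N%:Z) w) = (fun i => o (a + b%:Z + i%:Z) w).
  by apply/funext => i; rewrite PoszD addrA.
rewrite addnS => h.
rewrite ler_pdivrMr//; apply: (le_trans h).
have ? := lt0r_neq0 e0; have ? := lt0r_neq0 z0.
have ? : 1 - z != 0 by rewrite gt_eqF// subr_gt0; case/andP: hz.
by rewrite le_eqVlt; apply/orP; left; apply/eqP; rewrite exprS /forget_const; field; apply/andP.
Qed.

Lemma mean_cost_forget b k : `|mean_cost (b + k) - mean_cost k| <= forget_const * z ^+ k.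
Proof.
rewrite -[X in _ - X](mean_cost_shift b%:Z).
apply: norm_meanB_le; try exact: bounded_cost.
by move=> w; rewrite opprK; have := passage_forget 0 b k w; rewrite add0r.
Qed.

Lemma mean_cost_bound k : 0 <= mean_cost k <= - ln (z * eps).
Proof.
rewrite -{1}(mean_cst P 0) -(mean_cst P (- ln (z * eps))).
by apply/andP; split; apply: le_mean => //; try exact: bounded_cost; try exact: bounded_rv_cst; move=> w; have /andP[] := cost_bound 0 k w.
Qed.

Definition lyapunov := limn mean_cost.

(** By stationarity, one site more amounts to a barrier farther to the left, which
    lowers the cost: the sequence is nonincreasing. *)
Lemma cvg_mean_cost : mean_cost @ \oo --> lyapunov.
Proof.
apply: nonincreasing_is_cvgn.
  apply/nonincreasing_seqP => k; rewrite -(mean_cost_shift 1%:Z k).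
  apply: le_mean; try exact: bounded_cost; move=> w.
  have /andP[h1 _] := passage_bound 1%:Z k w.
  have /andP[h2 _] := passage_bound 0 k.+1 w.
  rewrite lerN2 ler_ln ?posrE; [|exact: lt_le_trans h1|exact: lt_le_trans h2].
  have := hit_restart_le 1 k.+1 hz (fun i => env_bound env (0 + i%:Z) w).
  have -> // : (fun i : nat => o (0 + (1 + i)%N%:Z) w) = (fun i => o (1%:Z + i%:Z) w).
  by apply/funext => i; rewrite PoszD add0r.
exists 0 => _ [k _ <-]; by case/andP: (mean_cost_bound k).
Qed.

Lemma mean_cost_lyapunov k : `|mean_cost k - lyapunov| <= forget_const * z ^+ k.
Proof.
rewrite distrC.
have h : (fun b => `|mean_cost (b + k) - mean_cost k|) @ \oo --> `|lyapunov - mean_cost k|.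
  apply: cvg_norm; apply: cvgB; last exact: cvg_cst.
  by rewrite cvg_shiftn; exact: cvg_mean_cost.
rewrite -(cvg_lim _ h)//; apply: limr_le; first by apply/cvg_ex; eexists; exact: h.
by apply: nearW => b; exact: mean_cost_forget.
Qed.

Lemma lyapunov_bound : 0 <= lyapunov <= - ln (z * eps).
Proof.
rewrite /lyapunov; apply/andP; split.
  apply: limr_ge; first exact: cvg_mean_cost.
  by apply: nearW => k; case/andP: (mean_cost_bound k).
apply: limr_le; first exact: cvg_mean_cost.
by apply: nearW => k; case/andP: (mean_cost_bound k).
Qed.

End rate.
End lyapunov.

(** * Fluctuations of the cost of passage *)

Lemma sum_geometric_le (R : realFieldType) (z : R) m : 0 <= z < 1 ->
  \sum_(i < m) z ^+ (m - i.+1) <= (1 - z)^-1.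
Proof.
case/andP=> z0 z1; have z10 : 0 < 1 - z by rewrite subr_gt0.
have -> : \sum_(i < m) z ^+ (m - i.+1) = \sum_(i < m) z ^+ i.
  by rewrite (reindex_inj rev_ord_inj)/=; apply: eq_bigr => i _; rewrite subnSK// subKn// ltnW.
rewrite -[leRHS]mul1r ler_pdivlMr// mulrC.
have := subrX1 z m; have : 0 <= z ^+ m by exact: exprn_ge0.
by move=> ? e; rewrite -(opprB z) mulNr -e; lra.
Qed.

Section fluctuations.
Context d (Omega : measurableType d) (R : realType) (P : probability Omega R).
Variables (o : int -> Omega -> R) (eps : R).
Hypothesis env : elliptic_iid P o eps.
Variables (z : R) (a : int).
Hypothesis hz : 0 < z < 1.
Local Notation lambda := (lyapunov P o z).
Local Notation C := (- ln (z * eps)).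
Local Notation K := (forget_const eps z).

Let dev k w := - ln (passage o z a k.+1 w) - lambda.

Let bounded_dev k : bounded_rv (dev k).
Proof. by apply: bounded_rvB (bounded_rv_cst _ _); exact: bounded_cost env _ hz _ _. Qed.

Let norm_dev k w : `|dev k w| <= C.
Proof.
have /andP[? ?] := cost_bound env hz a k w; have /andP[? ?] := lyapunov_bound env hz.
by rewrite ler_norml; apply/andP; split; rewrite /dev; lra.
Qed.

Let K0 : 0 <= K. Proof. exact: forget_const_ge0 env _ hz. Qed.
Let C0 : 0 <= C. Proof. by apply: le_trans (norm_dev 0 point). Qed.
Let z0 : 0 < z. Proof. by case/andP: hz. Qed.

(** The cost at distance [k] to the right is, up to an error of order [z ^ k],
    that of a walk with a barrier between the two sites; the latter is
    independent of the cost to its left and has nearly mean [lambda]. *)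
Let covariance_le p k :
  `|mean P (fun w => dev p w * dev (p.+1 + k) w)| <= 2 * C * K * z ^+ k.
Proof.
pose b := p.+1; pose dev' w := - ln (passage o z (a + b%:Z) k.+1 w) - lambda.
have bdev' : bounded_rv dev'.
  by apply: bounded_rvB (bounded_rv_cst _ _); exact: bounded_cost env _ hz _ _.
have ml : measurable_fun setT (fun y : R => - ln y - lambda).
  apply: measurable_funB => //; apply: measurable_funN; exact: measurable_ln.
have indep : mean P (fun w => dev p w * dev' w) = mean P (dev p) * mean P dev'.
  have Ua : indep_future P o (dev p) (fun=> 0 : R) (a + b%:Z).
    exact: (@indep_future_observable _ _ _ _ _ _ env z a b (fun y => - ln y - lambda)).
  exact: (@mean_indep_passage _ _ _ _ _ _ env z (a + b%:Z) k.+1 (dev p)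
    (fun y => - ln y - lambda)).
have mean_dev' : `|mean P dev'| <= K * z ^+ k.
  rewrite /dev' meanB ?mean_cst; [|exact: bounded_cost env _ hz _ _|exact: bounded_rv_cst].
  by rewrite (mean_cost_shift env hz); exact: mean_cost_lyapunov.
have mean_dev : `|mean P (dev p)| <= C by apply: norm_mean_le.
have close : `|mean P (fun w => dev p w * dev (b + k) w) -
               mean P (fun w => dev p w * dev' w)| <= C * (K * z ^+ k).
  apply: norm_meanB_le; try exact: bounded_rvM.
  move=> w; rewrite -mulrBr normrM; apply: ler_pM => //.
  rewrite /dev /dev' (_ : _ - lambda - _ = - ln (passage o z a (b + k).+1 w) +
    ln (passage o z (a + b%:Z) k.+1 w)); last by ring.
  exact: passage_forget env _ hz _ _ _ _.
rewrite -/b -[X in `|X|](subrK (mean P (fun w => dev p w * dev' w))).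
apply: le_trans (ler_normD _ _) _.
have := ler_pM (normr_ge0 _) (normr_ge0 _) mean_dev mean_dev'.
rewrite -normrM -indep => h2.
by move: close h2; set x := `|_|; set y := `|_|; lra.
Qed.

Definition fluctuation_const := C ^+ 2 + 4 * C * K / (1 - z).

(** Summable covariances: the variance grows linearly in [m], uniformly in the
    position [n]. *)
Lemma fluctuation_le n m :
  mean P (fun w => (cost z (fun i => o (a + i%:Z) w) n m - m%:R * lambda) ^+ 2)
    <= fluctuation_const * m%:R.
Proof.
have -> : (fun w => (cost z (fun i => o (a + i%:Z) w) n m - m%:R * lambda) ^+ 2) =
    (fun w => (\sum_(i < m) dev (n + i) w) ^+ 2).
  apply/funext => w; congr (_ ^+ 2); rewrite sumrB sumr_const card_ord mulr_natl.
  by congr (_ - _).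
have bS m' : bounded_rv (fun w => \sum_(i < m') dev (n + i) w).
  exact: (@bounded_rv_sum _ _ _ (fun i => dev (n + i))).
elim: m => [|m IH].
  rewrite mulr0 (_ : (fun _ => _) = fun=> 0); first by rewrite mean_cst.
  by apply/funext => w; rewrite big_ord0 expr0n.
have -> : (fun w => (\sum_(i < m.+1) dev (n + i) w) ^+ 2) =
   (fun w => (\sum_(i < m) dev (n + i) w) ^+ 2 +
     (2 * (\sum_(i < m) (dev (n + i) w * dev (n + m) w)) + dev (n + m) w ^+ 2)).
  by apply/funext => w; rewrite big_ord_recr/= -mulr_suml; ring.
have bX k := bounded_rvX k (bS m).
have bP i : bounded_rv (fun w => dev (n + i) w * dev (n + m) w) by exact: bounded_rvM.
have bPS := @bounded_rv_sum _ _ _ (fun i w => dev (n + i) w * dev (n + m) w) m bP.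
have bD := bounded_rvX 2 (bounded_dev (n + m)).
have b2 : bounded_rv (fun w => 2 * (\sum_(i < m) (dev (n + i) w * dev (n + m) w))).
  by apply: bounded_rvM => //; exact: bounded_rv_cst.
rewrite meanD//; last exact: bounded_rvD.
rewrite meanD// meanZ// (@mean_sum _ _ _ _ (fun i w => dev (n + i) w * dev (n + m) w))//.
rewrite -[m.+1%:R]natr1 mulrDr mulr1; apply: lerD => //.
have cov : \sum_(i < m) mean P (fun w => dev (n + i) w * dev (n + m) w) <=
    2 * C * K * (1 - z)^-1.
  apply: (@le_trans _ _ (\sum_(i < m) (2 * C * K) * z ^+ (m - i.+1))).
    apply: ler_sum => i _; apply: le_trans (ler_norm _) _.
    have -> : (n + m = (n + i).+1 + (m - i.+1))%N by have := ltn_ord i; lia.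
    exact: covariance_le.
  rewrite -mulr_sumr; apply: ler_wpM2l; first by rewrite !mulr_ge0.
  by apply: sum_geometric_le; rewrite (ltW z0); case/andP: hz.
have var : mean P (fun w => dev (n + m) w ^+ 2) <= C ^+ 2.
  apply: le_trans (ler_norm _) _; apply: norm_mean_le => // w.
  by rewrite normrX lerXn2r ?nnegrE.
by rewrite /fluctuation_const; lra.
Qed.

End fluctuations.

(** * Almost sure growth along powers of four *)

Section almost_sure.
Context d (Omega : measurableType d) (R : realType) (P : probability Omega R).

(** The sum of the [2 ^ k * Y k] is integrable, hence almost surely finite, and
    bounds [Y k] by a multiple of [2 ^ - k]. *)
Lemma ae_cvg0_of_mean (Y : nat -> Omega -> R) c :
  (forall k, bounded_rv (Y k)) -> (forall k w, 0 <= Y k w) ->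
  (forall k, mean P (Y k) <= c / 4 ^+ k) ->
  {ae P, forall w, Y ^~ w @ \oo --> 0}.
Proof.
move=> bY Y0 mY; pose u k w := (2 ^+ k * Y k w)%:E.
have u0 k w : (0 <= u k w)%E by rewrite lee_fin mulr_ge0// exprn_ge0.
have mu k : measurable_fun setT (u k).
  by apply/measurable_EFinP; apply: measurable_funM => //; exact: (bY k).1.
have c0 : 0 <= c.
  have := mY 0%N; rewrite expr0 divr1; apply: le_trans.
  by apply: Rintegral_ge0 => w _; exact: Y0.
have ug : P.-integrable setT (fun w => \sum_(k <oo) u k w)%E.
  apply/integrableP; split.
    by apply: ge0_emeasurable_sum.
  under eq_integral do rewrite gee0_abs ?nneseries_ge0//.
  rewrite integral_nneseries//.
  apply: (@le_lt_trans _ _ (2 * c)%:E); last by rewrite ltry.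
  apply: lime_le; first by apply: is_cvg_nneseries => k _ _; exact: integral_ge0.
  apply: nearW => n.
  apply: (@le_trans _ _ (\sum_(0 <= k < n) (c / 2 ^+ k)%:E)%E).
    apply: lee_sum => k _.
    have -> : (\int[P]_w u k w = (2 ^+ k * mean P (Y k))%:E)%E.
      rewrite -meanZ// EFin_mean//.
      by apply: bounded_rvM => //; exact: bounded_rv_cst.
    rewrite lee_fin; apply: (@le_trans _ _ (2 ^+ k * (c / 4 ^+ k))).
      by apply: ler_wpM2l; [exact: exprn_ge0|exact: mY].
    rewrite (_ : (4 : R) = 2 * 2); last by ring.
    rewrite exprMn; have : (2 : R) ^+ k != 0 by rewrite expf_neq0.
    by move: (2 ^+ k : R) => x x0; rewrite le_eqVlt; apply/orP; left; apply/eqP; field.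
  rewrite sumEFin lee_fin -mulr_sumr mulrC; apply: ler_wpM2r => //.
  rewrite big_mkord (eq_bigr (fun i : 'I_n => 2^-1 ^+ i)); last first.
    by move=> i _; rewrite exprVn.
  have := subrX1 (2^-1 : R) n; have : 0 <= (2^-1 : R) ^+ n by exact: exprn_ge0.
  by set S := \sum_(_ < _) _; lra.
have := integrable_ae measurableT ug; apply: filterS => w /(_ I) gw.
set g := (\sum_(k <oo) u k w)%E in gw.
have Yle k : Y k w <= fine g * 2^-1 ^+ k.
  rewrite exprVn ler_pdivlMr ?exprn_gt0// mulrC -lee_fin fineK//.
  apply: le_trans (nneseries_lim_ge k.+1 _); last by move=> *; exact: u0.
  by rewrite big_nat_recr//= leeDr// sume_ge0.
apply: (@squeeze_cvgr _ _ _ _ (fun=> 0) (fun k => fine g * 2^-1 ^+ k)).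
- by apply: nearW => k; rewrite Y0 Yle.
- exact: cvg_cst.
- rewrite -[X in _ --> X](mulr0 (fine g)); apply: cvgM; first exact: cvg_cst.
  by apply: cvg_expr; rewrite ger0_norm//; lra.
Qed.

End almost_sure.

Section cost_almost_sure.
Context d (Omega : measurableType d) (R : realType) (P : probability Omega R).
Variables (o : int -> Omega -> R) (eps : R).
Hypothesis env : elliptic_iid P o eps.

(** Squared deviations per site have mean of order [1 / n], which is summable
    along [n = 4 ^ k]. This sparse sequence is enough, as the bounds of the large
    deviation principle hold for all [n]. *)
Lemma cost_ae z (B : nat) (m : nat -> nat) : 0 < z < 1 ->
  (forall n, (m n <= B * n)%N) ->
  {ae P, forall w, (cost z (fun i => o (i%:Z - (4 ^ k)%N%:Z) w) (4 ^ k) (m (4 ^ k)%N)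
    - (m (4 ^ k)%N)%:R * lyapunov P o z) / (4 ^ k)%:R @[k --> \oo] --> 0}.
Proof.
move=> hz mB; pose D n w := cost z (fun i => o (- n%:Z + i%:Z) w) n (m n) - (m n)%:R * lyapunov P o z.
have bD n : bounded_rv (D n).
  apply: bounded_rvB (bounded_rv_cst _ _).
  rewrite /cost; apply: (@bounded_rv_sum _ _ _ (fun i w => - ln (passage o z (- n%:Z) (n + i).+1 w))) => i.
  exact: bounded_cost env _ hz _ _.
pose Y k w := (D (4 ^ k)%N w / (4 ^ k)%:R) ^+ 2.
have bY k : bounded_rv (Y k).
  by apply: bounded_rvX; apply: bounded_rvM => //; exact: bounded_rv_cst.
have fc0 : 0 <= fluctuation_const eps z.
  have := fluctuation_le env 0 hz 0 1; rewrite mulr1; apply: le_trans.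
  by apply: Rintegral_ge0 => w _; exact: sqr_ge0.
have mY k : mean P (Y k) <= (fluctuation_const eps z * B%:R) / 4 ^+ k.
  set n := (4 ^ k)%N; have n0 : 0 < n%:R :> R by rewrite ltr0n expn_gt0.
  have -> : (4 : R) ^+ k = n%:R by rewrite natrX.
  have -> : Y k = fun w => (n%:R^-1 ^+ 2) * D n w ^+ 2.
    by apply/funext => w; rewrite /Y -/n exprMn mulrC.
  rewrite meanZ; last exact: bounded_rvX.
  apply: (@le_trans _ _ (n%:R^-1 ^+ 2 * (fluctuation_const eps z * (B%:R * n%:R)))).
    apply: ler_wpM2l; first by rewrite sqr_ge0.
    apply: le_trans (fluctuation_le env _ hz _ _) _.
    by apply: ler_wpM2l => //; rewrite -natrM ler_nat.
  by rewrite le_eqVlt; apply/orP; left; apply/eqP; field; rewrite gt_eqF.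
have := ae_cvg0_of_mean bY (fun k w => sqr_ge0 _) mY.
apply: filterS => w Yw.
suff : (fun k => D (4 ^ k)%N w / (4 ^ k)%:R) @ \oo --> 0.
  apply: cvg_trans; apply: near_eq_cvg; apply: nearW => k; rewrite /D.
  set n := (4 ^ k)%N.
  have -> // : (fun i : nat => o (i%:Z - n%:Z) w) = (fun i => o (- n%:Z + i%:Z) w).
  by apply/funext => i; rewrite addrC.
apply/cvgr0Pnorm_lt => e e0.
have e20 : 0 < e ^+ 2 by exact: exprn_gt0.
move/cvgr0Pnorm_lt : Yw => /(_ _ e20); apply: filterS => k.
by rewrite /Y normrX ltr_pXn2r ?nnegrE// ltW.
Qed.

End cost_almost_sure.

(** * Large deviation bounds along a subsequence *)

Section subsequence.
Context (R : realType).
Variable N : nat -> nat.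
Hypothesis ltN : forall k, (k < N k)%N.

Lemma cvg_natr_div_trunc (c : R) : 0 <= c ->
  (Num.truncn (c * (N k)%:R))%:R / (N k)%:R @[k --> \oo] --> c.
Proof.
move=> c0.
apply: (@squeeze_cvgr _ _ _ _ (fun k => c - k.+1%:R^-1) (fun=> c)).
- apply: nearW => k; have N0 : 0 < (N k)%:R :> R by rewrite ltr0n (leq_ltn_trans _ (ltN k)).
  have cN0 : 0 <= c * (N k)%:R by rewrite mulr_ge0// ltW.
  have /andP[h1 h2] := truncn_itv cN0.
  rewrite ler_pdivrMr// h1 andbT ler_pdivlMr// mulrBl lerBlDr.
  rewrite -natr1 in h2; apply: (le_trans (ltW h2)); rewrite lerD2l.
  by rewrite ler_pdivlMl// mulr1 ler_nat.
- rewrite -[X in _ --> X]subr0; apply: cvgB; first exact: cvg_cst.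
  exact: cvg_harmonic.
- exact: cvg_cst.
Qed.

Lemma limn_einf_subseq_le (u : nat -> \bar R) (v : nat -> R) (l : R) :
  (\forall k \near \oo, (u (N k) <= (v k)%:E)%E) -> v @ \oo --> l ->
  (limn_einf u <= l%:E)%E.
Proof.
move=> uv vl; rewrite limn_einf_lim.
have vE : EFin \o v @ \oo --> l%:E by apply: cvg_EFin => //; exact: nearW.
rewrite -(cvg_lim _ vE)//; apply: lee_lim; first exact: is_cvg_einfs.
  by apply/cvg_ex; eexists; exact: vE.
near=> k; apply: (@le_trans _ _ (u (N k))); last by near: k.
by apply: ereal_inf_lbound; exists (N k) => //=; exact: ltnW.
Unshelve. all: by end_near. Qed.

Lemma limn_esup_subseq_ge (u : nat -> \bar R) (v : nat -> R) (l : R) :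
  (\forall k \near \oo, ((v k)%:E <= u (N k))%E) -> v @ \oo --> l ->
  (l%:E <= limn_esup u)%E.
Proof.
move=> uv vl; rewrite limn_esup_lim.
have vE : EFin \o v @ \oo --> l%:E by apply: cvg_EFin => //; exact: nearW.
rewrite -(cvg_lim _ vE)//; apply: lee_lim; last 2 first.
- exact: is_cvg_esups.
- near=> k; apply: (@le_trans _ _ (u (N k))); first by near: k.
  by apply: ereal_sup_ubound; exists (N k) => //=; exact: ltnW.
by apply/cvg_ex; eexists; exact: vE.
Unshelve. all: by end_near. Qed.

Lemma lne_le_expR (x y : R) : x <= expR y -> (lne x%:E <= y%:E)%E.
Proof.
move=> xy; rewrite /lne; case: ifPn => [_|]; first exact: leNye.
by rewrite -ltNge => x0; rewrite lee_fin -(expRK y) ler_ln// posrE expR_gt0.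
Qed.

Lemma lne_ge_expR (x y : R) : expR y <= x -> (y%:E <= lne x%:E)%E.
Proof.
move=> xy; have x0 : 0 < x by apply: lt_le_trans xy; exact: expR_gt0.
by rewrite lne_EFin// lee_fin -[leLHS]expRK ler_ln// posrE expR_gt0.
Qed.

End subsequence.

Lemma le_indic (T : Type) (R : numDomainType) (A B : set T) x :
  A `<=` B -> \1_A x <= \1_B x :> R.
Proof.
move=> AB; rewrite !indicE; case: (boolP (x \in A)) => [|_]; last by rewrite ler0n.
by rewrite inE => /AB Bx; rewrite mem_set.
Qed.

Section quenched_bounds.
Context d (T : measurableType d) (R : realType) (Q : probability T R).
Variables (e : int -> R) (S : nat -> T -> int) (I : R -> \bar R).
Hypotheses (rwre : is_rwre e Q S) (he : forall i, 0 < e i < 1).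
Hypothesis ldp : satisfies_ldp Q S I.
Variable N : nat -> nat.
Hypothesis ltN : forall k, (k < N k)%N.

Let N0 k : 0 < (N k)%:R :> R.
Proof. by rewrite ltr0n (leq_ltn_trans _ (ltN k)). Qed.

(** The law of large numbers for the logarithm of the harmonic function of rate
    [r] at the point [c n], along the subsequence [N]. *)
Definition growth_along (r c lam : R) :=
  (cost (expR (- r)) (fun i => e (i%:Z - (N k)%:Z)) (N k)
      (Num.truncn (c * (N k)%:R))
   - (Num.truncn (c * (N k)%:R))%:R * lam) / (N k)%:R @[k --> \oo] --> (0 : R).

Let c_ (r c : R) k := cost (expR (- r)) (fun i => e (i%:Z - (N k)%:Z)) (N k)
      (Num.truncn (c * (N k)%:R)) / (N k)%:R.

Let cvg_c (r c lam : R) : 0 <= c -> growth_along r c lam -> c_ r c @ \oo --> c * lam.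
Proof.
move=> c0 g.
pose m k := Num.truncn (c * (N k)%:R).
have -> : c_ r c = (fun k => (c_ r c k - (m k)%:R / (N k)%:R * lam) +
    (m k)%:R / (N k)%:R * lam) by apply/funext => k; rewrite subrK.
rewrite -[X in _ --> X]add0r; apply: cvgD.
  suff -> : (fun k => c_ r c k - (m k)%:R / (N k)%:R * lam) =
    (fun k => (c_ r c k * (N k)%:R - (m k)%:R * lam) / (N k)%:R).
    suff -> : (fun k => (c_ r c k * (N k)%:R - (m k)%:R * lam) / (N k)%:R) =
      (fun k => (cost (expR (- r)) (fun i => e (i%:Z - (N k)%:Z)) (N k) (m k)
      - (m k)%:R * lam) / (N k)%:R) by [].
    by apply/funext => k; rewrite /c_ divfK// gt_eqF.
  by apply/funext => k; field; rewrite gt_eqF.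
by apply: cvgM (cvg_cst _); exact: cvg_natr_div_trunc.
Qed.

Let he' i : 0 <= e i <= 1.
Proof. by case/andP: (he i) => ? ?; rewrite !ltW. Qed.

Let speedE A n : speed_log_prob Q S A n =
  ((n%:R^-1)%:E * lne (walk_mean e n \1_[set x | A (x%:~R / n%:R)] 0)%:E)%E.
Proof.
rewrite /speed_log_prob -(prob_walk rwre he'); congr (_ * lne _)%E.
Qed.

Let expR01 (r : R) : 0 < r -> 0 < expR (- r) < 1.
Proof. by move=> r0; rewrite expR_gt0 expR_lt1 oppr_lt0. Qed.

Let expRVX (r : R) n : (expR (- r))^-1 ^+ n = expR (n%:R * r).
Proof. by rewrite -expRN opprK -expRM_natl mulr_natl. Qed.

(** The lower bound of the large deviation principle on the half-line beyond
    [c], against Markov's inequality [walk_right_le]. *)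
Lemma quenched_rate_ge (r c lam theta : R) : 0 < r -> 0 <= c < theta ->
  growth_along r c lam -> (- I theta <= (r - c * lam)%:E)%E.
Proof.
move=> r0 /andP[c0 ct] g.
pose A : set R := `]c, +oo[%classic.
have [lb _] := ldp (measurable_itv `]c, +oo[).
apply: le_trans (le_trans lb _).
  rewrite leeN2; apply: ereal_inf_lbound; exists theta => //.
  by rewrite (interior_id A).1 /A /= ?in_itv /= ?andbT//; exact: itv_open.
apply: (limn_einf_subseq_le ltN (v := fun k => r - c_ r c k)); last first.
  by apply: cvgB; [exact: cvg_cst|exact: cvg_c].
apply: nearW => k; rewrite speedE; set n := N k.
have n0 : 0 < n%:R :> R by exact: N0.
rewrite muleC lee_pdivrMr// -EFinM; apply: lne_le_expR.
set m := Num.truncn (c * n%:R).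
apply: (@le_trans _ _ (walk_mean e n \1_[set x | m%:Z <= x] 0)).
  apply: le_walk_mean => // x; apply: le_indic => y /=.
  rewrite in_itv /= andbT ltr_pdivlMr// => cy.
  have /andP[h _] := truncn_itv (mulr_ge0 c0 (ltW n0)).
  by rewrite -(ler_int R); apply: le_trans h (ltW cy).
apply: le_trans (walk_right_le n m (expR01 r0) he) _.
rewrite expRVX -expRD ler_expR mulrBl mulrC lerD2l lerN2 /c_.
by rewrite divfK// gt_eqF.
Qed.

(** A quarter, so that the two tails of the tilted law together leave half of the
    mass to the window. *)
Let expR_small (a : nat -> R) (l : R) : a @ \oo --> l -> l < 0 ->
  \forall k \near \oo, expR ((N k)%:R * a k) <= 4^-1.
Proof.
move=> al l0; near=> k.
have ak : a k <= l / 2.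
  near: k; move/cvgrPdist_le : al => /(_ (- l / 2)).
  have l2 : 0 < - l / 2 by lra.
  move=> /(_ l2); apply: filterS => k; rewrite ler_norml => /andP[h _]; lra.
have kN : (- 6 / l) <= (N k)%:R.
  apply: (@le_trans _ _ k%:R); last by rewrite ler_nat ltnW.
  by near: k; exact: nbhs_infty_ger.
have Nl : (N k)%:R * a k <= - 3.
  apply: (@le_trans _ _ ((N k)%:R * (l / 2))).
    by apply: ler_wpM2l => //; exact: ltW.
  by move: kN; rewrite ler_ndivrMr//; lra.
rewrite -[leLHS]invrK -expRN lef_pV2 ?posrE ?expR_gt0//.
by apply: le_trans (expR_ge1Dx _); lra.
Unshelve. all: by end_near. Qed.

(** The upper bound of the large deviation principle on the interval from [c1]
    to [c2], against [walk_window_ge]. The two strict inequalities say that,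
    under the law tilted at rate [r], the probabilities of ending to the left of
    [c1 * n] and to the right of [c2 * n] decay exponentially. *)
Lemma quenched_rate_le (r r1 r2 c1 c2 lam lam1 lam2 : R) :
  0 < r1 -> r1 <= r -> r <= r2 -> 0 <= c1 -> 0 <= c2 ->
  growth_along r c1 lam -> growth_along r1 c1 lam1 ->
  growth_along r c2 lam -> growth_along r2 c2 lam2 ->
  r1 - r + c1 * (lam - lam1) < 0 -> r2 - r + c2 * (lam - lam2) < 0 ->
  (ereal_inf (I @` `[c1, c2]) <= (c2 * lam - r)%:E)%E.
Proof.
move=> r10 r1r rr2 c10 c20 g1 g11 g2 g22 d1 d2.
pose A : set R := `[c1, c2]%classic.
have [_ ub] := ldp (measurable_itv `[c1, c2]).
suff : ((r - c2 * lam)%:E <= limn_esup (speed_log_prob Q S A))%E.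
  move=> /le_trans /(_ ub).
  rewrite (_ : closure _ = A); last by apply/esym/closure_id; exact: itv_closed.
  by rewrite leeNr -EFinN opprB.
pose a k := r1 - r + (c_ r c1 k - c_ r1 c1 k).
pose b k := r2 - r + (c_ r c2 k - c_ r2 c2 k).
have ha : a @ \oo --> r1 - r + c1 * (lam - lam1).
  apply: cvgD; first exact: cvg_cst.
  by rewrite mulrBr; apply: cvgB; exact: cvg_c.
have hb : b @ \oo --> r2 - r + c2 * (lam - lam2).
  apply: cvgD; first exact: cvg_cst.
  by rewrite mulrBr; apply: cvgB; exact: cvg_c.
apply: (limn_esup_subseq_ge ltN (v := fun k => r - c_ r c2 k - (N k)%:R^-1)).
  near=> k.
  have sa : expR ((N k)%:R * a k) <= 4^-1 by near: k; exact: expR_small ha d1.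
  have sb : expR ((N k)%:R * b k) <= 4^-1 by near: k; exact: expR_small hb d2.
  rewrite speedE; move: sa sb; set n := N k => sa sb.
  have n0 : 0 < n%:R :> R by exact: N0.
  rewrite muleC lee_pdivlMr// -EFinM; apply: lne_ge_expR.
  set m1 := Num.truncn (c1 * n%:R); set m2 := Num.truncn (c2 * n%:R).
  set u := fun i : nat => e (i%:Z - n%:Z).
  pose W := walk_mean e n \1_[set x | m1%:Z < x < m2%:Z] 0.
  apply: (@le_trans _ _ W); last first.
    apply: le_walk_mean => // x; apply: le_indic => y /= /andP[y1 y2].
    rewrite /A /= in_itv /= ler_pdivlMr// ler_pdivrMr//; apply/andP; split.
      have /andP[_ h] := truncn_itv (mulr_ge0 c10 (ltW n0)).
      apply: le_trans (ltW h) _.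
      by rewrite [_.+1%:R]pmulrn ler_int -addn1 PoszD lezD1.
    have /andP[h _] := truncn_itv (mulr_ge0 c20 (ltW n0)).
    apply: le_trans h.
    by rewrite [m2%:R]pmulrn ler_int ltW.
  have costE r' c : cost (expR (- r')) u n (Num.truncn (c * n%:R)) = n%:R * c_ r' c k.
    by rewrite /c_ [RHS]mulrC divfK// gt_eqF.
  have := @walk_window_ge R (expR (- r)) (expR (- r1)) (expR (- r2)) e n m1 m2.
  rewrite !expRVX -/W -/u => /(_ (expR_gt0 _)).
  rewrite !ler_expR !lerN2 expR_lt1 oppr_lt0 => /(_ rr2 r1r r10 he).
  rewrite !costE -!expRD => win.
  have ea : n%:R * r1 + (n%:R * c_ r c1 k - n%:R * c_ r1 c1 k) = n%:R * r + n%:R * a k.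
    by rewrite /a; ring.
  have eb : n%:R * r2 + (n%:R * c_ r c2 k - n%:R * c_ r2 c2 k) = n%:R * r + n%:R * b k.
    by rewrite /b; ring.
  rewrite ea eb !expRD in win.
  have x0 := expR_gt0 (n%:R * r).
  have half : expR (n%:R * r) * 2^-1 <= expR (n%:R * c_ r c2 k) * W.
    have := ler_wpM2l (ltW x0) sa; have := ler_wpM2l (ltW x0) sb.
    by move: win; set x := expR (n%:R * r); lra.
  have e1 : expR (- 1) <= 2^-1 :> R.
    rewrite expRN lef_pV2 ?posrE ?expR_gt0//.
    by apply: le_trans (expR_ge1Dx _); lra.
  rewrite -(ler_pM2l (expR_gt0 (n%:R * c_ r c2 k))) -expRD.
  apply: le_trans half.
  have -> : n%:R * c_ r c2 k + (r - c_ r c2 k - n%:R^-1) * n%:R = n%:R * r - 1.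
    by field; rewrite gt_eqF.
  by rewrite expRD; apply: ler_wpM2l => //; exact: ltW.
rewrite -[X in _ --> X]subr0; apply: cvgB.
  by apply: cvgB; [exact: cvg_cst|exact: cvg_c].
apply: (@squeeze_cvgr _ _ _ _ (fun=> 0 : R) (fun k => k.+1%:R^-1)).
- apply: nearW => k; rewrite invr_ge0 ltW//= lef_pV2 ?posrE ?ltr0n ?(leq_ltn_trans _ (ltN k))//.
  by rewrite ler_nat.
- exact: cvg_cst.
- exact: cvg_harmonic.
Unshelve. all: by end_near. Qed.

End quenched_bounds.

(** * Power series with nonnegative coefficients *)

Lemma ultra_map (S T : Type) (U : set_system S) (f : S -> T) :
  UltraFilter U -> UltraFilter (f @ U).
Proof.
move=> UU; split; first exact: fmap_proper_filter.
move=> G GG fG; apply/seteqP; split => // A GA.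
have [//|UnA] := in_ultra_setVsetC (f @^-1` A) UU.
have GnA : G (~` A) by apply: fG.
have /(_ _) := filterI GA GnA; rewrite setICr => G0.
by case: (@filter_not_empty _ G _ G0).
Qed.

Section absolutely_monotone.
Context (R : realType).
Implicit Types (c : nat -> R) (f g : R -> R) (z C : R).

Definition power_sum c f :=
  (forall k, 0 <= c k) /\
  forall z, 0 < z < 1 -> \sum_(i < K) c i * z ^+ i @[K --> \oo] --> f z.

(** The bound [C] makes this class closed under limits and under means. *)
Definition abs_monotone C f :=
  (exists c, power_sum c f) /\ forall z, 0 < z < 1 -> f z <= C.

Lemma psum_nondecreasing c z K L : (forall k, 0 <= c k) -> 0 <= z -> (K <= L)%N ->
  \sum_(i < K) c i * z ^+ i <= \sum_(i < L) c i * z ^+ i.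
Proof.
move=> c0 z0 KL; rewrite -!(big_mkord xpredT (fun i => c i * z ^+ i)).
rewrite (big_cat_nat (leq0n K) KL)//= lerDl; apply: sumr_ge0 => i _.
by rewrite mulr_ge0// exprn_ge0.
Qed.

Lemma power_sum_le c f z K : power_sum c f -> 0 < z < 1 ->
  \sum_(i < K) c i * z ^+ i <= f z.
Proof.
move=> [c0 cf] hz; have /andP[z0 z1] := hz.
rewrite -(cvg_lim _ (cf z hz))//; apply: limr_ge.
  by apply/cvg_ex; eexists; exact: cf.
by near=> L; apply: psum_nondecreasing => //; [exact: ltW|near: L; exact: nbhs_infty_ge].
Unshelve. all: by end_near. Qed.

(** Beyond the index [K], passing from [y] to [z] gains at least the factor
    [(z / y) ^ K]. In this form the tail estimate survives limits and means. *)
Lemma power_sum_tail c f z y K : power_sum c f -> 0 < z -> z < y -> y < 1 ->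
  f z - (z / y) ^+ K * f y <= \sum_(i < K) c i * z ^+ i.
Proof.
move=> cf z0 zy y1.
have hz : 0 < z < 1 by lra.
have hy : 0 < y < 1 by lra.
have y0 : 0 < y by lra.
have [c0 cz] := cf; rewrite lerBlDr.
rewrite -(cvg_lim _ (cz z hz))//; apply: limr_le.
  by apply/cvg_ex; eexists; exact: cz.
have q0 : 0 <= z / y by rewrite divr_ge0// ltW.
have q1 : z / y <= 1 by rewrite ler_pdivrMr// mul1r ltW.
near=> L; have KL : (K <= L)%N by near: L; exact: nbhs_infty_ge.
apply: (@le_trans _ _ (\sum_(i < K) c i * z ^+ i +
    (z / y) ^+ K * \sum_(i < L) c i * y ^+ i)); last first.
  by rewrite lerD2l; apply: ler_wpM2l; [exact: exprn_ge0|exact: power_sum_le].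
rewrite -!(big_mkord xpredT (fun i => c i * _ ^+ i)).
rewrite (big_cat_nat (leq0n K) KL)//= lerD2l.
rewrite [\sum_(0 <= i < L) _](big_cat_nat (leq0n K) KL)//= mulrDr.
rewrite ler_wpDl//.
  rewrite mulr_ge0 ?exprn_ge0//; apply: sumr_ge0 => i _.
  by rewrite mulr_ge0// exprn_ge0// ltW.
rewrite mulr_sumr; apply: ler_sum_nat => i /andP[Ki _].
rewrite mulrCA; apply: ler_wpM2l => //.
have -> : z ^+ i = (z / y) ^+ i * y ^+ i.
  by rewrite -exprMn divfK// gt_eqF.
apply: ler_wpM2r; first by rewrite exprn_ge0// ltW.
exact: ler_wiXn2l.
Unshelve. all: by end_near. Qed.

Lemma power_sum_of_sandwich c f : (forall k, 0 <= c k) ->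
  (forall z, 0 < z < 1 -> exists q D, 0 <= q < 1 /\ forall K,
    f z - q ^+ K * D <= \sum_(i < K) c i * z ^+ i <= f z) ->
  power_sum c f.
Proof.
move=> c0 H; split => // z /H[q [D [/andP[q0 q1] sw]]].
apply: (@squeeze_cvgr _ _ _ _ (fun K => f z - q ^+ K * D) (fun=> f z)).
- exact: nearW.
- rewrite -[X in _ --> X]subr0 -[X in _ --> _ - X](mul0r D).
  apply: cvgB; first exact: cvg_cst.
  by apply: cvgM (cvg_cst _); apply: cvg_expr; rewrite ger0_norm.
- exact: cvg_cst.
Qed.

Lemma power_sum_ge0 c f z : power_sum c f -> 0 < z < 1 -> 0 <= f z.
Proof.
by move=> cf hz; apply: le_trans (power_sum_le 0 cf hz); rewrite big_ord0.
Qed.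

(** A single term is at most the sum, evaluated at [1 / 2]. *)
Lemma power_sum_coef_le c f C k : power_sum c f ->
  (forall z, 0 < z < 1 -> f z <= C) -> c k <= C * 2 ^+ k.
Proof.
move=> cf fC; have h : 0 < (2^-1 : R) < 1 by lra.
have := le_trans (power_sum_le k.+1 cf h) (fC _ h).
rewrite big_ord_recr/= exprVn => H.
rewrite -ler_pdivrMr ?exprn_gt0//; apply: le_trans H.
rewrite lerDr; apply: sumr_ge0 => i _; rewrite mulr_ge0 ?exprn_ge0//.
by have [] := cf.
Qed.

Lemma abs_monotone_ge0 C f z : abs_monotone C f -> 0 < z < 1 -> 0 <= f z.
Proof. by move=> [[c cf] _]; exact: power_sum_ge0 cf. Qed.

Lemma abs_monotone_le C C' f : abs_monotone C f ->
  (forall z, 0 < z < 1 -> f z <= C') -> abs_monotone C' f.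
Proof. by move=> [h _] fC; split. Qed.

Lemma eq_abs_monotone C f g : (forall z, 0 < z < 1 -> f z = g z) ->
  abs_monotone C f -> abs_monotone C g.
Proof.
move=> fg [[c [c0 cf]] fC]; split; last by move=> z hz; rewrite -fg// fC.
by exists c; split => // z hz; rewrite -fg//; exact: cf.
Qed.

(** The coefficients of the limit are taken along an ultrafilter, which makes all
    of them converge at once. *)
Lemma abs_monotone_lim C (F : nat -> R -> R) f :
  (forall n, abs_monotone C (F n)) ->
  (forall z, 0 < z < 1 -> F ^~ z @ \oo --> f z) ->
  abs_monotone C f.
Proof.
move=> hF Ff; have [c hc] := choice (fun n => (hF n).1).
have C0 : 0 <= C.
  have h : 0 < (2^-1 : R) < 1 by lra.
  exact: le_trans (abs_monotone_ge0 (hF 0%N) h) ((hF 0%N).2 _ h).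
have [U [UU subU]] := @ultraFilterLemma nat \oo _.
have lim_coef k : exists l : R, c ^~ k @ U --> l.
  have := @segment_compact R 0 (C * 2 ^+ k); rewrite compact_ultra.
  have UF : UltraFilter ((c ^~ k) @ U) by exact: ultra_map.
  move=> /(_ _ UF)[|l [_ hl]]; last by exists l.
  suff : U [set n | c n k \in `[0, C * 2 ^+ k]] by [].
  apply: (@nearW _ U) => n; rewrite /= in_itv /=.
  by rewrite (hc n).1/=; exact: power_sum_coef_le (hc n) (hF n).2.
have [c' hc'] := choice lim_coef.
split; last first.
  move=> z hz; rewrite -(cvg_lim _ (Ff z hz))//; apply: limr_le.
    by apply/cvg_ex; eexists; exact: Ff.
  by apply: nearW => n; exact: (hF n).2.
exists c'; apply: power_sum_of_sandwich => [k|z hz].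
  rewrite -(cvg_lim _ (hc' k))//; apply: limr_ge.
    by apply/cvg_ex; eexists; exact: hc'.
  by apply: nearW => n; exact: (hc n).1.
have [y [zy y1]] : exists y, z < y /\ y < 1 by exists ((z + 1) / 2); lra.
have z0 : 0 < z by lra.
have q0 : 0 <= z / y < 1 by rewrite divr_ge0 ?ltr_pdivrMr ?mul1r//; lra.
exists (z / y), C; split => // K.
have hK : \sum_(i < K) c n i * z ^+ i @[n --> U] --> \sum_(i < K) c' i * z ^+ i.
  elim: K => [|K IH].
    by under eq_cvg do rewrite big_ord0; rewrite big_ord0; exact: cvg_cst.
  under eq_cvg do rewrite big_ord_recr/=; rewrite big_ord_recr/=.
  by apply: cvgD => //; apply: cvgM (cvg_cst _); exact: hc'.
have hf : F ^~ z @ U --> f z by apply: cvg_trans (Ff z hz); exact: cvg_fmap2.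
apply/andP; split.
  have hl : F n z - (z / y) ^+ K * C @[n --> U] --> f z - (z / y) ^+ K * C.
    by apply: cvgB => //; exact: cvg_cst.
  rewrite -(cvg_lim _ hl)// -(cvg_lim _ hK)//; apply: ler_lim.
  - by apply/cvg_ex; eexists; exact: hl.
  - by apply/cvg_ex; eexists; exact: hK.
  apply: nearW => n; apply: le_trans (power_sum_tail K (hc n) z0 zy y1).
  rewrite lerD2l lerN2; apply: ler_wpM2l; first by rewrite exprn_ge0//; case/andP: q0.
  by apply: (hF n).2; lra.
rewrite -(cvg_lim _ hf)// -(cvg_lim _ hK)//; apply: ler_lim.
- by apply/cvg_ex; eexists; exact: hK.
- by apply/cvg_ex; eexists; exact: hf.
by apply: nearW => n; exact: power_sum_le.
Qed.

Lemma abs_monotone_poly C (p : {poly R}) : (forall k, 0 <= p`_k) ->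
  (forall z, 0 < z < 1 -> p.[z] <= C) -> abs_monotone C (horner p).
Proof.
move=> p0 pC; split => //; exists (fun k => p`_k); split => // z hz.
apply: cvg_near_cst; near=> K.
have sK : (size p <= K)%N by near: K; exact: nbhs_infty_ge.
by rewrite (horner_coef_wide _ sK).
Unshelve. all: by end_near. Qed.

(** Products of truncations are polynomials, so the Cauchy product series is
    obtained as a limit by [abs_monotone_lim]. *)
Lemma abs_monotoneM C C' f g : abs_monotone C f -> abs_monotone C' g ->
  abs_monotone (C * C') (fun z => f z * g z).
Proof.
move=> [[c hc] fC] [[c' hc'] gC].
pose p n := \poly_(i < n) c i; pose q n := \poly_(i < n) c' i.
have pE n z : (p n).[z] = \sum_(i < n) c i * z ^+ i.
  by rewrite (horner_coef_wide _ (size_poly _ _)); apply: eq_bigr => i _; rewrite coef_poly ltn_ord.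
have qE n z : (q n).[z] = \sum_(i < n) c' i * z ^+ i.
  by rewrite (horner_coef_wide _ (size_poly _ _)); apply: eq_bigr => i _; rewrite coef_poly ltn_ord.
apply: (@abs_monotone_lim _ (fun n => horner (p n * q n))) => [n|z hz]; last first.
  under eq_cvg do rewrite hornerM pE qE.
  by apply: cvgM; [exact: hc.2|exact: hc'.2].
apply: abs_monotone_poly => [k|z hz].
  rewrite coefM; apply: sumr_ge0 => i _; rewrite !coef_poly.
  by apply: mulr_ge0; case: ifP => // _; [exact: hc.1|exact: hc'.1].
rewrite hornerM pE qE; have z0 : 0 <= z by case/andP: hz => /ltW.
apply: ler_pM.
- by apply: sumr_ge0 => i _; rewrite mulr_ge0 ?exprn_ge0//; exact: hc.1.
- by apply: sumr_ge0 => i _; rewrite mulr_ge0 ?exprn_ge0//; exact: hc'.1.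
- exact: le_trans (power_sum_le n hc hz) (fC _ hz).
- exact: le_trans (power_sum_le n hc' hz) (gC _ hz).
Qed.

Lemma abs_monotoneD C C' f g : abs_monotone C f -> abs_monotone C' g ->
  abs_monotone (C + C') (fun z => f z + g z).
Proof.
move=> [[c hc] fC] [[c' hc'] gC]; split; last by move=> z hz; rewrite lerD ?fC ?gC.
exists (fun k => c k + c' k); split => [k|z hz].
  by rewrite addr_ge0 ?hc.1 ?hc'.1.
under eq_cvg => n do (under eq_bigr do rewrite mulrDl; rewrite big_split/=).
by apply: cvgD; [exact: hc.2|exact: hc'.2].
Qed.

Lemma abs_monotone_cst a : 0 <= a -> abs_monotone a (fun=> a).
Proof.
move=> a0; apply: (@eq_abs_monotone _ (horner a%:P)) => [z _|].
  by rewrite hornerC.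
apply: abs_monotone_poly => [k|z _]; last by rewrite hornerC.
by rewrite coefC; case: ifP.
Qed.

Lemma abs_monotone_id : abs_monotone 1 (fun z => z).
Proof.
apply: (@eq_abs_monotone _ (horner 'X)) => [z _|]; first by rewrite hornerX.
apply: abs_monotone_poly => [k|z hz]; last by rewrite hornerX; lra.
by rewrite coefX ler0n.
Qed.

Lemma abs_monotoneX f n : abs_monotone 1 f -> abs_monotone 1 (fun z => f z ^+ n).
Proof.
move=> hf; elim: n => [|n IH].
  by apply: eq_abs_monotone (abs_monotone_cst ler01) => z _; rewrite expr0.
rewrite -[X in abs_monotone X _](mulr1 1).
by apply: eq_abs_monotone (abs_monotoneM hf IH) => z _; rewrite exprS.
Qed.

(** The partial sums are built by [abs_monotoneM] and [abs_monotoneD], and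
    increase to [g]. *)
Lemma abs_monotone_comp C f (a : nat -> R) g : abs_monotone 1 f ->
  (forall k, 0 <= a k) -> (forall z, 0 < z < 1 -> g z <= C) ->
  (forall z, 0 < z < 1 -> \sum_(i < K) a i * f z ^+ i @[K --> \oo] --> g z) ->
  abs_monotone C g.
Proof.
move=> hf a0 gC ag.
pose F n z := \sum_(i < n) a i * f z ^+ i.
have hF n : abs_monotone (\sum_(i < n) a i) (F n).
  rewrite /F; elim: n => [|n IH].
    rewrite big_ord0; apply: eq_abs_monotone (abs_monotone_cst (lexx 0)) => z _.
    by rewrite big_ord0.
  rewrite big_ord_recr/=.
  have := abs_monotoneM (abs_monotone_cst (a0 n)) (abs_monotoneX n hf).
  rewrite mulr1 => h; apply: eq_abs_monotone (abs_monotoneD IH h) => z _.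
  by rewrite big_ord_recr.
apply: (@abs_monotone_lim _ F) => // n; apply: abs_monotone_le (hF n) _ => z hz.
apply: le_trans (gC z hz); rewrite -(cvg_lim _ (ag z hz))//; apply: limr_ge.
  by apply/cvg_ex; eexists; exact: ag.
near=> L; apply: psum_nondecreasing => //; first exact: abs_monotone_ge0 hf _.
by near: L; exact: nbhs_infty_ge.
Unshelve. all: by end_near. Qed.

Lemma abs_monotone_geometric C f : abs_monotone 1 f ->
  (forall z, 0 < z < 1 -> f z < 1) ->
  (forall z, 0 < z < 1 -> (1 - f z)^-1 <= C) ->
  abs_monotone C (fun z => (1 - f z)^-1).
Proof.
move=> hf f1 fC; apply: (@abs_monotone_comp _ f (fun=> 1)) => // z hz.
have f0 := abs_monotone_ge0 hf hz; have d0 : 1 - f z != 0.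
  by rewrite gt_eqF// subr_gt0 f1.
have -> : (fun K => \sum_(i < K) 1 * f z ^+ i) = (fun K => (1 - f z ^+ K) / (1 - f z)).
  apply/funext => K; apply: (mulIf d0); rewrite divfK//.
  rewrite (eq_bigr (fun i : 'I_K => f z ^+ i)); last by move=> i _; rewrite mul1r.
  by rewrite mulrC -opprB mulNr -subrX1 opprB.
rewrite -[X in _ --> X]mul1r; apply: cvgM (cvg_cst _).
rewrite -[X in _ --> X]subr0; apply: cvgB; first exact: cvg_cst.
by apply: cvg_expr; rewrite ger0_norm// f1.
Qed.

Lemma cvg_log_series (x : R) : 0 <= x < 1 ->
  \sum_(i < K) i%:R^-1 * x ^+ i @[K --> \oo] --> - ln (1 - x).
Proof.
move=> /andP[]; rewrite le_eqVlt => /predU1P[<- _|x0 x1].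
  rewrite subr0 ln1 oppr0; apply: cvg_near_cst; apply: nearW => K.
  apply: big1 => -[[|i] _] _ /=; first by rewrite invr0 mul0r.
  by rewrite expr0n mulr0.
have x10 : 0 < 1 - x by rewrite subr_gt0.
rewrite -(cvg_shiftS (fun K => \sum_(i < K) i%:R^-1 * x ^+ i)).
pose h K := \sum_(i < K.+1) (i%:R^-1 \*: ((@id R) ^+ i)) : R -> R.
pose g : R -> R := (@ln R) \o (cst 1 - (@id R)).
have hE K t : h K t = \sum_(i < K.+1) i%:R^-1 * t ^+ i.
  by rewrite /h fct_sumE; apply: eq_bigr => i _; rewrite /= exprfctE.
have dh K (t : R) : is_derive t (1 : R) (h K) (\sum_(i < K) t ^+ i).
  have d : is_derive t (1 : R) (h K)
      (\sum_(i < K.+1) i%:R^-1 *: ((i%:R * t ^+ i.-1) *: 1)).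
    by apply: is_derive_sum => i; apply: is_deriveZ; exact: is_deriveX.
  apply: is_derive_eq; rewrite big_ord_recl /= invr0 scale0r add0r.
  apply: eq_bigr => i _; by rewrite /GRing.scale/= mulr1 mulKf// pnatr_eq0.
have dg (t : R) : t < 1 -> is_derive t (1 : R) g (- (1 - t)^-1).
  move=> t1; have t10 : 0 < 1 - t by rewrite subr_gt0.
  rewrite -mulrN1; apply: is_derive1_comp; first exact: is_derive1_ln.
  by apply: is_derive_eq; rewrite sub0r.
have dgh K (t : R) : t < 1 -> is_derive t (1 : R) (- (g + h K)) (t ^+ K / (1 - t)).
  move=> t1; have t10 : 1 - t != 0 by rewrite gt_eqF// subr_gt0.
  have d := is_deriveN (is_deriveD (dg t t1) (dh K t)).
  apply: (is_derive_eq d); apply: (mulIf t10); rewrite divfK//.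
  rewrite mulNr mulrDl mulNr mulVf//.
  by have := subrX1 t K; rewrite -(opprB t 1) mulrN mulrC => <-; ring.
have bound K : - ln (1 - x) - x ^+ K / (1 - x) <= h K x <= - ln (1 - x).
  have dgh' t : t \in `]0, x[ -> is_derive t (1 : R) (- (g + h K)) (t ^+ K / (1 - t)).
    by rewrite in_itv/= => /andP[_ tx]; apply: dgh; exact: lt_trans x1.
  have cgh : {within `[0, x], continuous (- (g + h K))}.
    apply: derivable_within_continuous => t; rewrite in_itv/= => /andP[_ tx].
    by apply: ex_derive; apply: dgh; exact: le_lt_trans x1.
  have [c] := MVT x0 dgh' cgh.
  have evalE t : (- (g + h K)) t = - ln (1 - t) - h K t by rewrite /= opprD.
  have h0 : h K 0 = 0.
    rewrite hE; apply: big1 => -[[|i] _] _ /=; first by rewrite invr0 mul0r.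
    by rewrite expr0n mulr0.
  rewrite !evalE h0 !subr0 ln1 oppr0 subr0 in_itv/= => /andP[c0 cx] e.
  have c10 : 0 < 1 - c by lra.
  have cK0 : 0 <= c ^+ K by rewrite exprn_ge0// ltW.
  have lo : 0 <= c ^+ K / (1 - c) * x.
    by rewrite !mulr_ge0 ?invr_ge0 ?(ltW x0)// ltW.
  have up : c ^+ K / (1 - c) * x <= x ^+ K / (1 - x).
    rewrite -[leRHS]mulr1; apply: ler_pM => //; [|exact: ltW|apply: ler_pM|exact: ltW] => //.
    - by rewrite mulr_ge0 ?invr_ge0// ltW.
    - by rewrite invr_ge0 ltW.
    - by apply: lerXn2r => //; rewrite ?nnegrE ltW.
    - by rewrite lef_pV2 ?posrE//; lra.
  by move: e lo up; move: (ln (1 - x)) (h K x) (x ^+ K / (1 - x)) (c ^+ K / (1 - c) * x) => *; lra.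
apply: (@squeeze_cvgr _ _ _ _ (fun K => - ln (1 - x) - x ^+ K / (1 - x)) (fun=> - ln (1 - x))).
- by apply: nearW => K; have := bound K; rewrite hE.
- rewrite -[X in _ --> X]subr0 -[X in _ --> _ - X](mul0r (1 - x)^-1).
  apply: cvgB; first exact: cvg_cst.
  by apply: cvgM (cvg_cst _); apply: cvg_expr; rewrite ger0_norm// ltW.
- exact: cvg_cst.
Qed.

Lemma abs_monotone_log C f : abs_monotone 1 f ->
  (forall z, 0 < z < 1 -> f z < 1) ->
  (forall z, 0 < z < 1 -> - ln (1 - f z) <= C) ->
  abs_monotone C (fun z => - ln (1 - f z)).
Proof.
move=> hf f1 fC; apply: (@abs_monotone_comp _ f (fun i => i%:R^-1)) => // z hz.
by apply: cvg_log_series; rewrite (abs_monotone_ge0 hf hz) f1.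
Qed.

End absolutely_monotone.

(** * The Lyapunov exponent as a power series *)

Section mixtures.
Context d (Omega : measurableType d) (R : realType) (P : probability Omega R).

(** The coefficient [k] is the limit, as [z] tends to [0], of the remainder after
    the earlier terms, divided by [z ^ k]. *)
Lemma measurable_power_sum_coef C (f : Omega -> R -> R) (c : Omega -> nat -> R) k :
  (forall w, power_sum (c w) (f w)) ->
  (forall w z, 0 < z < 1 -> f w z <= C) ->
  (forall z, 0 < z < 1 -> measurable_fun setT (f ^~ z)) ->
  measurable_fun setT (c ^~ k).
Proof.
move=> cf fC mf; have [m] := ubnP k; elim: m k => // m IH k; rewrite ltnS => km.
pose x n : R := n.+2%:R^-1.
have hx n : 0 < x n < 1.
  by rewrite invr_gt0 ltr0n/= invf_lt1 ?ltr0n// ltr1n.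
pose g n w := (f w (x n) - \sum_(j < k) c w j * x n ^+ j) * (x n ^+ k)^-1.
apply: (@measurable_fun_cvg _ _ _ _ g) => [n|w _].
  apply: measurable_funM => //; apply: measurable_funB; first exact: mf.
  apply: measurable_sum => j; apply: measurable_funM => //.
  by apply: IH; exact: leq_trans km.
have y0 : 0 < (3 / 4 : R) by lra.
have y1 : (3 / 4 : R) < 1 by lra.
apply: (@squeeze_cvgr _ _ _ _ (fun=> c w k)
    (fun n => c w k + x n * ((3 / 4) ^- k.+1 * C))).
- apply: nearW => n; have /andP[x0 x1] := hx n.
  have xk0 : 0 < x n ^+ k by exact: exprn_gt0.
  have xy : x n < 3 / 4.
    apply: (@le_lt_trans _ _ 2^-1); last by lra.
    by rewrite lef_pV2 ?posrE ?ltr0n// ler_nat.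
  have h1 := power_sum_le k.+1 (cf w) (hx n).
  have h2 := power_sum_tail k.+1 (cf w) x0 xy y1.
  have h3 : f w (3 / 4) <= C by apply: fC; lra.
  rewrite big_ord_recr/= in h1 h2; set s := \sum_(j < k) _ in h1 h2 *.
  rewrite /g -/s ler_pdivlMr// ler_pdivrMr//; apply/andP; split; first by lra.
  move: h2; rewrite expr_div_n [x n ^+ k.+1]exprS => h2.
  have q0 : 0 <= (3 / 4 : R) ^- k.+1 by rewrite invr_ge0 exprn_ge0// ltW.
  have h4 : x n * x n ^+ k * (3 / 4) ^- k.+1 * f w (3 / 4) <=
            x n * x n ^+ k * (3 / 4) ^- k.+1 * C.
    by apply: ler_wpM2l => //; rewrite !mulr_ge0// ltW.
  move: h2 h4; move: ((3 / 4) ^- k.+1 : R) (f w (3 / 4)) (x n ^+ k) => A B D; lra.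
- exact: cvg_cst.
- rewrite -[X in _ --> X]addr0; apply: cvgD; first exact: cvg_cst.
  rewrite -[X in _ --> X](mul0r ((3 / 4) ^- k.+1 * C)); apply: cvgM (cvg_cst _).
  have := @cvg_harmonic R; rewrite -cvg_shiftS; exact.
Qed.

(** Coefficients and sums may be averaged since both are bounded uniformly in
    [w]. *)
Lemma abs_monotone_mean C (f : Omega -> R -> R) :
  (forall w, abs_monotone C (f w)) ->
  (forall z, 0 < z < 1 -> measurable_fun setT (f ^~ z)) ->
  abs_monotone C (fun z => mean P (f ^~ z)).
Proof.
move=> hf mf; have [c hc] := choice (fun w => (hf w).1).
have fC w z : 0 < z < 1 -> f w z <= C by exact: (hf w).2.
have bf z : 0 < z < 1 -> bounded_rv (f ^~ z).
  move=> hz; split; first exact: mf.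
  by exists C => w; rewrite ger0_norm ?fC//; exact: power_sum_ge0 (hc w) hz.
have bc k : bounded_rv (c ^~ k).
  split; first exact: measurable_power_sum_coef hc fC mf.
  exists (C * 2 ^+ k) => w; rewrite ger0_norm ?(hc w).1//.
  exact: power_sum_coef_le (hc w) (fC w).
split; last first.
  move=> z hz; rewrite -(mean_cst P C); apply: le_mean; [exact: bf|exact: bounded_rv_cst|].
  by move=> w; exact: fC.
exists (fun k => mean P (c ^~ k)); apply: power_sum_of_sandwich => [k|z hz].
  by rewrite -(mean_cst P 0); apply: le_mean => //; [exact: bounded_rv_cst|move=> w; exact: (hc w).1].
have /andP[z0 z1] := hz.
have [y [zy y1]] : exists y, z < y /\ y < 1 by exists ((z + 1) / 2); lra.
have y0 : 0 < y by lra.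
have hy : 0 < y < 1 by lra.
exists (z / y), (mean P (f ^~ y)); split; first by rewrite divr_ge0 ?ltr_pdivrMr ?mul1r//; lra.
move=> K; have bterm i : bounded_rv (fun w => c w i * z ^+ i).
  by apply: bounded_rvM => //; exact: bounded_rv_cst.
have -> : \sum_(i < K) mean P (c ^~ i) * z ^+ i =
    mean P (fun w => \sum_(i < K) c w i * z ^+ i).
  rewrite (@mean_sum _ _ _ _ (fun i w => c w i * z ^+ i))//; apply: eq_bigr => i _.
  by rewrite mulrC -meanZ//; congr mean; apply/funext => w; rewrite mulrC.
have bsum := @bounded_rv_sum _ _ _ (fun i w => c w i * z ^+ i) K bterm.
have bY : bounded_rv (fun w => (z / y) ^+ K * f w y).
  by apply: bounded_rvM; [exact: bounded_rv_cst|exact: bf].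
rewrite -meanZ -?meanB; [|exact: bf..|exact: bY|exact: bf].
apply/andP; split; apply: le_mean => //.
- by apply: bounded_rvB => //; exact: bf.
- by move=> w; exact: power_sum_tail (hc w) z0 zy y1.
- exact: bf.
- by move=> w; exact: power_sum_le (hc w) hz.
Qed.

End mixtures.

Section hitting_series.
Context (R : realType).
Variable u : nat -> R.
Hypothesis hu : forall i, 0 < u i < 1.

(** Generating function of the left excursions from [k]: [hit_step] is a
    geometric series in it. *)
Let excursion k z := z * (1 - u k) * hit z u k.

Let excursion_le k z : 0 < z < 1 -> excursion k z <= 1 - u k.
Proof.
move=> hz; have /andP[h0 hz1] := hit_bound k hz hu; have /andP[u0 u1] := hu k.
have /andP[z0 z1] := hz; rewrite /excursion mulrAC -[leRHS]mul1r.
by apply: ler_wpM2r; nra.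
Qed.

Lemma abs_monotone_excursion k : abs_monotone 1 (fun z => hit z u k) ->
  abs_monotone 1 (excursion k).
Proof.
move=> IH; have /andP[u0 u1] := hu k.
have u10 : 0 <= 1 - u k by lra.
have := abs_monotoneM (abs_monotoneM (@abs_monotone_id R) (abs_monotone_cst u10)) IH.
by move/abs_monotone_le; apply=> z /(excursion_le k); rewrite /excursion; lra.
Qed.

Lemma abs_monotone_hit k : abs_monotone 1 (fun z => hit z u k).
Proof.
elim: k => [|k IH].
  by apply: abs_monotone_le (abs_monotone_cst (lexx 0)) _ => z _; exact: ler01.
have /andP[u0 u1] := hu k.
have inv : abs_monotone (u k)^-1 (fun z => (1 - excursion k z)^-1).
  apply: abs_monotone_geometric => [|z hz|z hz]; first exact: abs_monotone_excursion.
    by have := excursion_le k hz; lra.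
  have := excursion_le k hz => h; rewrite lef_pV2 ?posrE//; lra.
have := abs_monotoneM (abs_monotoneM (@abs_monotone_id R) (abs_monotone_cst (ltW u0))) inv.
move/abs_monotone_le; apply=> z hz.
have /andP[_ h] := hit_bound k.+1 hz hu.
by move: h; rewrite /= /hit_step -/(excursion k z); lra.
Qed.

(** This isolates what is not a power series with nonnegative coefficients in
    [- ln hit]. *)
Lemma ln_hit k z : 0 < z < 1 ->
  - ln (hit z u k.+1) = - ln z - ln (u k) - - ln (1 - excursion k z).
Proof.
move=> hz; have /andP[u0 u1] := hu k; have /andP[z0 z1] := hz.
have e1 : 0 < 1 - excursion k z by have := excursion_le k hz; lra.
rewrite /= /hit_step -/(excursion k z) ln_div ?posrE ?mulr_gt0// lnM ?posrE//.
by ring.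
Qed.

Lemma abs_monotone_log_excursion eps k : 0 < eps -> eps <= u k ->
  abs_monotone (- ln eps) (fun z => - ln (1 - z * (1 - u k) * hit z u k)).
Proof.
move=> e0 eu; apply: abs_monotone_log => [|z hz|z hz].
- exact/abs_monotone_excursion/abs_monotone_hit.
- by have := excursion_le k hz; have /andP[] := hu k; rewrite /excursion; lra.
have := excursion_le k hz; rewrite /excursion => h.
rewrite lerN2 ler_ln ?posrE//; lra.
Qed.

End hitting_series.

Section lyapunov_series.
Context d (Omega : measurableType d) (R : realType) (P : probability Omega R).
Variables (o : int -> Omega -> R) (eps : R).
Hypothesis env : elliptic_iid P o eps.

Definition mean_log_right := mean P (fun w => - ln (o 0 w)).

Let bounded_log i : bounded_rv (fun w => - ln (o i w)).
Proof.
have e0 := ellipticity_gt0 env.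
split; first by apply: measurable_funN; apply: (measurableT_comp (@measurable_ln R)); exact: measurable_env env i.
exists (- ln eps) => w; have /andP[h1 h2] := elliptic_env env i w.
have o0 : 0 < o i w by lra.
rewrite ger0_norm ?oppr_ge0 ?ln_le0; [|lra..].
by rewrite lerN2 ler_ln.
Qed.

Let mean_log i : mean P (fun w => - ln (o i w)) = mean_log_right.
Proof.
apply: (@mean_same_law _ _ _ P _ R (o i) (o 0) (fun x => - ln x)).
- exact: measurable_env env i.
- exact: measurable_env env 0.
- by apply: measurable_funN; exact: measurable_ln.
- exact: (bounded_log i).2.
- exact: (bounded_log 0).2.
- by move=> M mM; exact: same_law_env env i M mM.
Qed.

Let G k w z := - ln (1 - z * (1 - o k%:Z w) * hit z (fun i : nat => o i%:Z w) k).

Let passage0 z k w : passage o z 0 k w = hit z (fun i : nat => o i%:Z w) k.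
Proof. by rewrite /passage; congr hit; apply/funext => i; rewrite add0r. Qed.

Let GE k w z : 0 < z < 1 ->
  G k w z = - ln z + - ln (o k%:Z w) - - ln (passage o z 0 k.+1 w).
Proof.
move=> hz; rewrite passage0 (@ln_hit R _ (fun i => env_bound env _ w) k z hz).
by rewrite /G; ring.
Qed.

Let mG k z : 0 < z < 1 -> bounded_rv (fun w => G k w z).
Proof.
move=> hz; rewrite (_ : (fun w => _) = fun w => - ln z + - ln (o k%:Z w) - - ln (passage o z 0 k.+1 w)).
  apply: bounded_rvB; last exact: bounded_cost env _ hz _ _.
  by apply: bounded_rvD => //; exact: bounded_rv_cst.
by apply/funext => w; rewrite GE.
Qed.

(** The mean of the logarithmic series of the excursions, by [ln_hit]; the
    excursion from [k] has mass at most [1 - o k], which ellipticity keeps away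
    from [1]. *)
Lemma abs_monotone_lyapunov : abs_monotone (- ln eps)
  (fun z => - ln z + mean_log_right - lyapunov P o z).
Proof.
apply: (@abs_monotone_lim _ _ (fun k z => mean P (fun w => G k w z))) => [k|z hz].
  apply: abs_monotone_mean => [w|z hz]; last exact: (mG k hz).1.
  have e0 := ellipticity_gt0 env; have /andP[h _] := elliptic_env env k%:Z w.
  exact: (@abs_monotone_log_excursion R _ (fun i => env_bound env _ w)).
have -> : (fun k => mean P (fun w => G k w z)) =
    (fun k => - ln z + mean_log_right - mean_cost P o z k).
  apply/funext => k.
  have -> : (fun w => G k w z) =
      (fun w => - ln z + - ln (o k%:Z w) - - ln (passage o z 0 k.+1 w)).
    by apply/funext => w; rewrite GE.
  have b1 : bounded_rv (fun w => - ln z + - ln (o k%:Z w)).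
    by apply: bounded_rvD => //; exact: bounded_rv_cst.
  rewrite meanB//; last exact: bounded_cost env _ hz _ _.
  by rewrite meanD ?mean_cst ?mean_log//; exact: bounded_rv_cst.
by apply: cvgB; [exact: cvg_cst|exact: cvg_mean_cost env _ hz].
Qed.

End lyapunov_series.

(** * One step of the logarithm of the odds *)

Section one_step.
Context (R : realType).
Implicit Types z w y x M eps : R.

(** The push that keeps [ln (1 - y)], the logarithm of the probability of not
    passing, above its minimum [ln (1 - z)]; see [log_odds_step]. *)
Definition push z w y := ln (1 + (1 - z) / (z * (1 - w) * (1 - y))).

Lemma push_ratio_ge0 z w y : 0 < z < 1 -> 0 < w < 1 -> 0 <= y <= z ->
  0 <= (1 - z) / (z * (1 - w) * (1 - y)).
Proof.
move=> hz hw hy; have /andP[z0 z1] := hz; have /andP[w0 w1] := hw; have /andP[y0 yz] := hy.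
by rewrite divr_ge0 ?mulr_ge0//; lra.
Qed.

Lemma push_ge0 z w y : 0 < z < 1 -> 0 < w < 1 -> 0 <= y <= z -> 0 <= push z w y.
Proof. by move=> hz hw hy; rewrite ln_ge0// lerDl push_ratio_ge0. Qed.

Lemma push_le z w y eps : 2^-1 <= z < 1 -> 0 < eps -> eps <= w <= 1 - eps ->
  0 <= y <= z -> push z w y <= 2 / eps * ((1 - z) / (1 - y)).
Proof.
move=> /andP[z2 z1] e0 /andP[ew we] hy; have /andP[y0 yz] := hy.
have hz : 0 < z < 1 by lra.
have hw : 0 < w < 1 by lra.
have r0 := push_ratio_ge0 hz hw hy.
apply: (@le_trans _ _ ((1 - z) / (z * (1 - w) * (1 - y)))).
  by apply: le_ln1Dx; lra.
have y1 : 0 < 1 - y by lra.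
have w1 : 0 < 1 - w by lra.
have z0 : 0 < z by lra.
have -> : (1 - z) / (z * (1 - w) * (1 - y)) = (z * (1 - w))^-1 * ((1 - z) / (1 - y)).
  by field; rewrite !gt_eqF.
apply: ler_wpM2r; first by rewrite divr_ge0; lra.
have -> : 2 / eps = (2^-1 * eps)^-1 by field; rewrite gt_eqF.
rewrite lef_pV2 ?posrE ?mulr_gt0//.
by apply: ler_pM => //; lra.
Qed.

(** The identity behind the asymptotics: [ln (1 - y)], which lies between
    [ln (1 - z)] and [0], makes a step [log_rho w], receives [push] and pays the
    cost [- ln hit_step]. *)
Lemma log_odds_step z w y : 0 < z < 1 -> 0 < w < 1 -> 0 <= y <= z ->
  ln (1 - hit_step z w y) + - ln (hit_step z w y) =
  ln (1 - y) + ln ((1 - w) / w) + push z w y.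
Proof.
move=> hz hw hy; have /andP[z0 z1] := hz; have /andP[w0 w1] := hw; have /andP[y0 yz] := hy.
have /andP[h1 h2] := hit_step_bound hz hw hy; have hE := hit_stepE hz hw hy.
set F := hit_step z w y in h1 h2 hE *.
have F0 : 0 < F by apply: lt_le_trans h1; exact: mulr_gt0.
have r0 := push_ratio_ge0 hz hw hy.
have w10 : 0 < 1 - w by lra.
have y10 : 0 < 1 - y by lra.
rewrite /push -ln_div ?posrE//; last by lra.
rewrite -lnM ?posrE//; last by rewrite divr_gt0.
rewrite -lnM ?posrE; [|by rewrite mulr_gt0// divr_gt0|by lra].
congr ln.
have -> : F = z * w / (1 - z * (1 - w) * y) by [].
have d0 := hit_den_gt0 hz hw hy.
by field; rewrite !gt_eqF.
Qed.

Lemma mulr_exp_le x : 0 < x -> x * expR (- x) <= 4 / x.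
Proof.
move=> x0; rewrite expRN ler_pdivrMr ?expR_gt0// mulrAC ler_pdivlMr//.
have h : 1 + x / 2 <= expR (x / 2) by exact: expR_ge1Dx.
have -> : expR x = expR (x / 2) * expR (x / 2) by rewrite -expRD -splitr.
have : (x / 2) * (x / 2) <= expR (x / 2) * expR (x / 2) by apply: ler_pM; lra.
lra.
Qed.

(** A quantity [g] that is exponentially small in [x] stays small after
    multiplication by [x]. *)
Lemma mul_small_le x g c M : 0 <= x -> 0 <= g -> 0 <= c -> 0 < M ->
  g <= c * expR (- x) -> x * g <= M * g + 4 * c / M.
Proof.
move=> x0 g0 c0 M0 gx; have cM : 0 <= 4 * c / M by rewrite divr_ge0 ?mulr_ge0// ltW.
have [xM|Mx] := lerP x M.
  by have : x * g <= M * g; [exact: ler_wpM2r|lra].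
have xp : 0 < x by exact: lt_trans Mx.
apply: (@le_trans _ _ (4 * c / M)); last by rewrite lerDr mulr_ge0// ltW.
apply: (@le_trans _ _ (c * (x * expR (- x)))).
  by rewrite mulrCA; apply: ler_wpM2l.
apply: (@le_trans _ _ (c * (4 / x))).
  by apply: ler_wpM2l => //; exact: mulr_exp_le.
rewrite mulrA [c * 4]mulrC; apply: ler_wpM2l; first by rewrite mulr_ge0.
by rewrite lef_pV2 ?posrE// ltW.
Qed.

(** The push is exponentially small in the height above the minimum
    [ln (1 - z)]. *)
Lemma height_push_le z w y eps M : 2^-1 <= z < 1 -> 0 < eps ->
  eps <= w <= 1 - eps -> 0 <= y <= z -> 0 < M ->
  0 <= (ln (1 - y) - ln (1 - z)) * push z w y <= M * push z w y + 8 / eps / M.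
Proof.
move=> hz2 e0 hw2 hy M0; have /andP[y0 yz] := hy; have /andP[z2 z1] := hz2.
have hz : 0 < z < 1 by lra.
have hw : 0 < w < 1 by lra.
have p0 := push_ge0 hz hw hy; have ple := push_le hz2 e0 hw2 hy.
have z10 : 0 < 1 - z by lra.
have y10 : 0 < 1 - y by lra.
have h0 : 0 <= ln (1 - y) - ln (1 - z) by rewrite subr_ge0 ler_ln ?posrE//; lra.
rewrite mulr_ge0//=; have -> : 8 / eps / M = 4 * (2 / eps) / M by field; rewrite !gt_eqF.
apply: mul_small_le => //; first by rewrite divr_ge0// ltW.
apply: le_trans ple _; rewrite -ln_div ?posrE// expRN lnK ?posrE ?divr_gt0//.
by rewrite invf_div.
Qed.

(** The cost is exponentially small in the depth below the maximum [0]: [- ln y]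
    is at most [2 * (1 - y)] for [y >= 1 / 2], and for smaller [y] the depth is at
    most [1]. *)
Lemma depth_cost_le y M : 0 < y < 1 -> 1 <= M ->
  0 <= - ln (1 - y) * - ln y <= M * - ln y + 8 / M.
Proof.
move=> /andP[y0 y1] M1; have M0 : 0 < M by lra.
have y10 : 0 < 1 - y by lra.
have a0 : 0 <= - ln y by rewrite oppr_ge0 ln_le0// ltW.
have b0 : 0 <= - ln (1 - y) by rewrite oppr_ge0 ln_le0//; lra.
rewrite mulr_ge0//=; have [y2|y2] := lerP 2^-1 y.
  have -> : 8 / M = 4 * 2 / M by congr (_ / _); ring.
  apply: mul_small_le => //; rewrite opprK lnK ?posrE//.
  have := @le_ln1Dx R (y^-1 - 1); rewrite addrCA subrr addr0 lnV ?posrE// => h.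
  apply: (@le_trans _ _ (y^-1 - 1)); first by apply: h; rewrite ltrBrDr addrC subrr invr_gt0.
  rewrite -(ler_pM2r y0) mulrBl mulVf ?gt_eqF// mul1r.
  have h2 : 0 <= 2 * y - 1 by lra.
  have h3 : 0 <= (1 - y) * (2 * y - 1) by apply: mulr_ge0 => //; exact: ltW.
  lra.
apply: (@le_trans _ _ (M * - ln y)); last by rewrite lerDl divr_ge0// ltW.
apply: ler_wpM2r => //; apply: le_trans M1.
rewrite -lnV ?posrE//; apply: (@le_trans _ _ ((1 - y)^-1 - 1)).
  have := @le_ln1Dx R ((1 - y)^-1 - 1); rewrite addrCA subrr addr0; apply.
  by rewrite ltrBrDr addrC subrr invr_gt0.
rewrite lerBlDr (_ : 1 + 1 = 2^-1^-1); last by rewrite invrK.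
by rewrite lef_pV2 ?posrE//; lra.
Qed.

End one_step.

(** * First and second moments of the logarithm of the odds *)

Lemma measurable_log_rho (R : realType) : measurable_fun setT (@log_rho R).
Proof.
apply: (measurableT_comp (@measurable_ln R)); apply: measurable_funM.
  exact: measurable_funB.
exact: measurable_inv.
Qed.

Section moments.
Context d (Omega : measurableType d) (R : realType) (P : probability Omega R).
Variables (o : int -> Omega -> R) (eps : R).
Hypothesis env : elliptic_iid P o eps.
Hypothesis centered : mean P (fun w => log_rho (o 0 w)) = 0.

Let e0 : 0 < eps. Proof. exact: ellipticity_gt0 env. Qed.

Definition log_rho_variance := mean P (fun w => log_rho (o 0 w) ^+ 2).

Lemma norm_log_rho_le i w : `|log_rho (o i w)| <= - ln eps.
Proof.
have /andP[h1 h2] := elliptic_env env i w.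
have eps0 := e0.
have w0 : 0 < o i w by lra.
have w1 : 0 < 1 - o i w by lra.
have r0 : 0 < (1 - o i w) / o i w by rewrite divr_gt0.
rewrite /log_rho ler_norml opprK -lnV ?posrE//.
apply/andP; split; rewrite ler_ln ?posrE ?invr_gt0//.
  rewrite ler_pdivlMr//; apply: (@le_trans _ _ eps); last by lra.
  by rewrite ler_piMr ?ltW//; lra.
rewrite ler_pdivrMr// ler_pdivlMl//.
by apply: le_trans h1; rewrite ler_piMr ?ltW//; lra.
Qed.

Let bounded_log_rho i : bounded_rv (fun w => log_rho (o i w)).
Proof.
split; last by exists (- ln eps) => w; exact: norm_log_rho_le.
exact: measurableT_comp (@measurable_log_rho R) (measurable_env env i).
Qed.

Let mean_log_rho_comp i (f : R -> R) : measurable_fun setT f ->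
  (exists C, forall j w, `|f (log_rho (o j w))| <= C) ->
  mean P (fun w => f (log_rho (o i w))) = mean P (fun w => f (log_rho (o 0 w))).
Proof.
move=> mf [C fC].
apply: (@mean_same_law _ _ _ P _ R (o i) (o 0) (f \o @log_rho R)).
- exact: measurable_env env i.
- exact: measurable_env env 0.
- exact: measurableT_comp mf (@measurable_log_rho R).
- by exists C => w; exact: fC.
- by exists C => w; exact: fC.
- by move=> M mM; exact: same_law_env env i M mM.
Qed.

Let mean_log_rho i : mean P (fun w => log_rho (o i w)) = 0.
Proof.
rewrite -centered; apply: (@mean_log_rho_comp i id) => //.
by exists (- ln eps) => j w; exact: norm_log_rho_le.
Qed.

Let mean_log_rho2 i : mean P (fun w => log_rho (o i w) ^+ 2) = log_rho_variance.
Proof.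
apply: (@mean_log_rho_comp i (fun x => x ^+ 2)); first exact: exprn_measurable.
exists ((- ln eps) ^+ 2) => j w; rewrite normrX lerXn2r ?nnegrE//.
  exact: le_trans (norm_log_rho_le j w).
exact: norm_log_rho_le.
Qed.

Section fixed_rate.
Variable z : R.
Hypothesis hz2 : 2^-1 <= z < 1.

Let hz : 0 < z < 1. Proof. by case/andP: hz2 => ? ?; apply/andP; split; lra. Qed.
Let z0 : 0 < z. Proof. by case/andP: hz. Qed.
Let z1 : z < 1. Proof. by case/andP: hz. Qed.
Let z10 : 0 < 1 - z. Proof. by rewrite subr_gt0. Qed.

Let y a k w := passage o z a k w.
Let hy a k w : 0 <= y a k w <= z.
Proof. exact: hit_bound k hz (fun i => env_bound env _ w). Qed.

Lemma cvg_mean_passage_diff (f : R -> R) L : measurable_fun setT f ->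
  (forall x x', 0 <= x <= z -> 0 <= x' <= z -> `|f x - f x'| <= L * `|x - x'|) ->
  mean P (fun w => f (y 0 k.+1 w)) - mean P (fun w => f (y 0 k w)) @[k --> \oo] --> 0.
Proof.
move=> mf lip.
have zz : 0 <= z <= z by rewrite ltW/=.
have oz : 0 <= (0 : R) <= z by rewrite lexx ltW.
have L0 : 0 <= L.
  have := lip z 0 zz oz; rewrite subr0 (gtr0_norm z0) => h.
  by rewrite -(ler_pM2r z0) mul0r; exact: le_trans (normr_ge0 _) h.
have fC a k w : `|f (y a k w)| <= `|f 0| + L * z.
  rewrite -[f (y a k w)](subrK (f 0)) addrC; apply: le_trans (ler_normD _ _) _.
  rewrite lerD2l; apply: le_trans (lip _ _ (hy a k w) oz) _.
  by rewrite subr0; have /andP[h1 h2] := hy a k w; apply: ler_wpM2l; rewrite ?ger0_norm.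
have bf a k : bounded_rv (fun w => f (y a k w)).
  split; last by exists (`|f 0| + L * z) => w; exact: fC.
  by apply: measurableT_comp => //; exact: measurable_passage env _ _ _.
have shift k : mean P (fun w => f (y 1 k w)) = mean P (fun w => f (y 0 k w)).
  have mf1 : measurable_fun setT (f \o @fst R R) by exact: measurableT_comp.
  exact: (@mean_passage_shift _ _ _ _ _ _ env z 1 k _ (`|f 0| + L * z) mf1
    (fun b w => fC b k w)).
apply/cvgr0Pnorm_le => e e00.
have small : (fun k => L / (1 - z) * z ^+ k) @ \oo --> 0.
  rewrite -[X in _ --> X](mulr0 (L / (1 - z))); apply: cvgM; first exact: cvg_cst.
  by apply: cvg_expr; rewrite ger0_norm// ltW.
move/cvgr0Pnorm_le : small => /(_ _ e00); apply: filterS => k.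
apply: le_trans; rewrite -(shift k); apply: le_trans (ler_norm _).
apply: norm_meanB_le => // w.
apply: le_trans (lip _ _ (hy _ _ _) (hy _ _ _)) _.
rewrite -mulrA; apply: ler_wpM2l => //; rewrite mulrC.
have := hit_forget 1 k hz (fun i => env_bound env (0 + i%:Z) w).
have -> : (fun i : nat => o (0 + (1 + i)%N%:Z) w) = (fun i => o (1 + i%:Z) w).
  by apply/funext => i; rewrite PoszD add0r.
by [].
Qed.

Let ell := - ln (1 - z).
Let V k w := ln (1 - y 0 k w).
Let Y k w := log_rho (o k%:Z w).
Let B k w := push z (o k%:Z w) (y 0 k w).
Let A k w := - ln (y 0 k.+1 w).

Let step k w : V k.+1 w + A k w = V k w + Y k w + B k w.
Proof.
rewrite /V /A /y passageS add0r; by apply: log_odds_step => //; exact: env_bound env _ _.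
Qed.

Let V_bound k w : 0 <= V k w + ell /\ V k w <= 0.
Proof.
have /andP[h1 h2] := hy 0 k w; have h3 := z1; rewrite /ell subr_ge0 /V; split.
  by rewrite ler_ln ?posrE//; lra.
by apply: ln_le0; lra.
Qed.

Let ell0 : 0 <= ell.
Proof. by rewrite oppr_ge0 ln_le0//; have := z0; lra. Qed.

Let mln1 : measurable_fun setT (fun x : R => ln (1 - x)).
Proof. by apply: (measurableT_comp (@measurable_ln R)); exact: measurable_funB. Qed.

Let bV k : bounded_rv (V k).
Proof.
split; first by apply: (measurableT_comp mln1); exact: measurable_passage env _ _ _.
by exists ell => w; have [? ?] := V_bound k w; rewrite ler0_norm//; lra.
Qed.

Let bA k : bounded_rv (A k). Proof. exact: bounded_cost env _ hz _ _. Qed.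
Let bY k : bounded_rv (Y k). Proof. exact: bounded_log_rho. Qed.

Let bB k : bounded_rv (B k).
Proof.
rewrite (_ : B k = fun w => V k.+1 w + A k w - (V k w + Y k w)).
  by apply: bounded_rvB; exact: bounded_rvD.
by apply/funext => w; rewrite step; ring.
Qed.

(** [V k] depends only on the sites before [k], and [log_rho] is centered. *)
Let mean_VY k : mean P (fun w => V k w * Y k w) = 0.
Proof.
have := @mean_passage_site _ _ _ _ _ _ env z 0 k (fun x => ln (1 - x)) (@log_rho R)
  mln1 (@measurable_log_rho R) (bV k).
rewrite add0r => /(_ (bY k)) ->.
by rewrite mean_log_rho mulr0.
Qed.

Let v k := mean P (V k).
Let q k := mean P (fun w => V k w ^+ 2).

Let lipV x x' : 0 <= x <= z -> 0 <= x' <= z ->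
  `|ln (1 - x) - ln (1 - x')| <= (1 - z)^-1 * `|x - x'|.
Proof.
move=> /andP[h1 h2] /andP[h3 h4]; have h0 := z1.
have h5 : 1 - z <= 1 - x by lra.
have h6 : 1 - z <= 1 - x' by lra.
apply: le_trans (ln_lipschitz z10 h5 h6) _.
have -> : 1 - x - (1 - x') = x' - x by ring.
by rewrite distrC mulrC.
Qed.

Let dv : v k.+1 - v k @[k --> \oo] --> 0.
Proof. exact: cvg_mean_passage_diff mln1 lipV. Qed.

Let dq : q k.+1 - q k @[k --> \oo] --> 0.
Proof.
apply: (@cvg_mean_passage_diff (fun x => ln (1 - x) ^+ 2) ((2 * ell) / (1 - z))).
  apply: (measurableT_comp (@exprn_measurable R setT 2)) => //.
move=> x x' hx hx'; rewrite subr_sqr normrM [leLHS]mulrC -[leRHS]mulrA.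
have bd t : 0 <= t <= z -> `|ln (1 - t)| <= ell.
  move=> /andP[t0 tz]; have h0 := z1; rewrite ler0_norm; last by apply: ln_le0; lra.
  by rewrite lerN2 ler_ln ?posrE//; lra.
apply: ler_pM; [by []|by []| |exact: lipV].
by apply: le_trans (ler_normD _ _) _; have := bd x hx; have := bd x' hx'; lra.
Qed.

Definition moment_const1 := 2 - 2 * ln eps + 2 / eps - ln (eps / 2).
Definition moment_const2 := 16 / eps + 16.

Let meanB_eq k : mean P (B k) = mean_cost P o z k + (v k.+1 - v k).
Proof.
rewrite (_ : B k = fun w => V k.+1 w + A k w - (V k w + Y k w)); last first.
  by apply/funext => w; rewrite step; ring.
rewrite meanB ?meanD//; [|exact: bounded_rvD..].
by rewrite mean_log_rho /v /mean_cost /A; lra.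
Qed.

Let B_ge0 k w : 0 <= B k w.
Proof. by apply: push_ge0 => //; exact: env_bound env _ _. Qed.

Let B_le k w : B k w <= 2 / eps.
Proof.
apply: le_trans (push_le hz2 e0 (elliptic_env env _ _) (hy 0 k w)) _.
rewrite -[leRHS]mulr1; apply: ler_wpM2l; first by rewrite divr_ge0// ltW.
have /andP[h1 h2] := hy 0 k w.
by rewrite ler_pdivrMr ?mul1r; have := z1; lra.
Qed.

Let A_bound k w : 0 <= A k w <= - ln (eps / 2).
Proof.
have /andP[h1 h2] := cost_bound env hz 0 k w; rewrite /A h1/=; apply: le_trans h2 _.
have /andP[h3 h4] := hz2; have h5 := e0.
rewrite lerN2 ler_ln ?posrE ?divr_gt0// ?mulr_gt0// mulrC.
by apply: ler_wpM2r => //; exact: ltW.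
Qed.

(** What is left of the square of [step] after removing the dominant push
    [2 * ell * B], the step [Y ^ 2], the increment of [V ^ 2] and the
    correlation of [V] with [Y]. *)
Let remainder k w := 2 * (V k w + ell) * B k w + 2 * Y k w * B k w + B k w ^+ 2
  - 2 * V k.+1 w * A k w - A k w ^+ 2.

Let remainder_le k w M : 1 <= M -> `|remainder k w| <=
  moment_const1 * (1 + M) * (B k w + A k w) + moment_const2 / M.
Proof.
move=> M1; have M0 : 0 < M by lra.
have /andP[wb0 wb] := height_push_le hz2 e0 (elliptic_env env k%:Z w) (hy 0 k w) M0.
have hy1 : 0 < y 0 k.+1 w < 1.
  have /andP[h1 h2] := passage_bound env hz 0 k w; have h3 := z1.
  by rewrite (lt_le_trans _ h1) ?mulr_gt0//=; exact: le_lt_trans h2 h3.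
have /andP[ua0 ua] := depth_cost_le hy1 M1.
have b0 := B_ge0 k w; have bl := B_le k w; have /andP[a0 al] := A_bound k w.
have yl : `|Y k w| <= - ln eps by exact: norm_log_rho_le.
rewrite -/(B k w) in wb0 wb.
have {wb0}wb0 : 0 <= (V k w + ell) * B k w by exact: wb0.
have {wb}wb : (V k w + ell) * B k w <= M * B k w + 8 / eps / M by exact: wb.
have {ua0}ua0 : 0 <= - V k.+1 w * A k w by exact: ua0.
have {ua}ua : - V k.+1 w * A k w <= M * A k w + 8 / M by exact: ua.
have yb : `|Y k w * B k w| <= - ln eps * B k w.
  by rewrite normrM (ger0_norm b0); exact: ler_wpM2r.
have bb : 0 <= B k w ^+ 2 <= 2 / eps * B k w.
  by rewrite sqr_ge0/= expr2; exact: ler_wpM2r.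
have aa : 0 <= A k w ^+ 2 <= - ln (eps / 2) * A k w.
  by rewrite sqr_ge0/= expr2; exact: ler_wpM2r.
have le0 : 0 <= - ln eps by exact: le_trans (normr_ge0 _) yl.
have e2 : 0 <= 2 / eps by rewrite divr_ge0// ltW.
have la0 : 0 <= - ln (eps / 2) by exact: le_trans a0 al.
have S0 : 0 <= B k w + A k w by exact: addr_ge0.
have main : moment_const1 * (1 + M) * (B k w + A k w) + moment_const2 / M =
    (2 * (1 + M) + (1 + M) * (- 2 * ln eps) + (1 + M) * (2 / eps) +
     (1 + M) * (- ln (eps / 2))) * (B k w + A k w) + (2 * (8 / eps / M) + 2 * (8 / M)).
  by rewrite /moment_const1 /moment_const2; field; rewrite !gt_eqF.
have c1 : - ln eps * B k w <= (1 + M) * (- ln eps) * (B k w + A k w).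
  by apply: ler_pM => //; [rewrite ler_peMl//; lra|lra].
have c2 : 2 / eps * B k w <= (1 + M) * (2 / eps) * (B k w + A k w).
  by apply: ler_pM => //; [rewrite ler_peMl//; lra|lra].
have c3 : - ln (eps / 2) * A k w <= (1 + M) * (- ln (eps / 2)) * (B k w + A k w).
  by apply: ler_pM => //; [rewrite ler_peMl//; lra|lra].
rewrite main /remainder; move: yb; rewrite !ler_norml => /andP[yb1 yb2].
case/andP: bb => bb1 bb2; case/andP: aa => aa1 aa2.
apply/andP; split; lra.
Qed.

(** Mean of the square of [step]; [M] is the cutoff of [mul_small_le]. *)
Let second_moment k M : 1 <= M ->
  `|2 * ell * mean P (B k) - log_rho_variance + (q k.+1 - q k)| <=
  moment_const1 * (1 + M) * (mean P (B k) + mean_cost P o z k) + moment_const2 / M.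
Proof.
move=> M1.
have bV2 j : bounded_rv (fun w => V j w ^+ 2) by exact: bounded_rvX.
have bY2 : bounded_rv (fun w => Y k w ^+ 2) by exact: bounded_rvX.
have bVY : bounded_rv (fun w => 2 * (V k w * Y k w)).
  by apply: bounded_rvM; [exact: bounded_rv_cst|exact: bounded_rvM].
have bellB : bounded_rv (fun w => 2 * ell * B k w).
  by apply: bounded_rvM => //; exact: bounded_rv_cst.
have rE : remainder k = fun w => (2 * ell * B k w - Y k w ^+ 2) +
    ((V k.+1 w ^+ 2 - V k w ^+ 2) - 2 * (V k w * Y k w)).
  apply/funext => w; rewrite /remainder.
  have -> : B k w = V k.+1 w + A k w - V k w - Y k w by rewrite step; ring.
  by ring.
have br : bounded_rv (remainder k).
  rewrite rE; apply: bounded_rvD; first exact: bounded_rvB.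
  by apply: bounded_rvB => //; exact: bounded_rvB.
have mr : mean P (remainder k) =
    2 * ell * mean P (B k) - log_rho_variance + (q k.+1 - q k).
  rewrite rE meanD; [|exact: bounded_rvB|apply: bounded_rvB => //; exact: bounded_rvB].
  rewrite [X in X + _]meanB// meanZ// mean_log_rho2.
  rewrite meanB//; last exact: bounded_rvB.
  by rewrite meanB// meanZ ?mean_VY ?mulr0 ?subr0//; exact: bounded_rvM.
pose bnd w := moment_const1 * (1 + M) * (B k w + A k w) + moment_const2 / M.
have bAB : bounded_rv (fun w => moment_const1 * (1 + M) * (B k w + A k w)).
  by apply: bounded_rvM; [exact: bounded_rv_cst|exact: bounded_rvD].
have bb : bounded_rv bnd by apply: bounded_rvD => //; exact: bounded_rv_cst.
have mb : mean P bnd = moment_const1 * (1 + M) *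
    (mean P (B k) + mean_cost P o z k) + moment_const2 / M.
  rewrite /bnd meanD ?mean_cst//; last exact: bounded_rv_cst.
  by rewrite meanZ ?meanD//; exact: bounded_rvD.
rewrite -mr -mb ler_norml -meanN//; apply/andP; split; apply: le_mean => //.
- exact: bounded_rvN.
- by move=> w; have := remainder_le k w M1; rewrite ler_norml => /andP[].
- by move=> w; have := remainder_le k w M1; rewrite ler_norml => /andP[].
Qed.

(** As the number of sites grows, the increments of the moments of [V] vanish:
    the mean push tends to the mean cost, whose limit is the Lyapunov exponent,
    and the second moment balances it against the variance. *)
Lemma lyapunov_moment M : 1 <= M ->
  `|2 * (- ln (1 - z)) * lyapunov P o z - log_rho_variance| <=
  2 * moment_const1 * (1 + M) * lyapunov P o z + moment_const2 / M.
Proof.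
move=> M1; set lam := lyapunov P o z.
have ca : mean_cost P o z @ \oo --> lam by exact: cvg_mean_cost env _ hz.
have cB : (fun k => mean P (B k)) @ \oo --> lam.
  rewrite (_ : (fun k => _) = fun k => mean_cost P o z k + (v k.+1 - v k)).
    by rewrite -[X in _ --> X]addr0; apply: cvgD.
  by apply/funext => k; rewrite meanB_eq.
have cL : (fun k => `|2 * ell * mean P (B k) - log_rho_variance + (q k.+1 - q k)|) @ \oo -->
   `|2 * ell * lam - log_rho_variance|.
  apply: cvg_norm; rewrite -[X in _ --> X]addr0; apply: cvgD => //.
  apply: cvgB; last exact: cvg_cst.
  by apply: cvgM => //; exact: cvg_cst.
have cR : (fun k => moment_const1 * (1 + M) * (mean P (B k) + mean_cost P o z k) + moment_const2 / M)
   @ \oo --> moment_const1 * (1 + M) * (lam + lam) + moment_const2 / M.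
  apply: cvgD; last exact: cvg_cst.
  by apply: cvgM; [exact: cvg_cst|exact: cvgD].
have -> : 2 * moment_const1 * (1 + M) * lam = moment_const1 * (1 + M) * (lam + lam) by ring.
rewrite -(cvg_lim _ cL)// -(cvg_lim _ cR)//; apply: ler_lim.
- by apply/cvg_ex; eexists; exact: cL.
- by apply/cvg_ex; eexists; exact: cR.
by apply: nearW => k; exact: second_moment.
Qed.

End fixed_rate.
End moments.

(** * The Lyapunov exponent at small rates *)

Section small_rate.
Context (R : realType).

Lemma one_sub_expRN_bound (r : R) : 0 < r <= 1 -> r / 2 <= 1 - expR (- r) <= r.
Proof.
move=> /andP[r0 r1]; have h1 : 1 + - r <= expR (- r) by exact: expR_ge1Dx.
have h2 : 1 + r <= expR r by exact: expR_ge1Dx.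
have e0 : 0 < expR r by exact: expR_gt0.
apply/andP; split; last by lra.
have h3 : expR (- r) <= (1 + r)^-1 by rewrite expRN lef_pV2 ?posrE//; lra.
have h4 : (1 + r)^-1 <= 1 - r / 2.
  rewrite -[leLHS]mul1r ler_pdivrMr; last by lra.
  by have : 0 <= r * (1 - r); [apply: mulr_ge0; lra|lra].
lra.
Qed.

Lemma near_ln_ge (T : R) : \forall r \near 0^'+, T <= - ln r.
Proof.
near=> r; have r0 : 0 < r by near: r; exact: nbhs_right_gt.
have rT : r < expR (- T) by near: r; apply: nbhs_right_lt; exact: expR_gt0.
rewrite -[T]opprK lerN2 -[leRHS]expRK ler_ln ?posrE ?expR_gt0//; exact: ltW.
Unshelve. all: by end_near. Qed.

(** The cutoff [M = 1] gives [lam r = O (1 / - ln r)]; the error term is then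
    arbitrarily small for a large fixed [M]. *)
Lemma cvg_of_moment (lam : R -> R) (sig K1 K2 : R) :
  0 <= sig -> 0 <= K1 -> 0 <= K2 -> (forall r, 0 < r -> 0 <= lam r) ->
  (forall r M, 0 < r <= 2^-1 -> 1 <= M ->
    `|2 * (- ln (1 - expR (- r))) * lam r - sig| <= K1 * (1 + M) * lam r + K2 / M) ->
  lam r * - ln r @[r --> 0^'+] --> sig / 2.
Proof.
move=> s0 K10 K20 lam0 mom; apply/cvgrPdist_le => eta eta0.
pose M := 1 + 4 * K2 / eta.
have M1 : 1 <= M by rewrite lerDl divr_ge0 ?mulr_ge0// ltW.
have K2M : K2 / M <= eta / 4.
  rewrite ler_pdivrMr; last by lra.
  rewrite mulrDr mulr1 (_ : eta / 4 * (4 * K2 / eta) = K2); last by field; rewrite gt_eqF.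
  by rewrite lerDr divr_ge0// ltW.
pose T := 2 * (K1 * (1 + M) + 2) * (sig + K2) / eta.
near=> r; have r0 : 0 < r by near: r; exact: nbhs_right_gt.
have r2 : r <= 2^-1 by near: r; apply: nbhs_right_le; rewrite invr_gt0.
have L1 : 2 * K1 + 2 <= - ln r by near: r; exact: near_ln_ge.
have L2 : T <= - ln r by near: r; exact: near_ln_ge.
have L3 : 1 <= - ln r by near: r; exact: near_ln_ge.
have hr : 0 < r <= 1 by rewrite r0/=; lra.
have hr2 : 0 < r <= 2^-1 by rewrite r0.
have /andP[b1 b2] := one_sub_expRN_bound hr.
have b0 : 0 < 1 - expR (- r) by apply: lt_le_trans b1; rewrite divr_gt0.
have l0 := lam0 r r0.
set L := - ln r in L1 L2 L3 *; set ell := - ln (1 - expR (- r)).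
have lL : L <= ell by rewrite lerN2 ler_ln ?posrE.
have lL1 : ell <= L + 1.
  have : ln (r / 2) <= ln (1 - expR (- r)) by rewrite ler_ln ?posrE// divr_gt0.
  rewrite ln_div ?posrE// => h.
  have := @le_ln1Dx R 1 _; have -> : 1 + 1 = 2 :> R by [].
  have n1 : -1 < 1 :> R by lra.
  by move=> /(_ n1) h2; rewrite /ell /L; lra.
have comp : `|2 * L * lam r - 2 * ell * lam r| <= 2 * lam r.
  rewrite -mulrBl normrM (ger0_norm l0); apply: ler_wpM2r => //.
  by rewrite ler_norml; apply/andP; split; lra.
have bound M' : 1 <= M' -> `|2 * L * lam r - sig| <= (K1 * (1 + M') + 2) * lam r + K2 / M'.
  move=> M1'; rewrite -[X in `|X|](subrKA (2 * ell * lam r)).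
  by apply: le_trans (ler_normD _ _) _; have := mom r M' hr2 M1'; rewrite -/ell; lra.
have lamL : lam r * L <= sig + K2.
  have := bound 1 (lexx 1); rewrite divr1 ler_norml => /andP[_ h].
  have : (2 * K1 + 2) * lam r <= L * lam r by exact: ler_wpM2r.
  by lra.
have L0 : 0 < L by lra.
have lamle : (K1 * (1 + M) + 2) * lam r <= eta / 2.
  have c0 : 0 < K1 * (1 + M) + 2 by rewrite ltr_wpDl// mulr_ge0//; lra.
  rewrite -(ler_pM2r L0) -mulrA.
  apply: (@le_trans _ _ ((K1 * (1 + M) + 2) * (sig + K2))); first by rewrite ler_pM2l.
  move: L2; rewrite /T ler_pdivrMr//; lra.
have := bound M M1; rewrite distrC => h.
rewrite -(ler_pM2l (ltr0n R 2)) -[X in X * `|_|](@ger0_norm R 2)// -normrM.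
have -> : 2 * (sig / 2 - lam r * L) = sig - 2 * L * lam r by field.
by apply: le_trans h _; lra.
Unshelve. all: by end_near. Qed.

End small_rate.

Section lyapunov_asymptotics.
Context d (Omega : measurableType d) (R : realType) (P : probability Omega R).
Variables (o : int -> Omega -> R) (eps : R).
Hypothesis env : elliptic_iid P o eps.
Hypothesis centered : mean P (fun w => log_rho (o 0 w)) = 0.

Lemma lyapunov_asymptotics :
  lyapunov P o (expR (- r)) * - ln r @[r --> 0^'+] --> log_rho_variance P o / 2.
Proof.
have e0 := ellipticity_gt0 env.
have e2 : eps <= 2^-1 by have /andP[h1 h2] := elliptic_env env 0 point; lra.
have le0 : ln eps <= 0 by apply: ln_le0; lra.
have le2 : ln (eps / 2) <= 0 by apply: ln_le0; lra.
have c1 : 0 <= moment_const1 eps.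
  by have : 0 <= 2 / eps; [rewrite divr_ge0// ltW|rewrite /moment_const1; lra].
apply: (@cvg_of_moment _ _ _ (2 * moment_const1 eps) (moment_const2 eps)).
- by apply: Rintegral_ge0 => w _; exact: sqr_ge0.
- exact: mulr_ge0.
- by rewrite addr_ge0// divr_ge0// ltW.
- move=> r r0; have hz : 0 < expR (- r) < 1.
    by rewrite expR_gt0 expR_lt1 oppr_lt0.
  by have /andP[] := lyapunov_bound env hz.
move=> r M /andP[r0 r2] M1; apply: lyapunov_moment => //.
rewrite expR_lt1 oppr_lt0 r0 andbT.
by have h : 1 + - r <= expR (- r) by [exact: expR_ge1Dx]; lra.
Qed.

End lyapunov_asymptotics.

(** * Derivatives of power series *)

Section power_series_derivative.
Context (R : realType).
Implicit Types (c : nat -> R) (f : R -> R).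

Lemma exprB_ge (x y : R) n : 0 <= x -> x <= y ->
  n.+1%:R * x ^+ n * (y - x) <= y ^+ n.+1 - x ^+ n.+1.
Proof.
move=> x0 xy; elim: n => [|n IH]; first by rewrite !expr1 expr0 mulr1 mul1r.
have h : x * (n.+1%:R * x ^+ n * (y - x)) <= y * (y ^+ n.+1 - x ^+ n.+1).
  by apply: ler_pM => //; rewrite !mulr_ge0 ?exprn_ge0// subr_ge0.
rewrite [y ^+ _.+2]exprS [x ^+ _.+2]exprS.
have -> : y * y ^+ n.+1 - x * x ^+ n.+1 =
  y * (y ^+ n.+1 - x ^+ n.+1) + x ^+ n.+1 * (y - x) by ring.
apply: le_trans (lerD h (lexx _)).
by rewrite le_eqVlt; apply/orP; left; apply/eqP; rewrite exprS -[n.+2%:R]natr1; ring.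
Qed.

(** By the mean value theorem, termwise: [i * x ^ (i - 1) * (y - x)] is at most
    [y ^ i]. *)
Lemma psum_diffs_le c f x y K : power_sum c f -> 0 < x -> x < y -> y < 1 ->
  \sum_(i < K) pseries_diffs c i * x ^+ i <= f y / (y - x).
Proof.
move=> cf x0 xy y1; have [c0 _] := cf.
have hy : 0 < y < 1 by lra.
rewrite ler_pdivlMr ?subr_gt0//; apply: le_trans (power_sum_le K.+1 cf hy).
rewrite mulr_suml big_ord_recl/=.
apply: (@le_trans _ _ (\sum_(i < K) c (bump 0 i) * y ^+ bump 0 i)); last first.
  by rewrite lerDr mulr_ge0// exprn_ge0//; lra.
apply: ler_sum => i _; rewrite /bump/= add1n /pseries_diffs.
have h := exprB_ge i (ltW x0) (ltW xy).
apply: (@le_trans _ _ (c i.+1 * (y ^+ i.+1 - x ^+ i.+1))).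
  have -> : i.+1%:R * c i.+1 * x ^+ i * (y - x) = c i.+1 * (i.+1%:R * x ^+ i * (y - x)) by ring.
  exact: ler_wpM2l.
by apply: ler_wpM2l => //; rewrite gerBl exprn_ge0// ltW.
Qed.

Lemma power_sum_cvg c f x : power_sum c f -> 0 < x < 1 -> pseries c x @ \oo --> f x.
Proof.
move=> [_ cf] hx; have := cf x hx.
by rewrite (_ : pseries c x = fun K => \sum_(i < K) c i * x ^+ i)//; apply/funext => K; rewrite /pseries/series/= big_mkord.
Qed.

Definition power_sum_diff c (x : R) : R := limn (pseries (pseries_diffs c) x).

Lemma power_sum_diffP c f : power_sum c f ->
  power_sum (pseries_diffs c) (power_sum_diff c).
Proof.
move=> cf; have [c0 _] := cf.
have d0 k : 0 <= pseries_diffs c k by rewrite /pseries_diffs mulr_ge0.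
split => // x /andP[x0 x1].
have pE : pseries (pseries_diffs c) x = fun K => \sum_(i < K) pseries_diffs c i * x ^+ i.
  by apply/funext => K; rewrite /pseries/series/= big_mkord.
rewrite /power_sum_diff pE; apply: nondecreasing_is_cvgn.
  by move=> K L KL; apply: psum_nondecreasing => //; exact: ltW.
have [y [xy y1]] : exists y, x < y /\ y < 1 by exists ((x + 1) / 2); lra.
exists (f y / (y - x)) => _ [K _ <-].
exact: psum_diffs_le cf _ _ _.
Qed.

Lemma power_sum_diff_le c f x y : power_sum c f -> 0 < x -> x < y -> y < 1 ->
  power_sum_diff c x <= f y / (y - x).
Proof.
move=> cf x0 xy y1; have hx : 0 < x < 1 by lra.
have h := (power_sum_diffP cf).2 x hx.
rewrite -(cvg_lim _ h)//; apply: limr_le; first by apply/cvg_ex; eexists; exact: h.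
by apply: nearW => K; exact: psum_diffs_le cf _ _ _.
Qed.

Lemma is_derive_power_sum c f (x : R) : power_sum c f -> 0 < x < 1 ->
  is_derive x (1 : R) f (power_sum_diff c x).
Proof.
move=> cf hx; have /andP[x0 x1] := hx.
have cf1 := power_sum_diffP cf; have cf2 := power_sum_diffP cf1.
have [y [xy y1]] : exists y, x < y /\ y < 1 by exists ((x + 1) / 2); lra.
have hy : 0 < y < 1 by lra.
have cvgP c' f' : power_sum c' f' -> cvgn (pseries c' y).
  by move=> h; apply/cvg_ex; eexists; exact: power_sum_cvg h hy.
apply: (@near_eq_is_derive _ _ _ (fun t => limn (pseries c t))).
  near=> t; apply/cvg_lim => //; apply: power_sum_cvg cf _.
  apply/andP; split; near: t; [exact: lt_nbhsr|exact: lt_nbhsl].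
apply: (@pseries_snd_diffs R c y x) => //; try by apply: cvgP; eassumption.
by rewrite !gtr0_norm//; lra.
Unshelve. all: by end_near. Qed.

(** The derivative vanishes at one point only if all coefficients of positive
    index do. *)
Lemma power_sum_diff_gt0 c f x y : power_sum c f -> 0 < x < 1 -> 0 < y < 1 ->
  0 < power_sum_diff c x -> 0 < power_sum_diff c y.
Proof.
move=> cf hx hy; have cf1 := power_sum_diffP cf.
move=> gx; have [k ck] : exists k, 0 < pseries_diffs c k.
  apply: contrapT => nk; move: gx; rewrite ltNge => /negP; apply.
  have h := cf1.2 x hx; rewrite -(cvg_lim _ h)//; apply: limr_le.
    by apply/cvg_ex; eexists; exact: h.
  apply: nearW => K; rewrite big1// => i _.
  suff -> : pseries_diffs c i = 0 by rewrite mul0r.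
  apply/eqP; rewrite eq_le cf1.1 andbT leNgt; apply/negP => ci.
  by apply: nk; exists i.
apply: lt_le_trans (power_sum_le k.+1 cf1 hy).
have y0 : 0 < y by case/andP: hy.
rewrite big_ord_recr/= ltr_wpDl//; last by rewrite mulr_gt0// exprn_gt0.
by apply: sumr_ge0 => i _; rewrite mulr_ge0 ?cf1.1// exprn_ge0// ltW.
Qed.

End power_series_derivative.

(** * Slope and curvature of the growth function *)

Section growth_function.
Context (R : realType).
Variables (lam G : R -> R) (c : nat -> R) (C C0 kappa : R).
Hypothesis lamE : forall r : R, 0 < r -> lam r = r + C0 - G (expR (- r)).
Hypothesis cG : power_sum c G.
Hypothesis GC : forall z : R, 0 < z < 1 -> G z <= C.
Hypothesis kappa_gt0 : 0 < kappa.
Hypothesis asymptotics : lam r * - ln r @[r --> 0^'+] --> kappa.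

Let D1 := power_sum_diff c.
Let D2 := power_sum_diff (pseries_diffs c).
Let cD1 : power_sum (pseries_diffs c) D1. Proof. exact: power_sum_diffP cG. Qed.
Let cD2 : power_sum (pseries_diffs (pseries_diffs c)) D2.
Proof. exact: power_sum_diffP cD1. Qed.

(** The derivative of [lam] ([is_derive_growth]). *)
Definition growth_slope (r : R) := 1 + expR (- r) * D1 (expR (- r)).
(** Minus the second derivative of [lam] ([is_derive_slope]). *)
Definition growth_curvature (r : R) :=
  expR (- r) * D1 (expR (- r)) + expR (- r) ^+ 2 * D2 (expR (- r)).

Local Notation slope := growth_slope.
Local Notation curvature := growth_curvature.

Let expRN01 (r : R) : 0 < r -> 0 < expR (- r) < 1.
Proof. by move=> r0; rewrite expR_gt0 expR_lt1 oppr_lt0. Qed.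

Let is_derive_comp_expRN (g g' : R -> R) (r : R) : 0 < r ->
  (forall x : R, 0 < x < 1 -> is_derive x (1 : R) g (g' x)) ->
  is_derive r (1 : R) (g \o (expR \o -%R)) (- (g' (expR (- r)) * expR (- r))).
Proof.
move=> r0 dg; have dN : is_derive r (1 : R) (expR \o -%R) (- expR (- r)).
  by rewrite -mulrN1; apply: is_derive1_comp.
by rewrite -mulrN; apply: is_derive1_comp; exact: dg (expRN01 r0).
Qed.

Lemma is_derive_growth (r : R) : 0 < r -> is_derive r (1 : R) lam (slope r).
Proof.
move=> r0; have dG := is_derive_comp_expRN r0 (fun x => is_derive_power_sum cG).
apply: (@near_eq_is_derive _ _ _ (id + cst C0 - (G \o (expR \o -%R)))).
  near=> t; have t0 : 0 < t by near: t; exact: lt_nbhsr.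
  by rewrite lamE.
apply: (is_derive_eq (is_deriveB (is_deriveD (is_derive_id _ _) (is_derive_cst _ _ _)) dG)).
by rewrite /growth_slope addr0 opprK mulrC.
Unshelve. all: by end_near. Qed.

Lemma is_derive_slope (r : R) : 0 < r -> is_derive r (1 : R) slope (- curvature r).
Proof.
move=> r0; have dg (x : R) : 0 < x < 1 -> is_derive x (1 : R) (id * D1) (x * D2 x + D1 x).
  move=> hx; have d := is_deriveM (is_derive_id x (1 : R)) (is_derive_power_sum cD1 hx).
  by apply: (is_derive_eq d); rewrite /GRing.scale/= mulr1.
have d := is_derive_comp_expRN r0 dg.
have -> : slope = cst 1 + ((id * D1) \o (expR \o -%R)) by [].
apply: (is_derive_eq (is_deriveD (is_derive_cst _ _ _) d)).
by rewrite /growth_curvature add0r; ring.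
Qed.

Let D1_ge0 x : 0 < x < 1 -> 0 <= D1 x. Proof. exact: power_sum_ge0 cD1. Qed.
Let D2_ge0 x : 0 < x < 1 -> 0 <= D2 x. Proof. exact: power_sum_ge0 cD2. Qed.

Let C_ge0 : 0 <= C.
Proof.
have h : 0 < (2^-1 : R) < 1 by lra.
exact: le_trans (power_sum_ge0 cG h) (GC h).
Qed.

Lemma slope_ge1 r : 0 < r -> 1 <= slope r.
Proof.
by move=> /expRN01 h; rewrite /growth_slope lerDl mulr_ge0 ?D1_ge0 ?expR_ge0.
Qed.

Let D1_le x : 0 < x < 1 -> D1 x <= 2 * C / (1 - x).
Proof.
move=> hx; have /andP[x0 x1] := hx; pose y := (x + 1) / 2.
have xy : x < y by rewrite /y; lra.
have y1 : y < 1 by rewrite /y; lra.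
apply: le_trans (power_sum_diff_le cG x0 xy y1) _.
have n1 : 1 - x != 0 by rewrite gt_eqF// subr_gt0.
have -> : 2 * C / (1 - x) = C / (y - x).
  by have -> : y - x = (1 - x) / 2; [rewrite /y; field|field].
apply: ler_wpM2r; first by rewrite invr_ge0; lra.
by apply: GC; lra.
Qed.

Let D2_le x : 0 < x < 1 -> D2 x <= 8 * C / (1 - x) ^+ 2.
Proof.
move=> hx; have /andP[x0 x1] := hx; pose y := (x + 1) / 2.
have xy : x < y by rewrite /y; lra.
have y1 : y < 1 by rewrite /y; lra.
apply: le_trans (power_sum_diff_le cD1 x0 xy y1) _.
have -> : 8 * C / (1 - x) ^+ 2 = 2 * C / (1 - y) / (y - x).
  have n1 : 1 - x != 0 by rewrite gt_eqF// subr_gt0.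
  have -> : y - x = (1 - x) / 2 by rewrite /y; field.
  have -> : 1 - y = (1 - x) / 2 by rewrite /y; field.
  by field.
apply: ler_wpM2r; first by rewrite invr_ge0; lra.
by apply: D1_le; lra.
Qed.

(** Two derivatives of a bounded power series with nonnegative coefficients cost
    a factor [(1 - z) ^ -2], and [1 - exp (- r)] is of order [r]. *)
Lemma curvature_le r : 0 < r <= 1 -> curvature r <= 36 * C / r ^+ 2.
Proof.
move=> hr; have /andP[r0 r1] := hr; have hz := expRN01 r0.
have /andP[b1 b2] := one_sub_expRN_bound hr.
rewrite /growth_curvature; set z := expR (- r) in hz b1 b2 *; have /andP[z0 z1] := hz.
have b0 : 0 < 1 - z by lra.
have d1 : z * D1 z <= 4 * C / r ^+ 2.
  apply: (@le_trans _ _ (1 * (2 * C / (1 - z)))).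
    by apply: ler_pM; [exact: ltW|exact: D1_ge0|exact: ltW|exact: D1_le].
  rewrite mul1r (_ : 4 * C / r ^+ 2 = 2 * C * (r ^+ 2 / 2)^-1); last first.
    by field; rewrite gt_eqF.
  apply: ler_wpM2l; first exact: mulr_ge0.
  rewrite lef_pV2 ?posrE ?divr_gt0 ?exprn_gt0//.
  apply: le_trans b1; rewrite ler_pM2r ?invr_gt0// expr2.
  by rewrite ler_piMl// ltW.
have d2 : z ^+ 2 * D2 z <= 32 * C / r ^+ 2.
  apply: (@le_trans _ _ (1 * (8 * C / (1 - z) ^+ 2))).
    apply: ler_pM; [by rewrite exprn_ge0// ltW|exact: D2_ge0| |exact: D2_le].
    by rewrite exprn_ile1// ltW.
  rewrite mul1r (_ : 32 * C / r ^+ 2 = 8 * C * ((r / 2) ^+ 2)^-1); last first.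
    by field; rewrite gt_eqF.
  apply: ler_wpM2l; first exact: mulr_ge0.
  rewrite lef_pV2 ?posrE ?exprn_gt0 ?divr_gt0//.
  by apply: lerXn2r => //; rewrite nnegrE; lra.
lra.
Qed.

Lemma slope_nonincreasing r s : 0 < r -> r <= s -> slope s <= slope r.
Proof.
move=> r0 rs; have s0 : 0 < s by exact: lt_le_trans rs.
rewrite /growth_slope lerD2l; apply: ler_pM; [exact: expR_ge0|exact: D1_ge0 (expRN01 s0)| |].
  by rewrite ler_expR lerN2.
have hs := expRN01 s0; have hr := expRN01 r0.
rewrite -(cvg_lim _ (cD1.2 _ hs))// -(cvg_lim _ (cD1.2 _ hr))//; apply: ler_lim.
- by apply/cvg_ex; eexists; exact: cD1.2 hs.
- by apply/cvg_ex; eexists; exact: cD1.2 hr.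
apply: nearW => K; apply: ler_sum => i _; apply: ler_wpM2l; first exact: cD1.1.
by apply: lerXn2r; rewrite ?nnegrE ?expR_ge0// ler_expR lerN2.
Qed.

(** Since [lam r] is of order [kappa / - ln r], it varies on the scale of
    powers of [r]; by concavity its slope at [u ^+ 4] is bounded below by the
    increment between [u ^+ 4] and [u ^+ 3]. *)
Lemma slope_ge : \forall u \near 0^'+,
  kappa / 20 <= slope (u ^+ 4) * (u ^+ 3 * - ln u).
Proof.
have k20 : 0 < kappa / 20 by exact: divr_gt0.
have [rho /= rho0 hrho] : exists2 rho : R, 0 < rho & forall s, 0 < s < rho ->
    `|kappa - lam s * - ln s| <= kappa / 20.
  move/cvgrPdist_le : asymptotics => /(_ _ k20)[rho /= rho0 h].
  exists rho => // s /andP[s0 srho]; apply: h => //=.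
  by rewrite sub0r normrN gtr0_norm.
near=> u; have u0 : 0 < u by near: u; exact: nbhs_right_gt.
have urho : u < rho by near: u; exact: nbhs_right_lt.
have u1 : u < 1 by near: u; exact: nbhs_right_lt.
have L0 : 0 < - ln u by rewrite oppr_gt0 ln_lt0// u0.
have uX n : (0 < n)%N -> 0 < u ^+ n < rho.
  move=> n0; rewrite exprn_gt0//=; apply: le_lt_trans urho.
  by rewrite -[leRHS]expr1; apply: ler_wiXn2l => //; exact: ltW.
have := hrho _ (uX 3 isT); have := hrho _ (uX 4 isT).
have -> : ln (u ^+ 4) = 4 * ln u by rewrite lnXn// mulr_natl.
have -> : ln (u ^+ 3) = 3 * ln u by rewrite lnXn// mulr_natl.
rewrite !ler_norml => /andP[h4 _] /andP[_ h3].
have u43 : u ^+ 4 < u ^+ 3 by rewrite exprSr -[ltRHS]mulr1 ltr_pM2l ?exprn_gt0.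
have u40 : 0 < u ^+ 4 by exact: exprn_gt0.
have dlam t : t \in `]u ^+ 4, u ^+ 3[ -> is_derive t (1 : R) lam (slope t).
  by rewrite in_itv/= => /andP[h _]; apply: is_derive_growth; exact: lt_trans h.
have clam : {within `[u ^+ 4, u ^+ 3], continuous lam}.
  apply: derivable_within_continuous => t; rewrite in_itv/= => /andP[h _].
  by apply: ex_derive; apply: is_derive_growth; exact: lt_le_trans h.
have [xi] := MVT u43 dlam clam; rewrite in_itv/= => /andP[xi4 xi3] e.
have le1 : lam (u ^+ 3) - lam (u ^+ 4) <= slope (u ^+ 4) * u ^+ 3.
  rewrite e; have s1 := slope_ge1 (lt_trans u40 xi4).
  apply: ler_pM; [by lra|by rewrite subr_ge0 ltW|exact: slope_nonincreasing (ltW xi4)|].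
  by rewrite gerBl ltW.
(* With [L = - ln u]: the increment is near [kappa / (3 L) - kappa / (4 L)],
   and [kappa / 12] exceeds [kappa / 20] by more than the errors, which
   contribute at most [(1/3 + 1/4) * kappa / 20]. *)
rewrite mulrA; apply: (@le_trans _ _ ((lam (u ^+ 3) - lam (u ^+ 4)) * - ln u)); last first.
  by apply: ler_wpM2r => //; exact: ltW.
have kp : 0 < kappa := kappa_gt0.
lra.
Unshelve. all: by end_near. Qed.

End growth_function.

(** * Second derivative of the Legendre transform *)

Section right_neighbourhoods.
Context (R : realType).

Lemma near0_right_ex (A : R -> Prop) : (\forall x \near 0^'+, A x) ->
  exists2 rho : R, 0 < rho & forall x, 0 < x < rho -> A x.
Proof.
move=> [rho /= rho0 h]; exists rho => // x /andP[x0 xrho]; apply: h => //=.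
by rewrite sub0r normrN gtr0_norm.
Qed.

Lemma near0_right_of (A : R -> Prop) (rho : R) : 0 < rho ->
  (forall x, 0 < x < rho -> A x) -> \forall x \near 0^'+, A x.
Proof.
move=> rho0 h; near=> x; apply: h; apply/andP; split; near: x.
  exact: nbhs_right_gt.
exact: nbhs_right_lt.
Unshelve. all: by end_near. Qed.

Lemma expRN_cube_le (L : R) : 0 < L -> expR (- L) * L ^+ 3 <= 256 / L.
Proof.
move=> L0; rewrite expRN mulrC ler_pdivrMr ?expR_gt0// mulrAC ler_pdivlMr//.
have h : 1 + L / 4 <= expR (L / 4) by exact: expR_ge1Dx.
have -> : expR L = expR (L / 4) ^+ 4 by rewrite -expRM_natl; congr expR; field.
have h2 : (L / 4) ^+ 4 <= expR (L / 4) ^+ 4.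
  by apply: lerXn2r; rewrite ?nnegrE ?expR_ge0//; lra.
have -> : L ^+ 3 * L = 256 * (L / 4) ^+ 4 by field.
by rewrite ler_pM2l.
Qed.

End right_neighbourhoods.

Section legendre_transform.
Context (R : realType).
Variables (lam G : R -> R) (c : nat -> R) (C C0 kappa : R).
Hypothesis lamE : forall r : R, 0 < r -> lam r = r + C0 - G (expR (- r)).
Hypothesis cG : power_sum c G.
Hypothesis GC : forall z : R, 0 < z < 1 -> G z <= C.
Hypothesis kappa_gt0 : 0 < kappa.
Hypothesis asymptotics : lam r * - ln r @[r --> 0^'+] --> kappa.

Local Notation slope := (growth_slope c).
Local Notation curvature := (growth_curvature c).

Let C_ge0 : 0 <= C.
Proof.
have h : 0 < (2^-1 : R) < 1 by lra.
exact: le_trans (power_sum_ge0 cG h) (GC h).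
Qed.

Let slope_gt0 r : 0 < r -> 0 < slope r.
Proof. by move=> r0; apply: lt_le_trans (slope_ge1 cG r0). Qed.

(** By [slope_ge], since [u ^ 3 * - ln u] tends to [0]. *)
Lemma slope_large (T : R) : 0 < T -> exists2 r, 0 < r < 1 & T <= slope r.
Proof.
move=> T0; have kp := kappa_gt0.
suff /filter_ex[u [u0 u1 uT]] : \forall u \near 0^'+,
    [/\ 0 < u, u < 1 & T <= slope (u ^+ 4)].
  by exists (u ^+ 4) => //; rewrite exprn_gt0//= exprn_ilt1// ltW.
near=> u; have u0 : 0 < u by near: u; exact: nbhs_right_gt.
have u1 : u < 1 by near: u; exact: nbhs_right_lt.
split => //.
have sge : kappa / 20 <= slope (u ^+ 4) * (u ^+ 3 * - ln u).
  by near: u; exact: slope_ge lamE cG kappa_gt0 asymptotics.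
have LT : 80 * T / kappa <= - ln u by near: u; exact: near_ln_ge.
have L0 : 0 < - ln u by rewrite oppr_gt0 ln_lt0// u0.
have s0 : 0 < slope (u ^+ 4) by apply: slope_gt0; exact: exprn_gt0.
have uL : u ^+ 3 * - ln u <= 4 / - ln u.
  apply: le_trans (mulr_exp_le L0); rewrite opprK lnK ?posrE// mulrC.
  apply: ler_wpM2l; first exact: ltW.
  by rewrite -[leRHS]expr1; apply: ler_wiXn2l => //; exact: ltW.
have uT : 4 / - ln u <= kappa / 20 / T.
  rewrite ler_pdivrMr// mulrC mulrA ler_pdivlMr//.
  by move: LT; rewrite ler_pdivrMr//; lra.
have : kappa / 20 <= slope (u ^+ 4) * (kappa / 20 / T).
  by apply: le_trans sge _; rewrite ler_pM2l//; exact: le_trans uT.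
rewrite mulrA ler_pdivlMr// mulrC ler_pM2r//; exact: divr_gt0.
Unshelve. all: by end_near. Qed.

(** Otherwise the power series would be constant and the slope equal to
    [1]. *)
Lemma curvature_gt0 r : 0 < r -> 0 < curvature r.
Proof.
move=> r0; have cG1 := power_sum_diffP cG; have cG2 := power_sum_diffP cG1.
have expRN01 (t : R) : 0 < t -> 0 < expR (- t) < 1.
  by move=> t0; rewrite expR_gt0 expR_lt1 oppr_lt0.
have [s /andP[s0 _] s2] := slope_large (ltr0n R 2).
have d : 0 < power_sum_diff c (expR (- s)).
  have d0 := power_sum_ge0 cG1 (expRN01 s s0).
  rewrite lt0r d0 andbT; apply: contraTneq s2.
  by rewrite /growth_slope => ->; rewrite mulr0 addr0 -ltNge ltr1n.
have := power_sum_diff_gt0 cG (expRN01 s s0) (expRN01 r r0) d.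
move=> h; rewrite /growth_curvature ltr_wpDr//; last by rewrite mulr_gt0// expR_gt0.
by rewrite mulr_ge0 ?exprn_ge0 ?expR_ge0// (power_sum_ge0 cG2)// expRN01.
Qed.

Lemma slope_decreasing r s : 0 < r -> r < s -> slope s < slope r.
Proof.
move=> r0 rs.
have ds t : t \in `]r, s[ -> is_derive t (1 : R) slope (- curvature t).
  by rewrite in_itv/= => /andP[h _]; apply: (is_derive_slope cG); exact: lt_trans h.
have cs : {within `[r, s], continuous slope}.
  apply: derivable_within_continuous => t; rewrite in_itv/= => /andP[h _].
  by apply: ex_derive; apply: (is_derive_slope cG); exact: lt_le_trans h.
have [x] := MVT rs ds cs; rewrite in_itv/= => /andP[rx _] e.
rewrite -subr_lt0 e mulNr oppr_lt0 mulr_gt0 ?subr_gt0//.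
by apply: curvature_gt0; exact: lt_trans rx.
Qed.

(** With [r = u ^ 4], the slope is at least of order
    [u ^ -3 / - ln u] and the curvature at most of order [u ^ -8]; so the ratio
    is at least of order [u ^ -1 / (- ln u) ^ 3]. *)
Lemma curvature_ratio_large (T : R) :
  \forall r \near 0^'+, T <= slope r ^+ 3 / curvature r.
Proof.
wlog T0 : T / 0 < T => [H|].
  have := H (Num.max T 1); rewrite lt_max ltr01 orbT => /(_ isT).
  by apply: filterS => r; rewrite ge_max => /andP[].
have kp := kappa_gt0; have Cge := C_ge0.
pose B := T * (36 * C) * 256 / (kappa / 20) ^+ 3.
have [rho rho0 hrho] : exists2 rho : R, 0 < rho & forall u, 0 < u < rho ->
    [/\ u < 1, kappa / 20 <= slope (u ^+ 4) * (u ^+ 3 * - ln u) & B <= - ln u].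
  apply: near0_right_ex; near=> u; split; near: u.
  - exact: nbhs_right_lt.
  - exact: slope_ge lamE cG kappa_gt0 asymptotics.
  - exact: near_ln_ge.
apply: (@near0_right_of _ _ (rho ^+ 4)); first exact: exprn_gt0.
move=> r /andP[r0 rrho].
pose u := Num.sqrt (Num.sqrt r).
have u0 : 0 < u by rewrite !sqrtr_gt0.
have u4 : u ^+ 4 = r.
  by rewrite (exprM u 2 2) sqr_sqrtr ?sqrtr_ge0// sqr_sqrtr// ltW.
have urho : u < rho.
  rewrite ltNge; apply: contraL rrho => h; rewrite -leNgt -u4.
  by apply: lerXn2r => //; rewrite nnegrE ltW.
have hu : 0 < u < rho by rewrite u0.
have [u1 sge LB] := hrho u hu; rewrite u4 in sge.
have L0 : 0 < - ln u by rewrite oppr_gt0 ln_lt0// u0.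
have r1 : r <= 1 by rewrite -u4 exprn_ile1// ltW.
have cv0 := curvature_gt0 r0.
have hr1 : 0 < r <= 1 by rewrite r0.
have cv := curvature_le cG GC hr1.
rewrite ler_pdivlMr//.
apply: (@le_trans _ _ (T * (36 * C / r ^+ 2))); first by rewrite ler_pM2l.
set L := - ln u in LB sge L0; set s := slope r in sge *.
have q0 : 0 < u ^+ 9 * L ^+ 3 by rewrite mulr_gt0 ?exprn_gt0.
rewrite -(ler_pM2r q0).
have -> : T * (36 * C / r ^+ 2) * (u ^+ 9 * L ^+ 3) = T * (36 * C) * (u * L ^+ 3).
  by rewrite -u4; field; rewrite gt_eqF.
have uE : u = expR (- L) by rewrite opprK lnK.
have uL3 : u * L ^+ 3 <= 256 / L by rewrite {1}uE; exact: expRN_cube_le.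
apply: (@le_trans _ _ (T * (36 * C) * (256 / L))).
  by apply: ler_wpM2l => //; rewrite !mulr_ge0// ltW.
apply: (@le_trans _ _ ((kappa / 20) ^+ 3)).
  have k3 : 0 < (kappa / 20) ^+ 3 by rewrite exprn_gt0// divr_gt0.
  by rewrite [leLHS]mulrA ler_pdivrMr// [leRHS]mulrC -ler_pdivrMr.
have -> : s ^+ 3 * (u ^+ 9 * L ^+ 3) = (s * (u ^+ 3 * L)) ^+ 3 by ring.
apply: lerXn2r => //; rewrite nnegrE; first by rewrite divr_ge0// ltW.
by apply: le_trans sge; rewrite divr_ge0// ltW.
Unshelve. all: by end_near. Qed.

(** The rate [r] at which the tilted walk has velocity [theta]: the inverse
    function of [1 / slope], with a dummy value off its range. *)
Definition rate_of (theta : R) : R := xget 1 [set r | 0 < r /\ slope r = theta^-1].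

Lemma rate_ofK r : 0 < r -> rate_of (slope r)^-1 = r.
Proof.
move=> r0; rewrite /rate_of; case: xgetP => [y _ [y0]|/(_ r)]; last first.
  by rewrite /= invrK => /(_ (conj r0 erefl)).
rewrite invrK => e; apply/eqP; rewrite eq_le !leNgt; apply/andP; split; apply/negP => h.
  by have := slope_decreasing r0 h; rewrite e ltxx.
by have := slope_decreasing y0 h; rewrite e ltxx.
Qed.

Lemma rate_ofP theta : 0 < theta < (slope 1)^-1 ->
  0 < rate_of theta /\ slope (rate_of theta) = theta^-1.
Proof.
move=> /andP[t0 t1]; have ti0 : 0 < theta^-1 by rewrite invr_gt0.
have [s /andP[s0 s1] sT] := slope_large ti0.
have cs : {within `[s, 1], continuous slope}.
  apply: derivable_within_continuous => t; rewrite in_itv/= => /andP[h _].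
  by apply: ex_derive; apply: (is_derive_slope cG); exact: lt_le_trans h.
have sl1 : slope 1 <= theta^-1.
  by rewrite -[leLHS]invrK lef_pV2 ?posrE ?invr_gt0 ?slope_gt0// ltW.
have [|r] := IVT (ltW s1) cs (v := theta^-1).
  have h : slope 1 <= slope s by exact: le_trans sl1 sT.
  by rewrite (min_idPr h) (max_idPl h) sl1.
rewrite in_itv/= => /andP[sr _] e.
have := @rate_ofK r (lt_le_trans s0 sr); rewrite e invrK => ->; split => //.
exact: lt_le_trans sr.
Qed.

Lemma is_derive_rate_of theta : 0 < theta < (slope 1)^-1 ->
  is_derive theta (1 : R) rate_of
    (slope (rate_of theta) ^+ 2 / curvature (rate_of theta)).
Proof.
move=> ht; have [r0 e] := rate_ofP ht; set r := rate_of theta in r0 e *.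
have s0 := slope_gt0 r0; have c0 := curvature_gt0 r0.
have d : is_derive r (1 : R) (fun t => (slope t)^-1) (slope r ^- 2 * curvature r).
  have := is_deriveV (lt0r_neq0 s0) (is_derive_slope cG r0).
  by move/is_derive_eq; apply; rewrite /GRing.scale/= mulrNN.
have := @is_derive_inverse R (fun t => (slope t)^-1) rate_of _ r _ _ d.
rewrite e invrK => /(_ _ _ _)/is_derive_eq; apply.
- near=> t; apply: rate_ofK; near: t; exact: lt_nbhsr.
- near=> t; have t0 : 0 < t by near: t; exact: lt_nbhsr.
  apply/differentiable_continuous/derivable1_diffP/derivableV.
    by rewrite gt_eqF// slope_gt0.
  by apply: ex_derive; exact: (is_derive_slope cG t0).
- by rewrite gt_eqF// mulr_gt0// invr_gt0 exprn_gt0// -?e.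
- by rewrite ?e invfM invrK.
Unshelve. all: by end_near. Qed.

Variable I : R -> \bar R.
Hypothesis IE : forall r l : R, 0 < r -> is_derive r (1 : R) lam l -> 0 < l ->
  I l^-1 = (l^-1 * lam r - r)%:E.

Let J x := fine (I x).

Let I_rate_of theta : 0 < theta < (slope 1)^-1 ->
  I theta = (theta * lam (rate_of theta) - rate_of theta)%:E.
Proof.
move=> ht; have [r0 e] := rate_ofP ht.
have := IE r0 (is_derive_growth lamE cG r0) (slope_gt0 r0).
by rewrite e invrK.
Qed.

Let theta_bound : 0 < (slope 1)^-1.
Proof. by rewrite invr_gt0 slope_gt0. Qed.

Let near_in theta : 0 < theta < (slope 1)^-1 ->
  \forall t \near theta, 0 < t < (slope 1)^-1.
Proof.
move=> /andP[t0 t1]; near=> t; apply/andP; split; near: t.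
  exact: lt_nbhsr.
exact: lt_nbhsl.
Unshelve. all: by end_near. Qed.

(** The rate [rate_of theta] is critical for [r -> theta * lam r - r], so only the
    explicit dependence on [theta] contributes to the derivative. *)
Let is_derive_J theta : 0 < theta < (slope 1)^-1 ->
  is_derive theta (1 : R) J (lam (rate_of theta)).
Proof.
move=> ht; have [r0 e] := rate_ofP ht.
have dr := is_derive_rate_of ht.
have dl := is_derive1_comp (is_derive_growth lamE cG r0) dr.
apply: (@near_eq_is_derive _ _ _ (id * (lam \o rate_of) - rate_of)).
  have := near_in ht; apply: filterS => t tin.
  by rewrite /J I_rate_of.
apply: (is_derive_eq (is_deriveB (is_deriveM (is_derive_id _ _) dl) dr)).
rewrite /GRing.scale/= mulr1.
have t0 : theta != 0 by rewrite gt_eqF//; case/andP: ht.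
rewrite [theta * _]mulrA (_ : theta * slope (rate_of theta) = 1); last by rewrite e mulfV.
by rewrite mul1r; ring.
Qed.

Let derive_J theta : 0 < theta < (slope 1)^-1 ->
  (J^`())%classic theta = lam (rate_of theta).
Proof. by move=> ht; have d := is_derive_J ht; rewrite derive1E derive_val. Qed.

Let is_derive_derive_J theta : 0 < theta < (slope 1)^-1 ->
  is_derive theta (1 : R) (J^`())%classic
    (slope (rate_of theta) ^+ 3 / curvature (rate_of theta)).
Proof.
move=> ht; have [r0 e] := rate_ofP ht.
have dl := is_derive1_comp (is_derive_growth lamE cG r0) (is_derive_rate_of ht).
apply: (@near_eq_is_derive _ _ _ (lam \o rate_of)).
  by have := near_in ht; apply: filterS => t tin; rewrite derive_J.
by apply: (is_derive_eq dl); rewrite mulrA -exprS.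
Qed.

Theorem legendre_second_derivative :
  (\forall theta \near 0^'+,
     [/\ I theta \is a fin_num, derivable J theta 1
       & derivable (J^`())%classic theta 1]) /\
  (J^`(2))%classic theta @[theta --> 0^'+] --> +oo.
Proof.
split.
  apply: (near0_right_of theta_bound) => t ht; split.
  - by rewrite I_rate_of.
  - by apply: ex_derive; exact: is_derive_J.
  - by apply: ex_derive; exact: is_derive_derive_J.
apply/cvgryPge => T.
have [rho rho0 hrho] := near0_right_ex (curvature_ratio_large T).
have b0 : 0 < Num.min (slope 1)^-1 (slope (rho / 2))^-1.
  by rewrite lt_min !invr_gt0 !slope_gt0 ?divr_gt0.
apply: (near0_right_of b0) => t; rewrite lt_min => /and3P[t0 t1 t2].
have ht : 0 < t < (slope 1)^-1 by rewrite t0.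
have [r0 e] := rate_ofP ht; have d := is_derive_derive_J ht.
rewrite derive1nS derive1n1 derive1E derive_val.
apply: hrho; rewrite r0/=; apply: (@le_lt_trans _ _ (rho / 2)); last by lra.
rewrite leNgt; apply/negP => h.
have := slope_decreasing (divr_gt0 rho0 (ltr0n R 2)) h; rewrite e.
by rewrite ltNge -[leLHS]invrK lef_pV2 ?posrE ?invr_gt0 ?slope_gt0 ?divr_gt0// ltW.
Qed.

End legendre_transform.

(** * Identification of the rate function *)

Lemma ae_exists d (Omega : measurableType d) (R : realType)
    (P : probability Omega R) (A : Omega -> Prop) :
  {ae P, forall w, A w} -> exists w, A w.
Proof.
move=> hA; apply: contrapT => nA.
have PT : (0 < P setT)%E by rewrite (_ : P setT = 1%E) ?lte01//; exact: probability_setT.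
have pf := ae_properfilter_algebraOfSetsType PT.
by have /filter_ex[w Aw] := hA; apply: nA; exists w.
Qed.

Lemma ae_forall_int d (Omega : measurableType d) (R : realType)
    (P : probability Omega R) (A : int -> Omega -> Prop) :
  (forall i, {ae P, forall w, A i w}) -> {ae P, forall w, forall i, A i w}.
Proof.
move=> hA; have : {ae P, forall w n, if choice.unpickle n is Some i then A i w else True}.
  apply: ae_foralln => n; case: (choice.unpickle n) => [i|]; first exact: hA.
  exact: aeW.
by apply: filterS => w h i; have := h (choice.pickle i); rewrite choice.pickleK.
Qed.

Lemma is_derive_enclosure (R : realType) (f : R -> R) (x l a b : R) :
  is_derive x (1 : R) f l -> a < l < b ->
  exists2 e : R, 0 < e & forall h, 0 < h < e ->
    a * h < f (x + h) - f x /\ f x - f (x - h) < b * h.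
Proof.
move=> /is_derive1_caratheodory[g [fE gc gx]] /andP[al lb].
have : \forall z \near x, a < g z < b.
  have gl : g z @[z --> x] --> l by rewrite -gx; exact: gc.
  have h1 : \forall z \near x, a < g z by exact: (cvgr_gt l gl).
  have h2 : \forall z \near x, g z < b by exact: (cvgr_lt l gl).
  by apply: filterS2 h1 h2 => z -> ->.
move=> [e /= e0 he]; exists e => // h /andP[h0 h1]; split.
  have /he/andP[ag _] : ball x e (x + h).
    by rewrite /ball/= opprD addrA subrr sub0r normrN gtr0_norm.
  by rewrite fE addrAC subrr add0r ltr_pM2r.
have /he/andP[_ gb] : ball x e (x - h).
  by rewrite /ball/= opprB addrC subrK gtr0_norm.
rewrite -opprB fE addrAC subrr add0r mulrN opprK; first by rewrite ltr_pM2r.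
Qed.

Lemma line_lt (R : realFieldType) (theta delta l r a : R) : 0 < delta -> 0 <= l ->
  delta * (2 * (l + 1)) <= a - (theta * l - r) -> (theta + delta) * l - r < a.
Proof. by move=> d0 l0 h; have : 0 <= delta * l by [rewrite mulr_ge0// ltW]; lra. Qed.

Lemma near_center (R : realFieldType) (theta delta e x : R) : 0 < e ->
  delta <= e / 2 -> theta - delta <= x <= theta + delta -> `|theta - x| < e.
Proof. by move=> e0 de /andP[x1 x2]; rewrite ltr_norml; apply/andP; split; lra. Qed.

Section identification.
Context d (Omega : measurableType d) (R : realType) (P : probability Omega R).
Variables (o : int -> Omega -> R) (eps : R).
Hypothesis env : elliptic_iid P o eps.
Context d' (T : measurableType d') (Q : (int -> R) -> probability T R).
Variables (S : nat -> T -> int) (I : R -> \bar R).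
Hypothesis Q_quenched : quenched_laws Q S.
Hypothesis I_ge0 : forall x, (0 <= I x)%E.
Hypothesis I_lsc : lower_semicontinuous I.
Hypothesis ldp_ae : {ae P, forall w, satisfies_ldp (Q (fun i => o i w)) S I}.

Let lam (r : R) := lyapunov P o (expR (- r)).
Let N k := (4 ^ k)%N.

Let ltN k : (k < N k)%N. Proof. exact: ltn_expl. Qed.

Let growth_ae (r c : R) : 0 < r -> 0 <= c ->
  {ae P, forall w, growth_along (fun i => o i w) N r c (lam r)}.
Proof.
move=> r0 c0; apply: (cost_ae env (B := (Num.truncn c).+1)
    (m := fun n => Num.truncn (c * n%:R))).
  by rewrite expR_gt0 expR_lt1 oppr_lt0.
move=> n; rewrite -(ler_nat R); have cn0 : 0 <= c * n%:R by rewrite mulr_ge0.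
have /andP[h _] := truncn_itv cn0; apply: le_trans h _.
have /andP[_ h] := truncn_itv c0.
by rewrite natrM; apply: ler_wpM2r => //; exact: ltW.
Qed.

Let he w i : 0 < o i w < 1. Proof. exact: env_bound env _ _. Qed.

Let rwre w : is_rwre (fun i => o i w) (Q (fun i => o i w)) S.
Proof. by apply: Q_quenched => i; have /andP[? ?] := he w i; rewrite !ltW. Qed.

Let lam_ge0 r : 0 < r -> 0 <= lam r.
Proof.
move=> r0; have hz : 0 < expR (- r) < 1 by rewrite expR_gt0 expR_lt1 oppr_lt0.
by have /andP[] := lyapunov_bound env hz.
Qed.

(** [quenched_rate_ge] needs a velocity smaller than [theta]; letting it increase
    to [theta] gives the bound. *)
Lemma rate_ge (r theta : R) : 0 < r -> 0 < theta ->
  ((theta * lam r - r)%:E <= I theta)%E.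
Proof.
move=> r0 t0.
have below c : 0 <= c < theta -> ((c * lam r - r)%:E <= I theta)%E.
  move=> hc; have /andP[c0 ct] := hc.
  have /ae_exists[w [ldpw gw]] :
      {ae P, forall w, satisfies_ldp (Q (fun i => o i w)) S I /\
        growth_along (fun i => o i w) N r c (lam r)}.
    by apply: filterS2 ldp_ae (growth_ae r0 c0) => w.
  have := quenched_rate_ge (rwre w) (he w) ldpw ltN r0 hc gw.
  by rewrite leeNl -EFinN opprB.
rewrite leNgt; apply/negP => It.
have Ifin : I theta \is a fin_num.
  by rewrite ge0_fin_numE//; apply: lt_trans It (ltry _).
move: It below; rewrite -(fineK Ifin) lte_fin; set x := fine (I theta) => It below.
have l0 := lam_ge0 r0.
pose g := theta * lam r - r - x.
have g0 : 0 < g by rewrite subr_gt0.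
pose delta := Num.min (theta / 2) (g / (2 * (lam r + 1))).
have d2 : 0 < 2 * (lam r + 1) by rewrite mulr_gt0//; lra.
have d0 : 0 < delta by rewrite lt_min !divr_gt0.
have dt : delta <= theta / 2 by rewrite ge_min lexx.
have dg : delta * (2 * (lam r + 1)) <= g.
  by rewrite -ler_pdivlMr// ge_min lexx orbT.
have hc : 0 <= theta - delta < theta by apply/andP; split; lra.
have := below _ hc; rewrite lee_fin.
have : 0 <= delta * lam r by rewrite mulr_ge0// ltW.
by rewrite /g in dg; lra.
Qed.

(** By lower semicontinuity it suffices to bound [I] somewhere in every small
    interval around [l^-1]. There [quenched_rate_le] applies, with rates
    [r - k] and [r + k] so close to [r] that the difference quotients of [lam]
    enclose [l] between the inverses of the endpoints. *)
Lemma rate_le (r l : R) : 0 < r -> is_derive r (1 : R) lam l -> 0 < l ->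
  (I l^-1 <= (l^-1 * lam r - r)%:E)%E.
Proof.
move=> r0 dl l0; set theta := l^-1; have t0 : 0 < theta by rewrite invr_gt0.
set v := theta * lam r - r; rewrite leNgt; apply/negP => vI.
have [a va aI] : exists2 a : R, v < a & (a%:E < I theta)%E.
  case: (I theta) vI => [x|_|//]; last by exists (v + 1); [lra|rewrite ltry].
  by rewrite lte_fin => vx; exists ((v + x) / 2); [lra|rewrite lte_fin; lra].
have [V [e0 /= e00 Ve] aV] := I_lsc aI.
have ll0 := lam_ge0 r0.
pose delta := Num.min (Num.min (theta / 2) (e0 / 2)) ((a - v) / (2 * (lam r + 1))).
have d2 : 0 < 2 * (lam r + 1) by rewrite mulr_gt0//; lra.
have d0 : 0 < delta by rewrite !lt_min !divr_gt0//; lra.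
have dt : delta <= theta / 2 by rewrite /delta !ge_min lexx.
have de : delta <= e0 / 2 by rewrite /delta !ge_min lexx orbT.
have da : delta * (2 * (lam r + 1)) <= a - v.
  by rewrite -ler_pdivlMr// ge_min lexx orbT.
pose c1 := theta - delta; pose c2 := theta + delta.
have c10 : 0 < c1 by rewrite /c1; lra.
have c20 : 0 < c2 by rewrite /c2; lra.
have encl : c2^-1 < l < c1^-1.
  rewrite -[l]invrK -/theta !ltf_pV2 ?posrE//.
  by rewrite /c1 /c2; apply/andP; split; lra.
have [h h0 hh] := is_derive_enclosure dl encl.
pose k := Num.min (h / 2) (r / 2).
have k0 : 0 < k by rewrite lt_min !divr_gt0.
have kh : k <= h / 2 by rewrite /k ge_min lexx.
have kr : k <= r / 2 by rewrite /k ge_min lexx orbT.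
have [up lo] : c2^-1 * k < lam (r + k) - lam r /\ lam r - lam (r - k) < c1^-1 * k.
  by apply: hh; rewrite k0/=; lra.
have r10 : 0 < r - k.
  have : k < r by apply: le_lt_trans kr _; rewrite ltr_pdivrMr// mulr2n mulrDr mulr1 ltrDl.
  by rewrite subr_gt0.
have r20 : 0 < r + k by rewrite addr_gt0.
have hae :
    {ae P, forall w, satisfies_ldp (Q (fun i => o i w)) S I /\
      (growth_along (fun i => o i w) N r c1 (lam r) /\
      (growth_along (fun i => o i w) N (r - k) c1 (lam (r - k)) /\
      (growth_along (fun i => o i w) N r c2 (lam r) /\
       growth_along (fun i => o i w) N (r + k) c2 (lam (r + k)))))}.
  apply: (filterI ldp_ae); apply: (filterI (growth_ae r0 (ltW c10))).
  apply: (filterI (growth_ae r10 (ltW c10))).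
  exact: (filterI (growth_ae r0 (ltW c20)) (growth_ae r20 (ltW c20))).
have [w [ldpw [g1 [g2 [g3 g4]]]]] := ae_exists hae.
have := @quenched_rate_le _ _ _ _ _ _ _ (rwre w) (he w) ldpw _ ltN r (r - k) (r + k)
  c1 c2 (lam r) (lam (r - k)) (lam (r + k)) r10.
move=> /(_ _ _ (ltW c10) (ltW c20) g1 g2 g3 g4) H.
have : (ereal_inf (I @` `[c1, c2]) <= (c2 * lam r - r)%:E)%E.
  apply: H; [by rewrite gerBl ltW|by rewrite lerDl ltW| |].
  - by rewrite [r - k - r]addrAC subrr sub0r addrC subr_lt0 mulrC -ltr_pdivlMr// mulrC.
  - rewrite -[lam r - _]opprB mulrN [r + k - r]addrC addKr subr_lt0.
    by rewrite -ltr_pdivrMl.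
apply/negP; rewrite -ltNge.
apply: (@lt_le_trans _ _ a%:E).
  by rewrite lte_fin; exact: (line_lt d0 ll0 da).
apply: le_ereal_inf_tmp => _ [x /= xin <-]; apply: ltW; apply: aV; apply: Ve.
by move: xin; rewrite in_itv/=; exact: (near_center e00 de).
Qed.

Lemma rateE (r l : R) : 0 < r -> is_derive r (1 : R) lam l -> 0 < l ->
  I l^-1 = (l^-1 * lam r - r)%:E.
Proof.
move=> r0 dl l0; apply/eqP; rewrite eq_le rate_le//=.
by apply: rate_ge => //; rewrite invr_gt0.
Qed.

End identification.

(** * Clipping the environment *)

Section clipped_environment.
Context (R : realType) (eta : probability R R).
Context d (Omega : measurableType d) (P : probability Omega R).
Variable omega : int -> {RV P >-> R}.
Hypothesis omega_iid : iid_with_law omega eta.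
Variable eps : R.
Hypothesis eps_gt0 : 0 < eps.
Hypothesis elliptic : eta `[eps, 1 - eps]%classic = 1%E.

Let clip (x : R) := Num.max eps (Num.min x (1 - eps)).

Let measurable_clip : measurable_fun setT clip.
Proof. by apply: measurable_maxr => //; exact: measurable_minr. Qed.

Let clip_id x : `[eps, 1 - eps]%classic x -> clip x = x.
Proof.
by rewrite /= in_itv/= => /andP[x1 x2]; rewrite /clip (min_idPl x2) (max_idPr x1).
Qed.

Let eps_le : eps <= 1 - eps.
Proof.
rewrite leNgt; apply/negP => e.
suff h : `[eps, 1 - eps]%classic = set0 :> set R.
  by move: elliptic; rewrite h measure0 => -[] /eqP; rewrite eq_sym oner_eq0.
by apply/seteqP; split => x //=; rewrite in_itv/= => /andP[h1 h2]; lra.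
Qed.

Let null : eta (~` `[eps, 1 - eps]%classic) = 0%E.
Proof. by rewrite probability_setC// elliptic subee. Qed.

Let ae_eta_elliptic : {ae eta, forall x, clip x = x}.
Proof.
exists (~` `[eps, 1 - eps]%classic); split => //; first exact: measurableC.
by move=> x /= nx hx; apply: nx; exact: clip_id.
Qed.

(** The environment, changed on a null set so that ellipticity holds for every
    outcome. *)
Definition clipped i w := clip (omega i w).

Lemma clippedE : {ae P, forall w, (fun i => omega i w) = (fun i => clipped i w)}.
Proof.
have /ae_forall_int : forall i, {ae P, forall w, omega i w = clipped i w}.
  move=> i; exists (omega i @^-1` (~` `[eps, 1 - eps]%classic)); split.
  - rewrite -[X in measurable X]setTI; apply: (measurable_funPT (omega i)) => //.
    exact: measurableC.
  - by have := omega_iid.2 i _ (measurableC (measurable_itv `[eps, 1 - eps])); rewrite null.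
  - by move=> w /= nw hw; apply: nw; rewrite /clipped clip_id.
by apply: filterS => w hw; apply/funext => i.
Qed.

Lemma elliptic_clipped : elliptic_iid P clipped eps.
Proof.
have mpre B : measurable B -> measurable (clip @^-1` B).
  by move=> mB; rewrite -[X in measurable X]setTI; exact: measurable_clip.
split=> //.
- move=> i; apply: (measurableT_comp measurable_clip); exact: measurable_funPT.
- by move=> J D mD; apply: (omega_iid.1 J (fun k => clip @^-1` D k)) => k _; exact: mpre.
- move=> k B mB; have hk j := omega_iid.2 j _ (mpre B mB).
  by transitivity (eta (clip @^-1` B)); [|symmetry]; exact: hk.
- by move=> i w; rewrite /clipped /clip le_max lexx/= ge_max eps_le ge_min lexx orbT.
Qed.

Lemma mean_clipped (f : R -> R) : measurable_fun setT f ->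
  bounded_rv (fun w => f (clipped 0 w)) ->
  (mean P (fun w => f (clipped 0 w)))%:E = (\int[eta]_x (f x)%:E)%E.
Proof.
move=> mf bf; rewrite EFin_mean//.
have mfc : measurable_fun setT (EFin \o (f \o clip)).
  by apply: measurableT_comp => //; exact: measurableT_comp.
transitivity (\int[distribution P (omega 0)]_x (f (clip x))%:E)%E.
  by rewrite integral_distribution//; exact: bounded_rv_integrable bf.
transitivity (\int[eta]_x (f (clip x))%:E)%E.
  by apply: eq_measure_integral => A mA _; exact: omega_iid.2.
apply: ae_eq_integral => //; first exact: measurableT_comp.
by apply: filterS ae_eta_elliptic => x hx _; rewrite hx.
Qed.

Hypothesis recurrent : (\int[eta]_w (log_rho w)%:E)%E = 0%E.

Let measurable_o := measurable_env elliptic_clipped.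

Lemma mean_log_rho_clipped : mean P (fun w => log_rho (clipped 0 w)) = 0.
Proof.
apply: EFin_inj; rewrite mean_clipped//; first exact: measurable_log_rho.
split; first exact: measurableT_comp (@measurable_log_rho R) (measurable_o 0).
by exists (- ln eps) => w; exact: norm_log_rho_le elliptic_clipped _ _.
Qed.

Lemma log_rho_variance_clipped :
  (log_rho_variance P clipped)%:E = 'V_eta[@log_rho R].
Proof.
rewrite /variance covariance.unlock !expectation.unlock recurrent/=.
rewrite /log_rho_variance (@mean_clipped (fun x => log_rho x ^+ 2)).
- apply: eq_integral => x _ /=; congr EFin.
  by transitivity ((log_rho x - 0) * (log_rho x - 0)); first by rewrite subr0.
- by apply: measurable_funX; exact: measurable_log_rho.
split.
  apply: measurable_funX.
  exact: measurableT_comp (@measurable_log_rho R) (measurable_o 0).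
exists (ln eps ^+ 2) => w; rewrite normrX -[X in _ <= X]sqrrN.
by apply: lerXn2r; rewrite ?nnegrE//; [apply: le_trans (norm_log_rho_le elliptic_clipped 0 w)|exact: norm_log_rho_le elliptic_clipped _ _].
Qed.

End clipped_environment.

Unset Implicit Arguments.
Set Strict Implicit.
Set Printing Implicit Defensive.

Theorem theorem1p1 (R : realType)
  (eta : probability R R)
  (d : measure_display) (Omega : measurableType d) (P : probability Omega R)
  (omega : int -> {RV P >-> R})
  (omega_iid : iid_with_law omega eta)
  (eps0 : R) (eps0_gt0 : 0 < eps0)
  (elliptic : eta `[eps0, 1 - eps0]%classic = 1%E)
  (recurrent : (\int[eta]_w (log_rho w)%:E)%E = 0%E)
  (nondegenerate : (0 < 'V_eta[@log_rho R])%E)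
  (d' : measure_display) (T : measurableType d')
  (Q : (int -> R) -> probability T R) (S : nat -> T -> int)
  (Q_quenched : quenched_laws Q S)
  (I : R -> \bar R) (I_rate : quenched_rate_function omega Q S I) :
  let J : R -> R := fun x => fine (I x) in
  (\forall theta \near 0^'+,
     [/\ I theta \is a fin_num, derivable J theta 1
       & derivable (J^`())%classic theta 1]) /\
  (J^`(2))%classic theta @[theta --> 0^'+] --> +oo.
Proof.
have env := elliptic_clipped omega_iid eps0_gt0 elliptic.
set o := clipped omega eps0 in env.
have [[I_ge0 I_lsc _] ldp] := I_rate.
have ldp_o : {ae P, forall w, satisfies_ldp (Q (fun i => o i w)) S I}.
  by apply: filterS2 (clippedE omega_iid elliptic) ldp => w ->.
have centered : mean P (fun w => log_rho (o 0 w)) = 0.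
  exact: (mean_log_rho_clipped omega_iid eps0_gt0 elliptic recurrent).
have var_gt0 : 0 < log_rho_variance P o / 2.
  rewrite divr_gt0// -lte_fin.
  by rewrite (log_rho_variance_clipped omega_iid eps0_gt0 elliptic recurrent).
have [[c cG] GC] := abs_monotone_lyapunov env.
apply: (legendre_second_derivative (lam := fun r => lyapunov P o (expR (- r)))
  (C0 := mean_log_right P o) _ cG GC var_gt0 (lyapunov_asymptotics env centered)).
  by move=> r r0; rewrite expRK; ring.
exact: (rateE env Q_quenched I_ge0 I_lsc ldp_o).
Qed.
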